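(* Let $f\in W^{1,1}(\mathbb{R}^2)\cap W^{1,2}(\mathbb{R}^2)$ be a monotone function. Then there exists at most one point $x_+\in\mathbb{R}^2$ such that $f(x_+)=+\infty$ and at most one point $x_-\in\mathbb{R}^2$ such that $f(x_-)=-\infty$. Furthermore, for any $x\in\mathbb{R}^2\setminus\{x_+,x_-\}$ the function $f$ is continuous at $x$, i.e. $f\in C(\mathbb{R}^2\setminus\{x_+,x_-\})$ (where only those of the points $x_+$, $x_-$ that exist are removed). In particular, $S_f\subset\{x_+,x_-\}$. If, in addition, $f$ is bounded, then $f\in C(\mathbb{R}^2)$.
   Context: $f$ is identified with its precise representative: $f(x)=\lim_{r\to0}\frac{1}{|B(x,r)|}\int_{B(x,r)}f\,dy$ whenever this limit exists in $[-\infty,+\infty]$ (so $f(x)=\pm\infty$ means that the limit of the averages equals $\pm\infty$), and $f(x)=0$ otherwise. $S_f$ denotes the approximate discontinuity set of $f$, i.e. the set of points $x$ that are not Lebesgue points, a Lebesgue point being a point $x$ with $f(x)$ finite and $\lim_{r\to0}\frac{1}{|B(x,r)|}\int_{B(x,r)}|f(y)-f(x)|\,dy=0$. Monotonicity: the perimeter of a measurable set $E\subset\mathbb{R}^2$ is $P(E)=\sup\{\int_E\operatorname{div}\varphi\,dx:\varphi\in C_c^\infty(\mathbb{R}^2;\mathbb{R}^2),\ \|\varphi\|_\infty\le1\}$. A measurable set $E$ of finite perimeter is indecomposable if it cannot be written as a disjoint union $E=A\sqcup B$ of two measurable sets of positive measure with $P(E)=P(A)+P(B)$. A function $f\in W^{1,1}(\mathbb{R}^2)$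 is monotone if the sets $\{f>t\}$ and $\{f<t\}$ are indecomposable for a.e. $t\in\mathbb{R}$. *)

(* Defs.v *)
From HB Require Import structures.
From mathcomp Require Import all_boot all_order all_algebra.
From mathcomp Require Import all_classical all_reals all_analysis.
From mathcomp Require Import measurable_realfun.
Import Order.TTheory GRing.Theory Num.Theory.
Import numFieldNormedType.Exports.

Set Implicit Arguments.
Unset Strict Implicit.
Unset Printing Implicit Defensive.

Local Open Scope classical_set_scope.
Local Open Scope ring_scope.

Section plane.
Context {R : realType}.

(* [measurableTypeR R] is convertible to [R]; it carries the Borel sets. *)
Definition plane_measure :
    {measure set (measurableTypeR R * measurableTypeR R) -> \bar R} :=
  (@lebesgue_measure R \x @lebesgue_measure R)%E.

(* The library's [ball] on a product is a square. *)
Definition disc (x : R * R) (r : R) : set (R * R) :=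
  [set y | (y.1 - x.1) ^+ 2 + (y.2 - x.2) ^+ 2 < r ^+ 2].

Definition avg (f : R * R -> \bar R) (A : set (R * R)) : \bar R :=
  ((plane_measure A)^-1 * \int[plane_measure]_(y in A) f y)%E.

(* The limit is taken in [\bar R], so it may be infinite. *)
Definition precise_rep (f : R * R -> \bar R) (x : R * R) : \bar R :=
  if `[< cvg (avg f (disc x r) @[r --> 0^'+]) >]
  then lim (avg f (disc x r) @[r --> 0^'+]) else 0%E.

Definition lebesgue_point (f : R * R -> \bar R) (x : R * R) : Prop :=
  f x \is a fin_num /\
  (avg (fun y => `|f y - f x|) (disc x r) @[r --> 0^'+] --> 0)%E.

Definition approx_discontinuity_set (f : R * R -> \bar R) : set (R * R) :=
  [set x | ~ lebesgue_point f x].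

Definition e1 : R * R := (1, 0).
Definition e2 : R * R := (0, 1).

Fixpoint Ck (k : nat) (phi : R * R -> R) : Prop :=
  match k with
  | 0 => continuous phi
  | k'.+1 => (forall x, derivable phi x e1 /\ derivable phi x e2) /\
             Ck k' ('D_e1 phi) /\ Ck k' ('D_e2 phi)
  end.

Definition test_function (phi : R * R -> R) : Prop :=
  (forall k, Ck k phi) /\ compact (closure [set x | phi x != 0]).

Definition inLp (p : R) (f : R * R -> \bar R) : Prop :=
  measurable_fun [set: measurableTypeR R * measurableTypeR R] f /\
  ('N[plane_measure]_p%:E[f] < +oo)%E.

Definition weak_derivative (v : R * R) (f : R * R -> \bar R) (g : R * R -> R) :
    Prop :=
  forall phi, test_function phi ->
  (\int[plane_measure]_x (f x * ('D_v phi x)%:E) =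
   - \int[plane_measure]_x (g x * phi x)%:E)%E.

Definition sobolev_W1 (p : R) (f : R * R -> \bar R) : Prop :=
  inLp p f /\
  exists g1 g2 : R * R -> R,
    [/\ inLp p (EFin \o g1), inLp p (EFin \o g2),
        weak_derivative e1 f g1 & weak_derivative e2 f g2].

Definition perimeter (E : set (R * R)) : \bar R :=
  ereal_sup [set z | exists phi1 phi2 : R * R -> R,
    [/\ test_function phi1, test_function phi2,
        forall x, phi1 x ^+ 2 + phi2 x ^+ 2 <= 1 &
        z = (\int[plane_measure]_(x in E)
              ('D_e1 phi1 x + 'D_e2 phi2 x)%:E)%E]].

Definition measurable_plane (E : set (R * R)) : Prop :=
  measurable (E : set (measurableTypeR R * measurableTypeR R)).

Definition indecomposable (E : set (R * R)) : Prop :=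
  [/\ measurable_plane E, (perimeter E < +oo)%E &
  ~ exists A B : set (R * R),
      [/\ measurable_plane A /\ measurable_plane B,
          E = A `|` B, A `&` B = set0,
          (0 < plane_measure A)%E /\ (0 < plane_measure B)%E &
          perimeter E = (perimeter A + perimeter B)%E]].

Definition monotone_function (f : R * R -> \bar R) : Prop :=
  {ae @lebesgue_measure R, forall t : R,
    indecomposable [set x | (t%:E < f x)%E] /\
    indecomposable [set x | (f x < t%:E)%E]}.

Definition bounded_ereal (f : R * R -> \bar R) : Prop :=
  exists M : R, forall x, (`|f x| <= M%:E)%E.

(* [f] is finite and continuous at every point of [A]; for open [A] this is
   membership in the space of real-valued continuous functions on [A]. *)
Definition continuous_at_points (A : set (R * R)) (f : R * R -> \bar R) : Prop :=
  forall x, A x -> f x \is a fin_num /\ {for x, continuous f}.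

End plane.

(* Main.v *)
(* Testing the weak gradient with cut-offs shows that, off a null set, f is
   absolutely continuous along horizontal and vertical lines, with the weak
   partial derivatives as derivatives. Since the gradient is square integrable,
   averaging over the possible positions of the sides produces around each point
   arbitrarily small rectangles K on whose boundary f stays within epsilon of a
   constant c. For t > c + epsilon the set E = {f > t} has vanishing density
   along the boundary of K, so that smooth cut-offs of K give
   P(E) = P(E inter K) + P(E minus K), and indecomposability puts almost all of E
   either inside K or outside K; likewise for {f < t} with t < c - epsilon. Hence
   f <= c + epsilon almost everywhere in K or almost everywhere off K, and
   similarly from below. Letting K shrink to a point yields an essential limit in
   [-oo, +oo] at every point; it is the value of the precise representative,
   which is therefore continuous into [-oo, +oo]. The same dichotomy for small
   rectangles shows that the value +oo (or -oo) cannot be taken at two points. *)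
From HB Require Import structures.
Require Import Defs.
From mathcomp Require Import all_boot all_order all_algebra.
From mathcomp Require Import all_classical all_reals all_analysis.
From mathcomp Require Import measurable_realfun.
From mathcomp Require Import ring lra.
Import Order.TTheory GRing.Theory Num.Theory.
Import numFieldNormedType.Exports.

Set Implicit Arguments.
Unset Strict Implicit.
Unset Printing Implicit Defensive.
Local Open Scope classical_set_scope.
Local Open Scope ring_scope.

(** * Smooth cut-off functions *)

(** Square integrability of the gradient matters through scaling. On a square of side 4 rho it makes
    the integral of |grad f| an o(rho), uniformly in the centre, while each side of the rectangle
    may be chosen in a window of length rho; so some line in the window carries an arbitrarily small
    integral of the gradient. The substantial half of the perimeter identity is superadditivity.
    Test fields for the two pieces are glued by a cut-off whose gradient has size n on strips of
    width 1/n along the boundary, so the set must occupy measure o(1/n) of these strips. The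
    constants c of the shrinking rectangles are not known to be bounded or to converge. The limit at
    a point is therefore defined as their upper limit, and the dichotomy yields both one-sided
    bounds. All cut-offs are built from the functions x^-n exp (-1/x), so that derivatives are
    explicit and smoothness reduces to closure under the rules of calculus. *)

Section flat.
Context {R : realType}.
Implicit Types (x : R) (n : nat).

(** The negative powers make the family stable under differentiation ([is_derive_flat]); [flat 0] is
    the classical exp (-1/x) extended by 0. *)
Definition flat n x : R := if 0 < x then x ^- n * expR (- x^-1) else 0.

Lemma flat_le0 n x : x <= 0 -> flat n x = 0.
Proof. by rewrite /flat ltNge => ->. Qed.

Lemma flat_ge0 n x : 0 <= flat n x.
Proof.
by rewrite /flat; case: ifPn => // x0; rewrite mulr_ge0 ?expR_ge0 ?invr_ge0 ?exprn_ge0 ?ltW.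
Qed.

Lemma flat0E x : 0 < x -> flat 0 x = expR (- x^-1).
Proof. by rewrite /flat => ->; rewrite expr0 invr1 mul1r. Qed.

Lemma flat_gt0 n x : 0 < x -> 0 < flat n x.
Proof. by move=> x0; rewrite /flat x0 mulr_gt0 ?expR_gt0// invr_gt0 exprn_gt0. Qed.

Lemma mul_flatS n x : x * flat n.+1 x = flat n x.
Proof.
rewrite /flat; case: ifPn => [x0|_]; last by rewrite mulr0.
by rewrite mulrA exprS invfM mulrA divff ?gt_eqF// mul1r.
Qed.

(** With y = 1/x this is y^n <= n! exp y, a single term of the exponential series. *)
Lemma flat_le n x : flat n x <= n`!%:R.
Proof.
have [x0|x0] := leP x 0; first by rewrite flat_le0.
rewrite /flat x0 expRN.
have y0 : 0 < x^-1 by rewrite invr_gt0.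
rewrite -exprVn ler_pdivrMr ?expR_gt0//.
case: n => [|n]; first by rewrite expr0 fact0 mul1r; have := expR_ge1Dx x^-1; lra.
have := expR_ge1Dxn n (ltW y0).
rewrite -ler_pdivrMl ?ltr0n ?fact_gt0// mulrC; lra.
Qed.

Lemma flat_le_lin n x : 0 <= x -> flat n x <= n.+1`!%:R * x.
Proof.
by move=> x0; rewrite -mul_flatS mulrC ler_wpM2r// flat_le.
Qed.

(** Only 0 is delicate: for h > 0 the difference quotient there is [flat n.+1 h], which
    [flat_le_lin] sends to 0. *)
Lemma is_derive_flat n x :
  is_derive x 1 (flat n) (flat n.+2 x - n%:R * flat n.+1 x).
Proof.
have [x0|x0|->] := ltgtP x 0.
- rewrite !flat_le0 ?(ltW x0)// mulr0 subr0.
  apply: (@near_eq_is_derive _ _ _ (cst 0)).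
  by near=> y; rewrite flat_le0// ltW//; near: y; exact: lt_nbhsl.
- pose g (y : R) : R := y^-1.
  have dg : is_derive x 1 g (- x ^- 2).
    have xN0 : x != 0 by rewrite gt_eqF.
    apply: (is_derive_eq (@is_deriveV _ id x _ _ xN0 (is_derive_id _ _))).
    by rewrite /GRing.scale/= mulr1.
  have de : is_derive x 1 (expR \o (- g)) (expR (- x^-1) * - (- x ^- 2)).
    exact: (@is_derive1_comp _ expR (- g) x _ _ (is_derive_expR _) (is_deriveN dg)).
  apply: (@near_eq_is_derive _ _ _ (g ^+ n * (expR \o (- g)))).
    near=> y; have -> : flat n y = y ^- n * expR (- y^-1).
      by rewrite /flat ifT//; near: y; exact: lt_nbhsr.
    by rewrite exprfctE /= -exprVn.
  apply: is_derive_eq.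
  rewrite exprfctE /flat x0 /g /GRing.scale/= opprK.
  case: n => [|n]; first by rewrite !expr0 !mul0r mulr0 addr0 subr0 mul1r mulrC.
  rewrite -!exprVn !exprS/=; ring.
- rewrite !flat_le0// mulr0 subr0.
  have lim0 : h^-1 *: (flat n (h *: (1 : R) + 0) - flat n 0) @[h --> (0:R)^'] --> (0:R).
    apply/cvgrPdist_le => e e0.
    have e'0 : 0 < e / n.+2`!%:R by rewrite divr_gt0// ltr0n fact_gt0.
    near=> h.
    rewrite sub0r normrN addr0 /GRing.scale/= mulr1 (flat_le0 n (lexx 0)) subr0.
    have [h0|h0] := leP h 0; first by rewrite flat_le0// mulr0 normr0 ltW.
    rewrite -mul_flatS mulrA mulVf ?gt_eqF// mul1r ger0_norm ?flat_ge0//.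
    rewrite (le_trans (flat_le_lin _ (ltW h0)))// mulrC -ler_pdivlMr ?ltr0n ?fact_gt0//.
    by apply: ltW; near: h; apply: nbhs_dnbhs; exact: lt_nbhsl.
  apply: DeriveDef; first by apply/cvg_ex; exists 0.
  exact: cvg_lim lim0.
Unshelve. all: by end_near. Qed.

Lemma flat_continuous n : continuous (flat n).
Proof.
move=> x; apply/differentiable_continuous/derivable1_diffP.
by have [] := is_derive_flat n x.
Qed.

End flat.

Section smooth.
Context {R : realType}.

(* A class of functions that is closed under partial derivatives by
   construction, hence consists of C^oo functions; it contains all the cut-off
   functions below. *)
Inductive smooth : (R * R -> R) -> Prop :=
| smooth_cst c : smooth (fun=> c)
| smooth_fst : smooth fst
| smooth_snd : smooth snd
| smoothD f g : smooth f -> smooth g -> smooth (fun x => f x + g x)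
| smoothM f g : smooth f -> smooth g -> smooth (fun x => f x * g x)
| smooth_flat n f : smooth f -> smooth (fun x => flat n (f x))
| smooth_Ck f : (forall k, Ck k f) -> smooth f.

Lemma smoothN f : smooth f -> smooth (fun x => - f x).
Proof.
move=> sf; rewrite (_ : (fun _ => _) = (fun x => -1 * f x)).
  by apply: smoothM => //; exact: smooth_cst.
by apply/funext => x; rewrite mulN1r.
Qed.

Lemma smoothB f g : smooth f -> smooth g -> smooth (fun x => f x - g x).
Proof. by move=> sf sg; apply: smoothD => //; exact: smoothN. Qed.

(** Restriction to a line makes the one-variable chain rule available for directional
    derivatives. *)
Lemma derive_line (g : R * R -> R) x v :
  'D_v g x = 'D_1 (fun h : R => g (h *: v + x)) 0.
Proof.
rewrite /derive; set g1 := fun h => h^-1 *: _; set g2 := fun h => h^-1 *: _.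
suff -> : g1 = g2 by []; apply/funext => h; rewrite /g1 /g2/=.
by rewrite addr0 scale0r add0r [_%:A]mulr1.
Qed.

Lemma is_derive_affine_line (f : R * R -> R) x v (a : R) :
  (forall h : R, f (h *: v + x) = h * a + f x) -> is_derive x v f a.
Proof.
move=> fE; have : is_derive (0 : R) (1 : R) (fun h : R => f (h *: v + x)) a.
  rewrite (_ : (fun _ => _) = (id * cst a) + cst (f x)); last exact/funext.
  apply: is_derive_eq.
  by rewrite addr0 scaler0 add0r /GRing.scale/= mulr1.
by move=> [d1 d2]; apply: (DeriveDef ((derivable1P _ _ _).2 d1)); rewrite derive_line.
Qed.

Lemma is_derive_flat_comp n (f : R * R -> R) (df : R) x v :
  is_derive x v f df ->
  is_derive x v (fun y => flat n (f y))
    ((flat n.+2 (f x) - n%:R * flat n.+1 (f x)) * df).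
Proof.
move=> [/derivable1P dfx dfE].
have df1 : is_derive (0 : R) 1 (fun h : R => f (h *: v + x)) df.
  by apply: (DeriveDef dfx); rewrite -derive_line.
have := @is_derive1_comp _ (flat n) _ 0 _ _ (is_derive_flat n _) df1.
rewrite scale0r add0r => -[d1 d2].
by apply: (DeriveDef ((derivable1P _ _ _).2 d1)); rewrite derive_line.
Qed.

(** The derivative is returned as a member of the class, which lets [Ck_smooth] iterate. *)
Lemma smooth_derive f : smooth f ->
  continuous f /\ forall v, v = e1 \/ v = e2 ->
    exists2 df, smooth df & forall x, is_derive x v f (df x).
Proof.
elim=> {f} [c|||f g sf [cf df] sg [cg dg]|f g sf [cf df] sg [cg dg]|n f sf [cf df]|f Cf].
- by split; [exact: cst_continuous|move=> v _; exists (fun=> 0); [exact: smooth_cst|move=> x; exact: is_derive_cst]].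
- split; first by move=> x; exact: cvg_fst.
  move=> v _; exists (fun=> v.1); first exact: smooth_cst.
  by move=> x; exact: is_derive_affine_line.
- split; first by move=> x; exact: cvg_snd.
  move=> v _; exists (fun=> v.2); first exact: smooth_cst.
  by move=> x; exact: is_derive_affine_line.
- split; first by move=> x; apply: cvgD; [exact: cf|exact: cg].
  move=> v /[dup] /df[f' sf' f'E] /dg[g' sg' g'E].
  exists (fun x => f' x + g' x); first exact: smoothD.
  by move=> x; exact: is_deriveD.
- split; first by move=> x; apply: cvgM; [exact: cf|exact: cg].
  move=> v /[dup] /df[f' sf' f'E] /dg[g' sg' g'E].
  exists (fun x => f x * g' x + g x * f' x); first by apply: smoothD; exact: smoothM.
  by move=> x; exact: is_deriveM.
- split; first by move=> x; apply: continuous_comp; [exact: cf|exact: flat_continuous].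
  move=> v /df[f' sf' f'E].
  exists (fun x => (flat n.+2 (f x) - n%:R * flat n.+1 (f x)) * f' x).
    apply: smoothM => //; apply: smoothB; first exact: smooth_flat.
    by apply: smoothM; [exact: smooth_cst|exact: smooth_flat].
  by move=> x; exact: is_derive_flat_comp.
- split; first exact: (Cf 0).
  move=> v [->|->].
    exists ('D_e1 f); first by apply: smooth_Ck => k; have [_ []] := Cf k.+1.
    by move=> x; apply/derivableP; have [/(_ x)[]] := Cf 1.
  exists ('D_e2 f); first by apply: smooth_Ck => k; have [_ []] := Cf k.+1.
  by move=> x; apply/derivableP; have [/(_ x)[]] := Cf 1.
Qed.

Lemma Ck_smooth k f : smooth f -> Ck k f.
Proof.
elim: k f => [|k IH] f /smooth_derive[cf df]; first exact: cf.
have [f1 sf1 f1E] := df _ (or_introl erefl).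
have [f2 sf2 f2E] := df _ (or_intror erefl).
have E1 : 'D_e1 f = f1 by apply/funext => x; case: (f1E x).
have E2 : 'D_e2 f = f2 by apply/funext => x; case: (f2E x).
split; first by move=> x; split; [case: (f1E x)|case: (f2E x)].
by rewrite E1 E2; split; exact: IH.
Qed.

End smooth.

(** * Measurability in the plane *)

Section integral_eq_preimage.
Context d (T : measurableType d) d' (U : measurableType d') (R : realType).
Context (m : {measure set T -> \bar R}) (D : set T) (p : T -> U).
Context (G : set (set U)) (f g : T -> \bar R).
Hypotheses (mD : measurable D) (mp : measurable_fun [set: T] p).
Hypotheses (GE : @measurable _ U = <<s G >>) (IG : setI_closed G).
Hypotheses (intf : m.-integrable D f) (intg : m.-integrable D g).
Hypothesis fgD : (\int[m]_(x in D) f x = \int[m]_(x in D) g x)%E.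
Hypothesis fgG : forall B, G B ->
  (\int[m]_(x in D `&` p @^-1` B) f x = \int[m]_(x in D `&` p @^-1` B) g x)%E.

(** The pi-lambda argument for functions without sign: equality on all of [D] takes care of
    complements, and integrability permits the subtraction. *)
Lemma integral_eq_preimage B : measurable B ->
  (\int[m]_(x in D `&` p @^-1` B) f x = \int[m]_(x in D `&` p @^-1` B) g x)%E.
Proof.
have mpre C : measurable C -> measurable (D `&` p @^-1` C).
  by move=> mC; apply: measurableI => //; rewrite -[X in measurable X]setTI; exact: mp.
have DI C : D `&` p @^-1` C `<=` D by move=> x [].
rewrite GE; apply: (@dynkin_induction _ _ G (fun B => \int[m]_(x in D `&` p @^-1` B) f x =
  \int[m]_(x in D `&` p @^-1` B) g x)%E GE IG) => //.
- by rewrite preimage_setT setIT.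
- move=> C mC fgC.
  have splitC h : m.-integrable D h -> (\int[m]_(x in D) h x =
      \int[m]_(x in D `&` p @^-1` C) h x + \int[m]_(x in D `&` p @^-1` (~` C)) h x)%E.
    move=> ih; rewrite -integral_setU//; first 1 last.
    - exact: mpre.
    - exact/mpre/measurableC.
    - by apply: measurable_funS (measurable_int _ ih) => // x [] [].
    - by apply/disj_setPS => x [[_ +] [_]]; exact.
    congr integral; apply/seteqP; split => [x Dx|x [] []//].
    by have [Cx|Cx] := pselect (C (p x)); [left|right].
  have fin : (\int[m]_(x in D `&` p @^-1` C) g x)%E \is a fin_num.
    by apply: integrable_fin_num; [exact: mpre|apply: integrableS intg => //; exact: mpre].
  have := fgD; rewrite !splitC// fgC => /(congr1 (fun z => z - \int[m]_(x in D `&` p @^-1` C) g x)%E).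
  by rewrite ![(\int[m]_(x in D `&` p @^-1` C) g x + _)%E]addeC !addeK.
- move=> F mF tF fgF; rewrite preimage_bigcup setI_bigcupr.
  have tDF : trivIset [set: nat] (fun i => D `&` p @^-1` F i).
    apply/trivIsetP => i j _ _ ij; rewrite -subset0 => x [[_ Fi] [_ Fj]].
    have /trivIsetP/(_ i j I I ij) := tF; rewrite -subset0 => /(_ (p x)).
    by apply; split; [exact: Fi|exact: Fj].
  have sD : \bigcup_i (D `&` p @^-1` F i) `<=` D by move=> x [i _ []].
  have mDF i : measurable (D `&` p @^-1` F i) by exact: mpre.
  have mB := bigcupT_measurable _ mDF.
  rewrite !integral_bigcup//; [|by apply: integrableS intg..|by apply: integrableS intf].
  by apply: eq_eseriesr.
Qed.

End integral_eq_preimage.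

Section plane_measurability.
Context {R : realType}.
Local Notation plane := (measurableTypeR R * measurableTypeR R)%type.
Local Notation mu := (@plane_measure R).

(** Half-open on the left, so that intersecting with []x, +oo[] in either coordinate gives another
    [rect], and so that indicators of the sides are differences of [heavi]. *)
Definition rect (a b c d : R) : set (R * R) := `]a, b] `*` `]c, d].

Lemma measurable_rect a b c d : measurable (rect a b c d : set plane).
Proof. exact: measurableX. Qed.

Lemma plane_measureX (A B : set (measurableTypeR R)) : measurable A -> measurable B ->
  (mu (A `*` B) = lebesgue_measure A * lebesgue_measure B)%E.
Proof. exact: product_measure1E. Qed.

Lemma plane_measure_rect_lty a b c d : (mu (rect a b c d) < +oo)%E.
Proof.
rewrite /rect plane_measureX// !lebesgue_measure_itv/=.
by do 2 case: ifP => _; rewrite ?mul0e ?mule0// -!EFinB -EFinM ltry.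
Qed.

(** An open set is the countable union of the rational half-open rectangles that it contains. *)
Lemma open_measurable_plane (U : set (R * R)) : open U -> measurable (U : set plane).
Proof.
move=> oU.
pose box (q : (rat * rat) * (rat * rat)) := rect (ratr q.1.1) (ratr q.1.2) (ratr q.2.1) (ratr q.2.2).
have -> : U = \bigcup_(q in [set q | box q `<=` U]) box q.
  apply/seteqP; split => [[x y] Uxy|xy [q qU] /qU//].
  have /nbhs_ballP[e /= e0 eU] := open_nbhs_nbhs (conj oU Uxy).
  have lo (z : R) : z - e < z by lra.
  have hi (z : R) : z < z + e by lra.
  have [qa /[!in_itv]/= /andP[a1 a2]] := rat_in_itvoo (lo x).
  have [qb /[!in_itv]/= /andP[b1 b2]] := rat_in_itvoo (hi x).
  have [qc /[!in_itv]/= /andP[c1 c2]] := rat_in_itvoo (lo y).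
  have [qd /[!in_itv]/= /andP[d1 d2]] := rat_in_itvoo (hi y).
  exists ((qa, qb), (qc, qd)); last by rewrite /box /rect/= !in_itv/= a2 (ltW b1) c2 (ltW d1).
  move=> [u v]; rewrite /box /rect/= !in_itv/= => -[/andP[ua ub] /andP[vc vd]].
  apply: eU; split; rewrite /ball/= /ball/= ltr_norml; apply/andP; split; lra.
rewrite bigcup_mkcond; apply: countable_bigcupT_measurable => // q.
by case: ifP => _; [exact: measurable_rect|exact: measurable0].
Qed.

Lemma continuous_measurable_plane (phi : R * R -> R) :
  continuous phi -> measurable_fun [set: plane] phi.
Proof.
move=> /continuousP cphi; apply: (measurability _ (RGenOInfty.measurableE R)).
move=> _ [_ [a ->]] <-; rewrite setTI; apply: open_measurable_plane.
by apply: cphi; exact: interval_open.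
Qed.

(** The pi-lambda argument is run three times: in the first coordinate within a half-plane of the
    second, then in the second coordinate, then on products, which generate the measurable sets of
    the plane. *)
Lemma ae_eq_rect a b c d (f g : plane -> \bar R) :
  mu.-integrable (rect a b c d) f -> mu.-integrable (rect a b c d) g ->
  (forall a' b' c' d', rect a' b' c' d' `<=` rect a b c d ->
    \int[mu]_(x in rect a' b' c' d') f x = \int[mu]_(x in rect a' b' c' d') g x)%E ->
  ae_eq mu (rect a b c d) f g.
Proof.
move=> intf intg fg.
have mfst : measurable_fun [set: plane] fst by exact: measurable_fst.
have msnd : measurable_fun [set: plane] snd by exact: measurable_snd.
pose G := @RGenOInfty.G R.
have GE : @measurable _ (measurableTypeR R) = <<s G >> by exact: RGenOInfty.measurableE.
have IG : setI_closed G.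
  move=> _ _ [x ->] [y ->]; exists (Num.max x y).
  apply/seteqP; split => z /=; rewrite !in_itv/= !andbT gt_max.
    by move=> [-> ->].
  by move=> /andP[].
have mD := measurable_rect a b c d.
have mpre1 (B : set (measurableTypeR R)) : measurable B -> measurable (fst @^-1` B : set plane).
  by move=> mB; rewrite -[X in measurable X]setTI; exact: mfst.
have mpre2 (B : set (measurableTypeR R)) : measurable B -> measurable (snd @^-1` B : set plane).
  by move=> mB; rewrite -[X in measurable X]setTI; exact: msnd.
have intS h (A : set plane) : mu.-integrable (rect a b c d) h -> measurable A ->
    mu.-integrable (rect a b c d `&` A) h.
  by move=> ih mA; apply: integrableS ih => //; exact: measurableI.
have E1 x : rect a b c d `&` snd @^-1` `]x, +oo[ = rect a b (Num.max c x) d.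
  apply/seteqP; split => -[u v]; rewrite /rect/= !in_itv/= ?andbT gt_max.
    by move=> [[/andP[-> ->] /andP[-> ->]] ->].
  by move=> [/andP[-> ->] /andP[/andP[-> ->] ->]].
have E2 x y : rect a b c d `&` snd @^-1` `]x, +oo[ `&` fst @^-1` `]y, +oo[ =
    rect (Num.max a y) b (Num.max c x) d.
  rewrite E1; apply/seteqP; split => -[u v]; rewrite /rect/= !in_itv/= ?andbT !gt_max.
    by move=> [[/andP[-> ->] ->] ->].
  by move=> [/andP[/andP[-> ->] ->] ->].
have step1 x A : measurable A ->
    (\int[mu]_(z in rect a b c d `&` snd @^-1` `]x, +oo[ `&` fst @^-1` A) f z =
     \int[mu]_(z in rect a b c d `&` snd @^-1` `]x, +oo[ `&` fst @^-1` A) g z)%E.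
  move=> mA; apply: (integral_eq_preimage _ mfst GE IG) => //.
  - by apply: measurableI => //; exact: mpre2.
  - by apply: intS => //; apply: mpre2.
  - by apply: intS => //; apply: mpre2.
  - by rewrite E1; apply: fg; rewrite -E1; exact: subIsetl.
  - move=> _ [y ->]; rewrite E2; apply: fg; rewrite -E2.
    by apply: subset_trans; exact: subIsetl.
have step2 A B : measurable A -> measurable B ->
    (\int[mu]_(z in rect a b c d `&` fst @^-1` A `&` snd @^-1` B) f z =
     \int[mu]_(z in rect a b c d `&` fst @^-1` A `&` snd @^-1` B) g z)%E.
  move=> mA mB; apply: (integral_eq_preimage _ msnd GE IG) => //.
  - by apply: measurableI => //; exact: mpre1.
  - by apply: intS => //; exact: mpre1.
  - by apply: intS => //; exact: mpre1.
  (* []c - 1, +oo[] contains []c, d]], so this half-plane does not cut the rectangle. *)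
  - suff E3 : rect a b c d `&` snd @^-1` `]c - 1, +oo[ `&` fst @^-1` A =
        rect a b c d `&` fst @^-1` A by rewrite -E3; exact: step1.
    apply/seteqP; split => -[u v]; rewrite /rect/= !in_itv/= ?andbT; first by move=> [[[]]].
    move=> [[? /andP[? ?]] ?]; split => //; split; first by split => //; apply/andP.
    lra.
  - by move=> _ [y ->]; have := step1 y A mA; rewrite setIAC.
apply: integral_ae_eq => //; first exact: measurable_int intg.
move=> E ED mE; rewrite -(setIidr ED).
have prodE := @measurable_prod_measurableType _ _ (measurableTypeR R) (measurableTypeR R).
apply: (integral_eq_preimage (p := id) _ _ prodE) => //.
- move=> _ _ [A mA [B mB <-]] [A' mA' [B' mB' <-]].
  exists (A `&` A'); first exact: measurableI.
  by exists (B `&` B'); [exact: measurableI|rewrite setXI].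
- exact: fg.
- by move=> _ [A mA [B mB <-]]; have := step2 A B mA mB; rewrite -setIA.
Qed.

Lemma plane_sigma_finite : sigma_finite [set: plane] mu.
Proof.
exists (fun n : nat => rect (- n%:R) n%:R (- n%:R) n%:R) => [|n]; last first.
  by split; [exact: measurable_rect|exact: plane_measure_rect_lty].
apply/esym; rewrite -subTset => x _.
have [n xn] : exists n : nat, `|x| < n%:R by exists (Num.truncn `|x|).+1; exact: truncnS_gt.
exists n => //; move: xn; rewrite prod_normE gt_max !ltr_norml => /andP[/andP[a b] /andP[c d]].
by split; rewrite /= in_itv/= ?a ?c ltW.
Qed.

(* An alias of [plane_measure] that can carry the sigma-finite structure needed for Fubini. *)
Definition planeS : set plane -> \bar R := @plane_measure R.
HB.instance Definition _ := Measure.on planeS.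
HB.instance Definition _ := Measure_isSigmaFinite.Build _ _ _ planeS plane_sigma_finite.

End plane_measurability.

Lemma integrable_indic_lty d (T : measurableType d) (R : realType)
    (m : {measure set T -> \bar R}) (A : set T) : measurable A -> (m A < +oo)%E ->
  m.-integrable [set: T] (fun x => (\1_A x)%:E).
Proof.
move=> mA Aoo; apply/integrableP; split; first exact/measurable_EFinP.
rewrite (eq_integral (fun x => (\1_A x)%:E)); first by rewrite integral_indic// setIT.
by move=> x _; rewrite abse_EFin ger0_norm.
Qed.

(** * Test functions and weak derivatives *)

Section test_functions.
Context {R : realType}.
Local Notation plane := (measurableTypeR R * measurableTypeR R)%type.
Local Notation mu := (@plane_measure R).
Implicit Types (h phi : R * R -> R) (K : set (R * R)).

Lemma compact_sub_rect K : compact K -> exists M : R, K `<=` rect (- M) M (- M) M.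
Proof.
move=> /compact_bounded[M [_ /(_ (M + 1))]].
rewrite ltrDl ltr01 => /(_ isT) KM; exists (M + 2) => x Kx.
have := KM _ Kx; rewrite /= prod_normE ge_max => /andP[].
rewrite !ler_norml /rect/= !in_itv/= => /andP[? ?] /andP[? ?].
by split; apply/andP; split; lra.
Qed.

Lemma compact_support_bounded K h : continuous h -> compact K ->
  (forall x, ~ K x -> h x = 0) -> exists C : R, forall x, `|h x| <= C.
Proof.
move=> ch cK h0.
have /compact_bounded[M [_ /(_ (`|M| + 1))]] : compact (h @` K).
  by apply: continuous_compact => //; exact: continuous_subspaceT.
rewrite (le_lt_trans (ler_norm M)) ?ltrDl// => /(_ isT) hM.
exists (`|M| + 1) => x; have [Kx|Kx] := pselect (K x).
  by apply: hM; exists x.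
by rewrite h0// normr0 addr_ge0.
Qed.

Lemma compact_support_integrable K h : continuous h -> compact K ->
  (forall x, ~ K x -> h x = 0) -> mu.-integrable [set: plane] (EFin \o h).
Proof.
move=> ch cK h0; have [C hC] := compact_support_bounded ch cK h0.
have [M KM] := compact_sub_rect cK.
have mr := measurable_rect (- M) M (- M) M.
have i1 : mu.-integrable [set: plane]
    (fun x => C%:E * (\1_(rect (- M) M (- M) M) x)%:E)%E.
  by apply: integrableZl => //; apply: integrable_indic_lty => //; exact: plane_measure_rect_lty.
apply: le_integrable i1 => //.
  by apply/measurable_EFinP; exact: continuous_measurable_plane.
move=> x _; rewrite /= lee_fin normrM.
have [Kx|Kx] := pselect (K x).
  by rewrite indicE mem_set ?normr1 ?mulr1; [exact: (le_trans (hC x) (ler_norm _))|exact: KM].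
by rewrite h0// normr0 mulr_ge0.
Qed.

Lemma smooth_test_function h M : smooth h ->
  (forall x, h x != 0 -> `|x.1| <= M /\ `|x.2| <= M) -> test_function h.
Proof.
move=> sh hM; split; first by move=> k; exact: Ck_smooth.
have cM : compact (`[- M, M] `*` `[- M, M] : set (R * R)).
  by apply: compact_setX; exact: segment_compact.
apply: (subclosed_compact _ cM); first exact: closed_closure.
have clM : closed (`[- M, M] `*` `[- M, M] : set (R * R)).
  apply: compact_closed => //; exact: norm_hausdorff.
apply: (subset_trans _ clM); apply: closure_subset => x /hM[x1 x2].
by split; rewrite /= in_itv/= -ler_norml.
Qed.

Lemma derive_support phi v x : ~ closure [set y | phi y != 0] x -> 'D_v phi x = 0.
Proof.
move=> clx; have n0 : \near x, phi x = cst 0 x.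
  have : nbhs x (~` closure [set y | phi y != 0]).
    apply: open_nbhs_nbhs; split => //; exact/closed_openC/closed_closure.
  apply: filterS => y /= cly; apply/eqP; apply: contrapT => /negP py.
  exact/cly/subset_closure.
by rewrite (near_eq_derive _ n0) derive_cst.
Qed.

Lemma test_function_continuous phi : test_function phi -> continuous phi.
Proof. by move=> [/(_ 0)]. Qed.

Lemma test_function_derive_continuous phi v : test_function phi ->
  v = e1 \/ v = e2 -> continuous ('D_v phi).
Proof.
move=> [H _]; have [_ [c1 c2]] := H 1%N.
by case=> ->; [exact: c1|exact: c2].
Qed.

Lemma test_function_derive_bounded phi v : test_function phi ->
  v = e1 \/ v = e2 -> exists C : R, forall x, `|'D_v phi x| <= C.
Proof.
move=> tphi ve; apply: (compact_support_bounded _ tphi.2).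
  exact: test_function_derive_continuous.
by move=> x; exact: derive_support.
Qed.

Lemma test_function_derive_integrable phi v : test_function phi ->
  v = e1 \/ v = e2 -> mu.-integrable [set: plane] (EFin \o 'D_v phi).
Proof.
move=> tphi ve; apply: (compact_support_integrable _ tphi.2).
  exact: test_function_derive_continuous.
by move=> x; exact: derive_support.
Qed.

(** At [k = 0] all four factors equal [flat 0 1], whence the fourth power that normalises [cutoff 0]
    to 1. *)
Definition cutoff (k : R) (x : R * R) : R :=
  (flat 0 1) ^- 4 * (flat 0 (1 + k * x.1) * flat 0 (1 - k * x.1) *
    (flat 0 (1 + k * x.2) * flat 0 (1 - k * x.2))).

Lemma smooth_affine (a k : R) (f : R * R -> R) : smooth f ->
  smooth (fun x => a + k * f x).
Proof.
by move=> sf; apply: smoothD; [exact: smooth_cst|apply: smoothM => //; exact: smooth_cst].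
Qed.

Lemma smooth_affineB (a k : R) (f : R * R -> R) : smooth f ->
  smooth (fun x => a - k * f x).
Proof.
by move=> sf; apply: smoothB; [exact: smooth_cst|apply: smoothM => //; exact: smooth_cst].
Qed.

Lemma smooth_cutoff k : smooth (cutoff k).
Proof.
apply: smoothM; first exact: smooth_cst.
apply: smoothM; apply: smoothM; apply: smooth_flat; try exact/smooth_affine/smooth_fst;
  try exact/smooth_affine/smooth_snd.
- exact/smooth_affineB/smooth_fst.
- exact/smooth_affineB/smooth_snd.
Qed.

Lemma cutoff0 x : cutoff 0 x = 1.
Proof.
have f1 : flat 0 1 != 0 :> R by rewrite gt_eqF// flat_gt0.
rewrite /cutoff !mul0r !addr0 !subr0 -!expr2 -exprM mulVf// expf_neq0//.
Qed.

Lemma cutoff_support k x : 0 < k -> cutoff k x != 0 -> `|x.1| <= k^-1 /\ `|x.2| <= k^-1.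
Proof.
move=> k0; apply: contraNP => /not_andP.
have kV : k * k^-1 = 1 by rewrite divff// gt_eqF.
rewrite /cutoff !ler_norml => -[] /negP /nandP[] /=; rewrite -ltNge => xk.
- by rewrite (flat_le0 0 (x := 1 + k * x.1)) ?mul0r ?mulr0//; nra.
- by rewrite (flat_le0 0 (x := 1 - k * x.1)) ?mulr0 ?mul0r ?mulr0//; nra.
- by rewrite (flat_le0 0 (x := 1 + k * x.2)) ?mul0r ?mulr0//; nra.
- by rewrite (flat_le0 0 (x := 1 - k * x.2)) ?mulr0//; nra.
Qed.

Lemma cutoffE k x : cutoff k x = cutoff 1 (k *: x).
Proof. by rewrite /cutoff !mul1r. Qed.

Lemma is_derive_scale phi k x v (b : R) : is_derive (k *: x) v phi b ->
  is_derive x v (fun y => phi (k *: y)) (k * b).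
Proof.
move=> [/derivable1P d1 dE].
have d2 : is_derive (k * 0 : R) (1 : R) (fun h : R => phi (h *: v + k *: x)) b.
  by rewrite mulr0; apply: (DeriveDef d1); rewrite -derive_line.
have dk : is_derive (0 : R) (1 : R) (fun h : R => k * h) k.
  by apply: (is_derive_eq (@is_deriveZ _ _ _ id k _ _ _ (is_derive_id _ _))); exact: mulr1.
have := @is_derive1_comp _ _ _ _ _ _ d2 dk.
rewrite (_ : _ \o _ = fun h : R => phi (k *: (h *: v + x))); last first.
  by apply/funext => h /=; rewrite scalerDr scalerA.
by move=> [d3 d3E]; apply: (DeriveDef ((derivable1P _ _ _).2 d3)); rewrite derive_line d3E mulrC.
Qed.

(** [b] is the derivative of [cutoff 1]; by scaling, the derivative of [cutoff k] is O(k) with a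
    constant independent of [k]. *)
Lemma cutoff_is_derive v : v = e1 \/ v = e2 -> exists b : R * R -> R, exists C : R,
  (forall x, `|b x| <= C) /\ continuous b /\
  forall k x, is_derive x v (cutoff k) (k * b (k *: x)).
Proof.
move=> ve; exists ('D_v (cutoff 1)).
have tc : test_function (cutoff 1).
  by apply: (smooth_test_function (M := 1^-1)) => [|x]; [exact: smooth_cutoff|exact: cutoff_support].
have [C hC] := test_function_derive_bounded tc ve.
exists C; split => //; split; first exact: test_function_derive_continuous.
move=> k x; have [_ /(_ v ve)[db _ dbE]] := smooth_derive (smooth_cutoff 1).
rewrite (_ : cutoff k = fun y => cutoff 1 (k *: y)); last by apply/funext => y; rewrite cutoffE.
apply: is_derive_scale; have := dbE (k *: x) => -[d1 d2].
by split.
Qed.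

End test_functions.

(** * Dominated convergence with bounded multipliers *)

Section bounded_multiplier.
Context d (T : measurableType d) (R : realType) (m : {measure set T -> \bar R}).
Implicit Types (D : set T) (f h : T -> R).

Lemma integrable_mul_bounded D f h (C : R) : measurable D ->
  m.-integrable D (EFin \o f) -> measurable_fun D h ->
  (forall x, `|h x| <= C) -> m.-integrable D (fun x => (f x * h x)%:E).
Proof.
move=> mD fi mh hC; have C0 : 0 <= C := le_trans (normr_ge0 _) (hC point).
have i1 : m.-integrable D (fun x => C%:E * (f x)%:E)%E by exact: integrableZl.
apply: le_integrable i1 => //.
  apply/measurable_EFinP; apply: measurable_funM => //.
  by apply/measurable_EFinP; exact: measurable_int fi.
by move=> x _; rewrite /= lee_fin !normrM (ger0_norm C0) mulrC ler_wpM2r.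
Qed.

(** The majorant is C |f|. Limits of integrals against families of test functions and cut-offs are
    taken with this lemma. *)
Lemma cvg_integral_mul D f (h_ : nat -> T -> R) h (C : R) : measurable D ->
  m.-integrable D (EFin \o f) -> (forall n, measurable_fun D (h_ n)) ->
  (forall n x, `|h_ n x| <= C) -> (forall x, D x -> h_ n x @[n --> \oo] --> h x) ->
  (\int[m]_(x in D) (f x * h_ n x)%:E @[n --> \oo] -->
   \int[m]_(x in D) (f x * h x)%:E)%E.
Proof.
move=> mD fi mh_ hC hh; have C0 : 0 <= C := le_trans (normr_ge0 _) (hC 0 point).
have mf : measurable_fun D f by apply/measurable_EFinP; exact: measurable_int fi.
have mh : measurable_fun D h.
  apply/measurable_EFinP; apply: (emeasurable_fun_cvg (fun n x => (h_ n x)%:E)) => //.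
    by move=> n; apply/measurable_EFinP; exact: mh_.
  by move=> x Dx; apply: cvg_EFin; [exact: nearW|exact: hh].
have i1 : m.-integrable D (fun x => C%:E * `|(f x)%:E|)%E.
  by apply: integrableZl => //; exact: integrable_abse.
have [//||||_ _] := @dominated_convergence _ _ _ m D mD
  (fun n x => (f x * h_ n x)%:E) (fun x => (f x * h x)%:E) _ _ _ _ i1 => //.
- by move=> n; apply/measurable_EFinP; exact: measurable_funM.
- by apply/measurable_EFinP; exact: measurable_funM.
- apply: aeW => x Dx; apply: cvg_EFin; first exact: nearW.
  by apply: cvgMr; exact: hh.
- by apply: aeW => x n Dx; rewrite -EFinM abse_EFin lee_fin normrM mulrC ler_wpM2r.
Qed.

End bounded_multiplier.

Section weak_derivative_ext.
Context {R : realType}.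
Local Notation plane := (measurableTypeR R * measurableTypeR R)%type.
Local Notation mu := (@plane_measure R).

(* Integration by parts against functions without compact support: truncate by
   [cutoff n^-1], whose derivative is O(1/n). *)
Lemma weak_derivative_ext v (f g : R * R -> R) phi psi (C : R) :
  v = e1 \/ v = e2 ->
  mu.-integrable [set: plane] (EFin \o f) -> mu.-integrable [set: plane] (EFin \o g) ->
  weak_derivative v (EFin \o f) g ->
  smooth phi -> (forall x, is_derive x v phi (psi x)) ->
  (forall x, `|phi x| <= C) -> (forall x, `|psi x| <= C) ->
  (\int[mu]_x (f x * psi x)%:E = - \int[mu]_x (g x * phi x)%:E)%E.
Proof.
move=> ve fi gi wfg sphi phipsi phiC psiC.
have C0 : 0 <= C := le_trans (normr_ge0 _) (phiC (0, 0)).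
have cpsi : continuous psi.
  have [_ /(_ v ve)[df /smooth_derive[cdf _] dfE]] := smooth_derive sphi.
  rewrite (_ : psi = df)//; apply/funext => x.
  by have [_ <-] := phipsi x; have [_ <-] := dfE x.
have cphi : continuous phi by have [] := smooth_derive sphi.
have [b [B [bB [cb db]]]] := @cutoff_is_derive R v ve.
have B0 : 0 <= B := le_trans (normr_ge0 _) (bB (0, 0)).
have [A hA] : exists A : R, forall k x, `|cutoff k x| <= A.
  exists ((flat 0 1) ^- 4) => k x; rewrite /cutoff normrM ger0_norm; last first.
    by rewrite invr_ge0 exprn_ge0// flat_ge0.
  rewrite ler_piMr ?invr_ge0 ?exprn_ge0 ?flat_ge0//.
  have n1 y : `|flat 0 y| <= 1 :> R by rewrite ger0_norm ?flat_ge0//; exact: (flat_le 0).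
  by rewrite !normrM; do 3 (apply: mulr_ile1 => //; rewrite ?mulr_ge0//; try exact: mulr_ile1).
have A0 : 0 <= A := le_trans (normr_ge0 _) (hA 0 (0, 0)).
pose k n : R := n.+1%:R^-1.
have k0 n : 0 < k n by rewrite invr_gt0.
have k1 n : k n <= 1 by rewrite invf_le1// ler1n.
have kcvg : k n @[n --> \oo] --> (0 : R) by exact: cvg_harmonic.
pose phi_ n x := phi x * cutoff (k n) x.
pose psi_ n x := phi x * (k n * b (k n *: x)) + cutoff (k n) x * psi x.
have dphi_ n x : is_derive x v (phi_ n) (psi_ n x).
  exact: (is_deriveM (phipsi x) (db (k n) x)).
have tphi_ n : test_function (phi_ n).
  apply: (smooth_test_function (M := (k n)^-1)).
    by apply: smoothM => //; exact: smooth_cutoff.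
  move=> x; rewrite mulf_eq0 negb_or => /andP[_]; exact: cutoff_support.
have ccut n : continuous (cutoff (k n)) by have [] := smooth_derive (smooth_cutoff (k n)).
have wn n : (\int[mu]_x (f x * psi_ n x)%:E = - \int[mu]_x (g x * phi_ n x)%:E)%E.
  rewrite -(wfg _ (tphi_ n)); apply: eq_integral => x _ /=.
  by have [_ ->] := dphi_ n x; rewrite EFinM.
have cutcvg x : cutoff (k n) x @[n --> \oo] --> (1 : R).
  rewrite -(cutoff0 x) /cutoff.
  have cD s : flat 0 (1 + k n * s) @[n --> \oo] --> (flat 0 (1 + 0 * s) : R).
    apply: continuous_cvg; first exact: flat_continuous.
    by apply: cvgD; [exact: cvg_cst|exact: cvgMl].
  have cB s : flat 0 (1 - k n * s) @[n --> \oo] --> (flat 0 (1 - 0 * s) : R).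
    apply: continuous_cvg; first exact: flat_continuous.
    by apply: cvgB; [exact: cvg_cst|exact: cvgMl].
  by apply: cvgMr; apply: cvgM; apply: cvgM.
have lim1 : (\int[mu]_x (f x * psi_ n x)%:E @[n --> \oo] --> \int[mu]_x (f x * psi x)%:E)%E.
  apply: (@cvg_integral_mul _ _ _ mu _ f psi_ psi (C * B + A * C)) => //.
  - move=> n; apply: continuous_measurable_plane => x; apply: cvgD.
      apply: cvgM; first exact: cphi.
      apply: cvgMr; apply: (@cvg_comp _ _ _ (fun y => k n *: y) b _ (nbhs (k n *: x))); last exact: cb.
      exact: scaler_continuous.
    by apply: cvgM; [exact: ccut|exact: cpsi].
  - move=> n x; rewrite (le_trans (ler_normD _ _))// lerD//.
      rewrite [leLHS]normrM ler_pM// [leLHS]normrM -[B]mul1r ler_pM// ger0_norm//.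
      exact: ltW.
    by rewrite [leLHS]normrM ler_pM.
  - move=> x _; rewrite -[psi x]add0r -[psi x]mul1r; apply: cvgD.
      (* The factor [k n] tends to 0 while [b (k n *: x)] converges, so the derivative of the
         cut-off disappears in the limit. *)
      have bx : b (k n *: x) @[n --> \oo] --> b (0 *: x).
        apply: (@cvg_comp _ _ _ (fun n => k n *: x) b _ (nbhs (0 *: x))); last exact: cb.
        by apply: (@cvg_comp _ _ _ k (fun t : R => t *: x) _ (nbhs (0 : R))) => //;
          exact: scalel_continuous.
      by rewrite -[X in _ --> X](mulr0 (phi x)) -(mul0r (b (0 *: x))); apply: cvgMr; apply: cvgM.
    by apply: cvgMl; exact: cutcvg.
have lim2 : (\int[mu]_x (g x * phi_ n x)%:E @[n --> \oo] --> \int[mu]_x (g x * phi x)%:E)%E.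
  apply: (@cvg_integral_mul _ _ _ mu _ g phi_ phi (C * A)) => //.
  - move=> n; apply: continuous_measurable_plane => x.
    by apply: cvgM; [exact: cphi|exact: ccut].
  - by move=> n x; rewrite [leLHS]normrM ler_pM.
  - by move=> x _; rewrite -[phi x in X in _ --> X]mulr1; apply: cvgMr; exact: cutcvg.
rewrite -(cvg_lim _ lim1)//; apply: cvg_lim => //.
under eq_cvg do rewrite wn.
exact: cvgeN.
Qed.

End weak_derivative_ext.

(** * Smooth approximations of the Heaviside function and of the positive part *)

Section ramp.
Context {R : realType}.
Implicit Types (n : nat) (z : R).

Definition heavi z : R := \1_`]0, +oo[ z.

Lemma heavi_gt0 z : 0 < z -> heavi z = 1.
Proof. by move=> z0; rewrite /heavi indicE mem_set//= in_itv/= z0. Qed.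

Lemma heavi_le0 z : z <= 0 -> heavi z = 0.
Proof.
by move=> z0; rewrite /heavi indicE memNset//= in_itv/= andbT ltNge z0.
Qed.

Lemma measurable_heavi : measurable_fun [set: measurableTypeR R] heavi.
Proof. exact: measurable_indic. Qed.

Lemma heavi_itv a b z : a <= b -> heavi (z - a) - heavi (z - b) = \1_`]a, b] z.
Proof.
move=> ab; rewrite indicE mem_setE in_itv/=; case: (boolP (a < z <= b)).
  by move=> /andP[az zb]; rewrite heavi_gt0 ?subr_gt0// heavi_le0 ?subr_le0// subr0.
move=> /nandP[]; rewrite -?leNgt -?ltNge => zab.
  by rewrite !heavi_le0 ?subrr ?subr_le0// (le_trans zab).
by rewrite !heavi_gt0 ?subrr ?subr_gt0// (le_lt_trans ab).
Qed.

Definition nn n : R := n.+1%:R.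

Lemma nn_gt0 n : 0 < nn n. Proof. by rewrite /nn. Qed.

Lemma flat_heavi_le n z : 0 < z -> 1 - (nn n)^-1 / z <= flat 0 (nn n * z) <= 1.
Proof.
move=> z0; rewrite (flat_le 0) andbT flat0E ?mulr_gt0 ?nn_gt0// invfM.
exact: expR_ge1Dx.
Qed.

Lemma cvg_nn (c : R) : (nn n)^-1 / c @[n --> \oo] --> (0 : R).
Proof. by rewrite -[X in _ --> X](mul0r c^-1); apply: cvgMl; exact: cvg_harmonic. Qed.

Lemma cvg_flat_heavi z : flat 0 (nn n * z) @[n --> \oo] --> heavi z.
Proof.
have [z0|z0] := leP z 0.
  rewrite heavi_le0//; apply: cvg_near_cst; apply: nearW => n.
  by apply: flat_le0; rewrite pmulr_rle0// nn_gt0.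
rewrite heavi_gt0//; apply: (@squeeze_cvgr _ _ _ _ (fun n => 1 - (nn n)^-1 / z) (cst 1)).
- by apply: nearW => n; exact: flat_heavi_le.
- by rewrite -[X in _ --> X]subr0; apply: cvgB; [exact: cvg_cst|exact: cvg_nn].
- exact: cvg_cst.
Qed.

(** For t > 0, t * flat 1 t = flat 0 t <= 1. This is the extra term in the derivative of [ramp]. *)
Lemma cvg_flat1 z : flat 1 (nn n * z) @[n --> \oo] --> (0 : R).
Proof.
have [z0|z0] := leP z 0.
  apply: cvg_near_cst; apply: nearW => n.
  by apply: flat_le0; rewrite pmulr_rle0// nn_gt0.
apply: (@squeeze_cvgr _ _ _ _ (cst 0) (fun n => (nn n)^-1 / z)).
- apply: nearW => n; rewrite flat_ge0/=.
  have nz : 0 < nn n * z by rewrite mulr_gt0// nn_gt0.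
  by rewrite -invfM -[leRHS]mul1r ler_pdivlMr// mulrC mul_flatS (flat_le 0).
- exact: cvg_cst.
- exact: cvg_nn.
Qed.

(* [z * exp (- 1 / (n.+1 * z))] for [z > 0]: a smooth approximation of the
   positive part whose derivative, unlike that of a generic primitive, is explicit. *)
Definition ramp n z := z * flat 0 (nn n * z).

(** The error is uniform in [z]; hence a difference of two ramps is bounded although each ramp is
    not, as [weak_derivative_ext] requires. *)
Lemma ramp_bound n z : `|ramp n z - Num.max z 0| <= (nn n)^-1.
Proof.
have n0 : 0 <= (nn n)^-1 by rewrite invr_ge0 ltW// nn_gt0.
rewrite /ramp; have [z0|z0] := leP z 0.
  by rewrite flat_le0 ?pmulr_rle0 ?nn_gt0// mulr0 subr0 normr0.
have /andP[lo hi] := flat_heavi_le n z0.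
have -> : z * flat 0 (nn n * z) - z = z * (flat 0 (nn n * z) - 1) by ring.
rewrite normrM gtr0_norm// mulrC -ler_pdivlMr//.
have := divr_ge0 n0 (ltW z0); move: (_ / z) lo hi => t lo hi t0.
by rewrite ler_norml; apply/andP; split; lra.
Qed.

Lemma cvg_ramp z : ramp n z @[n --> \oo] --> Num.max z 0.
Proof.
apply/cvgrPdist_le => e e0; near=> n.
rewrite distrC (le_trans (ramp_bound n z))//.
near: n; have := @cvg_harmonic R => /cvgrPdist_le/(_ e e0).
by apply: filterS => n; rewrite sub0r normrN gtr0_norm ?invr_gt0 ?nn_gt0.
Unshelve. all: by end_near. Qed.

Lemma max0_lip a b : `|Num.max a 0 - Num.max b 0| <= `|a - b| :> R.
Proof.
have := ler_norm (a - b); have := lerNnormlW (lexx `|a - b|).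
have := normr_ge0 (a - b); move: `|a - b| => c.
by rewrite ler_norml; case: (leP a 0); case: (leP b 0) => *; apply/andP; split; lra.
Qed.

End ramp.

Section rect_identity.
Context {R : realType}.
Local Notation plane := (measurableTypeR R * measurableTypeR R)%type.
Local Notation mu := (@plane_measure R).

(** For a0 <= a1 the limiting test function rises linearly in [p] from 0 to a1 - a0 and then stays
    constant; lacking compact support, its approximations call for [weak_derivative_ext]. The
    abstract coordinates [p] (along [v]) and [q] (across) serve both axes. *)
Lemma rect_identity v (p q : R * R -> R) (f g : R * R -> R) (a0 a1 c d : R) :
  v = e1 \/ v = e2 -> smooth p -> smooth q ->
  (forall x, is_derive x v p 1) -> (forall x, is_derive x v q 0) ->
  mu.-integrable [set: plane] (EFin \o f) -> mu.-integrable [set: plane] (EFin \o g) ->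
  weak_derivative v (EFin \o f) g ->
  (\int[mu]_x (f x * ((heavi (p x - a0) - heavi (p x - a1)) *
                      (heavi (q x - c) - heavi (q x - d))))%:E =
   - \int[mu]_x (g x * ((Num.max (p x - a0) 0 - Num.max (p x - a1) 0) *
                      (heavi (q x - c) - heavi (q x - d))))%:E)%E.
Proof.
move=> ve sp sq dp dq fi gi wfg.
pose P n a x := ramp n (p x - a).
pose Q n x := flat 0 (nn n * (q x - c)) - flat 0 (nn n * (q x - d)).
pose P' n a x := flat 1 (nn n * (p x - a)) + flat 0 (nn n * (p x - a)).
pose phi n x := (P n a0 x - P n a1 x) * Q n x.
pose psi n x := (P' n a0 x - P' n a1 x) * Q n x.
have sshift (r : R * R -> R) a n : smooth r -> smooth (fun x => flat 0 (nn n * (r x - a))).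
  move=> sr; apply: smooth_flat; apply: smoothM; first exact: smooth_cst.
  by apply: smoothB => //; exact: smooth_cst.
have sphi n : smooth (phi n).
  apply: smoothM; apply: smoothB; try exact: sshift.
  - by apply: smoothM; [apply: smoothB => //; exact: smooth_cst|exact: sshift].
  - by apply: smoothM; [apply: smoothB => //; exact: smooth_cst|exact: sshift].
have dshift (r : R * R -> R) a n x b : is_derive x v r b ->
    is_derive x v (fun y => nn n * (r y - a)) (nn n * b).
  move=> dr; have := @is_deriveZ _ _ _ _ (nn n) _ _ _ (is_deriveB dr (is_derive_cst a x v)).
  by rewrite subr0.
have dP n a x : is_derive x v (P n a) (P' n a x).
  have d1 := is_derive_flat_comp 0 (dshift _ a n _ _ (dp x)).
  have d2 := is_deriveM (is_deriveB (dp x) (is_derive_cst a x v)) d1.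
  apply: (is_derive_eq d2); rewrite /P' /= mul0r !subr0 mulr1 /GRing.scale/= mulr1.
  (* The product of [p x - a] with the derivative of the [flat 0] factor collapses to [flat 1]. *)
  rewrite -(mul_flatS 1); congr (_ + _) => /=.
  by rewrite -[RHS]mulrA [RHS]mulrC -mulrA.
have dQ n x : is_derive x v (Q n) 0.
  have d1 a := is_derive_flat_comp 0 (dshift _ a n _ _ (dq x)).
  by apply: (is_derive_eq (is_deriveB (d1 c) (d1 d))); rewrite !mulr0 subr0.
have dphi n x : is_derive x v (phi n) (psi n x).
  apply: (is_derive_eq (is_deriveM (is_deriveB (dP n a0 x) (dP n a1 x)) (dQ n x))).
  by rewrite scaler0 add0r /psi /GRing.scale/= mulrC.
have fl0 (z : R) : 0 <= flat 0 z <= 1 by rewrite flat_ge0 (flat_le 0).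
have fl1 (z : R) : 0 <= flat 1 z <= 1 by rewrite flat_ge0 (flat_le 1).
have Qb n x : `|Q n x| <= 1.
  rewrite /Q; have /andP[] := fl0 (nn n * (q x - c)); have /andP[] := fl0 (nn n * (q x - d)).
  by move=> *; rewrite ler_norml; apply/andP; split; lra.
have P'b n x : `|P' n a0 x - P' n a1 x| <= 2.
  rewrite /P'; have /andP[] := fl0 (nn n * (p x - a0)); have /andP[] := fl0 (nn n * (p x - a1)).
  have /andP[] := fl1 (nn n * (p x - a0)); have /andP[] := fl1 (nn n * (p x - a1)).
  by move=> *; rewrite ler_norml; apply/andP; split; lra.
have Pb n x : `|P n a0 x - P n a1 x| <= `|a1 - a0| + 2.
  have := ramp_bound n (p x - a0); have := ramp_bound n (p x - a1).
  have := max0_lip (p x - a0) (p x - a1).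
  have -> : p x - a0 - (p x - a1) = a1 - a0 by ring.
  have : (nn n)^-1 <= (1 : R) by rewrite invf_le1 ?nn_gt0// /nn ler1n.
  rewrite /P !ler_norml; move: (nn n)^-1 (ramp _ _) (ramp _ _) (Num.max _ _) (Num.max _ _) `|_|.
  move=> k r0 r1 m0 m1 t k1 /andP[? ?] /andP[? ?] /andP[? ?].
  by apply/andP; split; lra.
pose C : R := `|a1 - a0| + 2.
have C2 : 2 <= C by rewrite lerDr.
have phib n x : `|phi n x| <= C by rewrite normrM -[C]mulr1 ler_pM.
have psib n x : `|psi n x| <= C.
  by rewrite normrM -[C]mulr1 ler_pM// (le_trans (P'b _ _)).
have wn n := weak_derivative_ext ve fi gi wfg (sphi n) (dphi n) (phib n) (psib n).
have cont_meas (h : R * R -> R) : continuous h -> measurable_fun [set: plane] h.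
  exact: continuous_measurable_plane.
have cphi n : continuous (phi n) by have [] := smooth_derive (sphi n).
have cpsi n : continuous (psi n).
  have [_ /(_ v ve)[df /smooth_derive[cdf _] dfE]] := smooth_derive (sphi n).
  rewrite (_ : psi n = df)//; apply/funext => x.
  by have [_ <-] := dphi n x; have [_ <-] := dfE x.
have cQ x : Q n x @[n --> \oo] --> heavi (q x - c) - heavi (q x - d).
  by apply: cvgB; exact: cvg_flat_heavi.
have lim1 := @cvg_integral_mul _ _ _ mu _ f psi
  (fun x => (heavi (p x - a0) - heavi (p x - a1)) * (heavi (q x - c) - heavi (q x - d))) C
  measurableT fi (fun n => cont_meas _ (cpsi n)) psib.
have lim2 := @cvg_integral_mul _ _ _ mu _ g phi
  (fun x => (Num.max (p x - a0) 0 - Num.max (p x - a1) 0) *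
            (heavi (q x - c) - heavi (q x - d))) C
  measurableT gi (fun n => cont_meas _ (cphi n)) phib.
rewrite -(cvg_lim _ (lim1 _))//; last first.
  move=> x _; apply: cvgM => //; apply: cvgB; rewrite -[X in _ --> X]add0r;
  by apply: cvgD; [exact: cvg_flat1|exact: cvg_flat_heavi].
apply: cvg_lim => //; under eq_cvg do rewrite wn.
apply: cvgeN; apply: lim2 => x _; apply: cvgM => //.
by apply: cvgB; exact: cvg_ramp.
Qed.

End rect_identity.

(** * Absolute continuity on lines *)

Section tail.
Context {R : realType}.
Local Notation line := (measurableTypeR R).
Local Notation plane := (measurableTypeR R * measurableTypeR R)%type.
Local Notation mu := (@plane_measure R).
Local Notation lam := (@lebesgue_measure R).

(** The integral of [h] over the part of the row of [x] to the right of [x]. The values are extended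
    reals because a row may have infinite integral. *)
Definition tail (h : plane -> R) (x : plane) : \bar R :=
  (\int[lam]_s (h (s, x.2) * heavi (s - x.1))%:E)%E.

Lemma integral_heavi a b s : a <= b ->
  (\int[lam]_y (heavi (s - y) * \1_`]a, b] y)%:E =
   (Num.max (s - a) 0 - Num.max (s - b) 0)%:E)%E.
Proof.
move=> ab.
have E c : (s <= c) -> (lam `]a, c[%classic = (Num.max (c - a) 0)%:E)%E.
  move=> _; rewrite lebesgue_measure_itv/= lte_fin; case: ltP => ac.
    by rewrite -EFinB; congr EFin; rewrite /Num.max ltNge subr_ge0 ltW.
  by congr EFin; rewrite /Num.max; case: ltP => //; lra.
have indE y : heavi (s - y) * \1_`]a, b] y = \1_(`]a, b] `&` `]-oo, s[) y.
  rewrite indicI mulrC/=; congr (_ * _); rewrite indicE mem_setE in_itv/=.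
  by case: ltP => ys; [rewrite heavi_gt0// subr_gt0|rewrite heavi_le0// subr_le0].
under eq_integral do rewrite indE.
rewrite integral_indic//= ?setIT; last exact: measurableI.
have [sb|bs] := leP s b.
  rewrite (_ : _ `&` _ = `]a, s[%classic); last first.
    apply/seteqP; split => y /=; rewrite !in_itv/=; first by move=> [/andP[-> _] ->].
    by move=> /andP[-> ys]; rewrite ys (le_trans (ltW ys)).
  by rewrite E// (_ : Num.max (s - b) 0 = 0) ?subr0// /Num.max; case: ltP => //; lra.
rewrite (_ : _ `&` _ = `]a, b]%classic); last first.
  apply/seteqP; split => y /=; rewrite !in_itv/=; first by move=> [].
  by move=> /andP[-> yb]; rewrite yb (le_lt_trans yb).
rewrite lebesgue_measure_itv/= lte_fin -EFinB.
have -> : Num.max (s - a) 0 = s - a by rewrite /Num.max; case: ltP => //; lra.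
have -> : Num.max (s - b) 0 = s - b by rewrite /Num.max; case: ltP => //; lra.
by case: ltP => ab'; congr EFin; lra.
Qed.

Section nonneg.
Variable h : plane -> R.
Hypotheses (mh : measurable_fun [set: plane] h) (h0 : forall x, 0 <= h x).

Lemma tail_ge0 x : (0 <= tail h x)%E.
Proof.
apply: integral_ge0 => s _; rewrite lee_fin mulr_ge0//.
Qed.

Let F (z : plane * line) : \bar R := (h (z.2, z.1.2) * heavi (z.2 - z.1.1))%:E.

Let mF : measurable_fun [set: plane * line] F.
Proof.
apply/measurable_EFinP; apply: measurable_funM.
  apply: (measurableT_comp mh); apply: measurable_fun_pair; first exact: measurable_snd.
  by apply: measurableT_comp; [exact: measurable_snd|exact: measurable_fst].
apply: (measurableT_comp measurable_heavi); apply: measurable_funB; first exact: measurable_snd.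
by apply: measurableT_comp; exact: measurable_fst.
Qed.

Let F0 z : (0 <= F z)%E.
Proof. by rewrite lee_fin mulr_ge0. Qed.

Lemma measurable_tail : measurable_fun [set: plane] (tail h).
Proof. exact: (@measurable_fun_fubini_tonelli_F _ _ plane line R lam F mF F0). Qed.

(** Tonelli with the integration variable [s] of the tail moved outside; the inner integral of
    [heavi (s - y)] over []a, b]] is given by [integral_heavi]. *)
Lemma tail_rect a b c d : a <= b ->
  (\int[mu]_(x in rect a b c d) tail h x =
   \int[mu]_x (h x * ((Num.max (x.1 - a) 0 - Num.max (x.1 - b) 0) *
                      \1_`]c, d] x.2))%:E)%E.
Proof.
move=> ab.
pose w (x : plane) : R := \1_`]a, b] x.1 * \1_`]c, d] x.2.
have w0 x : 0 <= w x by rewrite mulr_ge0.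
have mw1 e e' : measurable_fun [set: line] (\1_`]e, e'] : line -> R).
  exact: measurable_indic.
have mw : measurable_fun [set: plane] w.
  by apply: measurable_funM; apply: measurableT_comp.
pose Fw (z : plane * line) : \bar R := ((w z.1)%:E * F z)%E.
have mFw : measurable_fun [set: plane * line] Fw.
  apply: emeasurable_funM => //; apply/measurable_EFinP.
  by apply: measurableT_comp; [exact: mw|exact: measurable_fst].
have Fw0 z : (0 <= Fw z)%E by rewrite mule_ge0 ?F0 ?lee_fin.
transitivity (\int[mu]_x \int[lam]_s Fw (x, s))%E.
  rewrite integral_mkcond; apply: eq_integral => x _.
  have -> : (\int[lam]_s Fw (x, s) = (w x)%:E * tail h x)%E.
    have mFx : measurable_fun [set: line] (fun s => F (x, s)) by exact: (measurableT_comp mF).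
    have F0x s : [set: line] s -> (0 <= F (x, s))%E by move=> _; exact: F0.
    have w0x : (0 <= (w x)%:E)%E by rewrite lee_fin.
    exact: (ge0_integralZl lam measurableT mFx F0x w0x).
  rewrite patchE; case: ifPn => [/set_mem[x1 x2]|/negP xr].
    by rewrite /w !indicE !mem_set// mulr1 mul1e.
  rewrite /w !indicE; case: (boolP (x.1 \in _)) => x1; rewrite ?mul0r ?mul0e//.
  case: (boolP (x.2 \in _)) => x2; rewrite ?mulr0 ?mul0e//.
  by exfalso; apply: xr; apply/mem_set; split; exact/set_mem.
rewrite (@fubini_tonelli _ _ plane line R (@planeS R) lam Fw mFw Fw0).
have mk : measurable_fun [set: line] (fun s : line => Num.max (s - a) 0 - Num.max (s - b) 0).
  by apply: measurable_funB; apply: measurable_maxr => //; exact: measurable_funB.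
have k0 s : 0 <= Num.max (s - a) 0 - Num.max (s - b) 0 :> R.
  by rewrite subr_ge0; case: (leP (s - a) 0); case: (leP (s - b) 0) => *; lra.
rewrite (_ : (\int[mu]_x _)%E = \int[lam]_s \int[lam]_u
    (h (s, u) * ((Num.max (s - a) 0 - Num.max (s - b) 0) * \1_`]c, d] u))%:E)%E; last first.
  rewrite (@fubini_tonelli1 _ _ line line R lam lam) => [//||x].
    apply/measurable_EFinP; apply: measurable_funM => //; apply: measurable_funM.
      by apply: (measurableT_comp mk); exact: measurable_fst.
    by apply: measurableT_comp; [exact: mw1|exact: measurable_snd].
  by rewrite lee_fin !mulr_ge0.
apply: eq_integral => s _.
have mFs : measurable_fun [set: plane] (fun x => Fw (x, s)) by exact: (measurableT_comp mFw).
rewrite (@fubini_tonelli2 _ _ line line R lam lam (fun x => Fw (x, s)) mFs (fun x => Fw0 (x, s))).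
apply: eq_integral => u _; rewrite /fubini_G /Fw /F /=.
transitivity (\int[lam]_y ((h (s, u) * \1_`]c, d] u)%:E * (heavi (s - y) * \1_`]a, b] y)%:E))%E.
  by apply: eq_integral => y _; rewrite -!EFinM /w/=; congr EFin; ring.
rewrite ge0_integralZl ?lee_fin ?mulr_ge0//.
- by rewrite integral_heavi// -EFinM; congr EFin; ring.
- apply/measurable_EFinP; apply: measurable_funM => //.
  by apply: (measurableT_comp measurable_heavi); exact: measurable_funB.
- by move=> y _; rewrite lee_fin mulr_ge0.
Qed.

Lemma tail_itv y y' u : y <= y' ->
  (tail h (y, u) = tail h (y', u) + \int[lam]_(s in `]y, y']) (h (s, u))%:E)%E.
Proof.
move=> yy'; rewrite /tail/= [X in (_ + X)%E]integral_mkcond.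
have mhu : measurable_fun [set: line] (fun s => h (s, u)).
  exact: (measurableT_comp mh).
rewrite (_ : _ \_ _ = fun s => (h (s, u) * \1_`]y, y'] s)%:E); last first.
  by apply/funext => s; rewrite patchE indicE; case: ifP; rewrite ?mulr1 ?mulr0.
rewrite -ge0_integralD//.
- by apply: eq_integral => s _; rewrite -EFinD -heavi_itv//; congr EFin; ring.
- by move=> s _; rewrite lee_fin mulr_ge0.
- apply/measurable_EFinP; apply: measurable_funM => //.
  by apply: (measurableT_comp measurable_heavi); exact: measurable_funB.
- by move=> s _; rewrite lee_fin mulr_ge0.
- by apply/measurable_EFinP; apply: measurable_funM.
Qed.

End nonneg.

End tail.

Section acl.
Context {R : realType}.
Local Notation line := (measurableTypeR R).
Local Notation plane := (measurableTypeR R * measurableTypeR R)%type.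
Local Notation mu := (@plane_measure R).
Local Notation lam := (@lebesgue_measure R).

Lemma rect_indic a b c d (x : R * R) :
  \1_(rect a b c d) x = \1_`]a, b] x.1 * \1_`]c, d] x.2 :> R.
Proof.
rewrite !indicE -natrM mulnb; congr (_%:R); congr nat_of_bool.
apply/idP/andP => [/set_mem[? ?]|[/set_mem ? /set_mem ?]]; last exact/mem_set.
by split; exact/mem_set.
Qed.

Lemma integral_rect_indic a b c d (f : plane -> R) :
  (\int[mu]_(x in rect a b c d) (f x)%:E =
   \int[mu]_x (f x * (\1_`]a, b] x.1 * \1_`]c, d] x.2))%:E)%E.
Proof.
rewrite integral_mkcond; apply: eq_integral => x _; rewrite -rect_indic patchE indicE.
by case: ifP => _; rewrite ?mulr1 ?mulr0.
Qed.

Lemma ae_rects (P : plane -> Prop) :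
  (forall n : nat, {ae mu, forall x, rect (- n%:R) n%:R (- n%:R) n%:R x -> P x}) ->
  {ae mu, forall x, P x}.
Proof.
move=> /ae_foralln; apply: filterS => x Px.
have [n xn] : exists n : nat, `|x| < n%:R by exists (Num.truncn `|x|).+1; exact: truncnS_gt.
apply: (Px n); move: xn; rewrite prod_normE gt_max !ltr_norml => /andP[/andP[a b] /andP[c d]].
by split; rewrite /= in_itv/= ?a ?c ltW.
Qed.

(** Absolute continuity on rows as an increment bound between points off an exceptional set. The
    right-hand side may be infinite, so no row has to be discarded. *)
Definition acl1 (f g : plane -> R) (N : set plane) := forall u y y', y <= y' ->
  ~ N (y, u) -> ~ N (y', u) ->
  (`|f (y', u) - f (y, u)|%:E <= \int[lam]_(s in `]y, y']) `|g (s, u)|%:E)%E.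

Definition acl2 (f g : plane -> R) (N : set plane) := forall u y y', y <= y' ->
  ~ N (u, y) -> ~ N (u, y') ->
  (`|f (u, y') - f (u, y)|%:E <= \int[lam]_(s in `]y, y']) `|g (u, s)|%:E)%E.

(** Since both differences are real, [m], [p], [a] and [b] must all be finite; thus the bound
    applies on a row before anything is known about integrability there. *)
Lemma ereal_diff_bound (a b p m : \bar R) (x y : R) : (0 <= a)%E -> (0 <= b)%E ->
  (x%:E = (m + b) - (p + a))%E -> (y%:E = m - p)%E -> (`|y - x|%:E <= a + b)%E.
Proof.
move: m p => [m||] [p||] //=.
move: a b => [a||] [b||] //=; rewrite !lee_fin => a0 b0 [->] [->].
by rewrite ler_norml; apply/andP; split; lra.
Qed.

(** The hypothesis says that [f] and minus the integral of [g] to the right have equal integrals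
    over rectangles. Splitting [g] into [gp] and [gm] keeps the tails nonnegative, so that Tonelli
    applies and f = tail gm - tail gp almost everywhere; [N] is the exceptional set of this
    equation. *)
Lemma acl_of_identity (f g : plane -> R) :
  mu.-integrable [set: plane] (EFin \o f) -> mu.-integrable [set: plane] (EFin \o g) ->
  (forall a0 a1 c d,
    \int[mu]_x (f x * ((heavi (x.1 - a0) - heavi (x.1 - a1)) *
                       (heavi (x.2 - c) - heavi (x.2 - d))))%:E =
    - \int[mu]_x (g x * ((Num.max (x.1 - a0) 0 - Num.max (x.1 - a1) 0) *
                       (heavi (x.2 - c) - heavi (x.2 - d))))%:E)%E ->
  exists2 N : set plane, mu.-negligible N & acl1 f g N.
Proof.
move=> fi gi H.
have mg : measurable_fun [set: plane] g by apply/measurable_EFinP; exact: measurable_int gi.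
pose gp x := Num.max (g x) 0; pose gm x := Num.max (- g x) 0.
have mgp : measurable_fun [set: plane] gp by exact: measurable_maxr.
have mgm : measurable_fun [set: plane] gm.
  by apply: measurable_maxr => //; exact: measurableT_comp.
have gp0 x : 0 <= gp x by rewrite le_max lexx orbT.
have gm0 x : 0 <= gm x by rewrite le_max lexx orbT.
have gE x : g x = gp x - gm x.
  by rewrite /gp /gm; case: (leP (g x) 0); case: (leP (- g x) 0) => *; lra.
have gN x : `|g x| = gp x + gm x.
  rewrite /gp /gm; case: (leP (g x) 0) => g0; [rewrite ler0_norm//|rewrite gtr0_norm//];
    case: (leP (- g x) 0) => *; lra.
have gpi : mu.-integrable [set: plane] (EFin \o gp).
  apply: le_integrable gi => //; first exact/measurable_EFinP.
  by move=> x _; rewrite /= lee_fin (ger0_norm (gp0 x)) gN lerDl.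
have gmi : mu.-integrable [set: plane] (EFin \o gm).
  apply: le_integrable gi => //; first exact/measurable_EFinP.
  by move=> x _; rewrite /= lee_fin (ger0_norm (gm0 x)) gN lerDr.
pose k a b (c d : R) (x : plane) : R :=
  (Num.max (x.1 - a) 0 - Num.max (x.1 - b) 0) * \1_`]c, d] x.2.
have mk a b c d : measurable_fun [set: plane] (k a b c d).
  apply: measurable_funM; last exact: measurableT_comp.
  by apply: measurable_funB; apply: measurable_maxr => //; exact: measurable_funB.
have kb a b c d x : `|k a b c d x| <= `|b - a|.
  rewrite normrM -[leRHS]mulr1 ler_pM//; last first.
    by rewrite indicE; case: (_ \in _); rewrite ?normr1 ?normr0.
  by rewrite (le_trans (max0_lip _ _))// (_ : _ - _ = b - a)//; ring.
have gki (h : plane -> R) a b c d : mu.-integrable [set: plane] (EFin \o h) ->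
    mu.-integrable [set: plane] (fun x => (h x * k a b c d x)%:E).
  by move=> ih; exact: integrable_mul_bounded ih (mk _ _ _ _) (kb _ _ _ _).
have tailI (h : plane -> R) a b c d : measurable_fun [set: plane] h -> (forall x, 0 <= h x) ->
    mu.-integrable [set: plane] (EFin \o h) -> a <= b ->
    mu.-integrable (rect a b c d) (tail h).
  move=> mh h0 ih ab; apply/integrableP; split.
    by apply: measurable_funTS; apply: measurable_tail.
  rewrite (eq_integral (tail h)) => [|x _]; last by rewrite gee0_abs// tail_ge0.
  rewrite tail_rect//; have /integrableP[mhk] := gki h a b c d ih; apply: le_lt_trans.
  by apply: (le_trans (lee_abs _)); exact: le_abse_integral.
have fE n : ae_eq mu (rect (- n%:R) n%:R (- n%:R) n%:R) (EFin \o f)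
    (fun x => tail gm x - tail gp x)%E.
  have nn0 : (- n%:R <= n%:R :> R) by rewrite (@le_trans _ _ 0)// ?oppr_le0 ler0n.
  apply: ae_eq_rect.
  - by apply: integrableS fi => //; exact: measurable_rect.
  - by apply: integrableB; [exact: measurable_rect|exact: tailI..].
  move=> a b c d _; rewrite /=.
  have [ab|ba] := leP a b; last first.
    have -> : rect a b c d = set0 :> set (R * R).
      by rewrite -subset0 => x [/=]; rewrite in_itv/= => /andP[? ?]; lra.
    by rewrite !integral_set0.
  have [cd|dc] := leP c d; last first.
    have -> : rect a b c d = set0 :> set (R * R).
      by rewrite -subset0 => x [/= _]; rewrite in_itv/= => /andP[? ?]; lra.
    by rewrite !integral_set0.
  rewrite integralB//; [|exact: measurable_rect|exact: tailI..].
  have tailE (h : plane -> R) : measurable_fun [set: plane] h -> (forall x, 0 <= h x) ->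
      (\int[mu]_(x in rect a b c d) tail h x = \int[mu]_x (h x * k a b c d x)%:E)%E.
    by move=> mh h0; exact: tail_rect.
  rewrite (tailE _ mgm gm0) (tailE _ mgp gp0) integral_rect_indic.
  transitivity (- \int[mu]_x (g x * k a b c d x)%:E)%E.
    transitivity (\int[mu]_x (f x * ((heavi (x.1 - a) - heavi (x.1 - b)) *
                       (heavi (x.2 - c) - heavi (x.2 - d))))%:E)%E.
      by apply: eq_integral => x _; rewrite !heavi_itv.
    rewrite H; congr (- _)%E; apply: eq_integral => x _.
    by rewrite /k (heavi_itv _ cd).
  rewrite (_ : (\int[mu]_x (g x * k a b c d x)%:E)%E =
    (\int[mu]_x (gp x * k a b c d x)%:E - \int[mu]_x (gm x * k a b c d x)%:E)%E).
    have I2fin : (\int[mu]_x (gm x * k a b c d x)%:E)%E \is a fin_num.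
      exact: integrable_fin_num (gki _ _ _ _ _ gmi).
    rewrite (fin_num_oppeB _ I2fin); exact: addeC.
  rewrite -integralB//; [|exact: gki..].
  by apply: eq_integral => x _; rewrite -EFinB -mulrBl -gE.
have [N [mN N0 fN]] : {ae mu, forall x, (f x)%:E = tail gm x - tail gp x}%E.
  by apply: ae_rects => n; exact: fE.
exists N; first by exists N; split.
move=> u y y' yy' Ny Ny'.
have Ey : ((f (y, u))%:E = tail gm (y, u) - tail gp (y, u))%E.
  by apply: contrapT => h; apply: Ny; exact: fN.
have Ey' : ((f (y', u))%:E = tail gm (y', u) - tail gp (y', u))%E.
  by apply: contrapT => h; apply: Ny'; exact: fN.
have gpu : measurable_fun [set: line] (fun s => gp (s, u)) by exact: (measurableT_comp mgp).
have gmu : measurable_fun [set: line] (fun s => gm (s, u)) by exact: (measurableT_comp mgm).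
have -> : (\int[lam]_(s in `]y, y']) `|g (s, u)|%:E =
  \int[lam]_(s in `]y, y']) (gp (s, u))%:E + \int[lam]_(s in `]y, y']) (gm (s, u))%:E)%E.
  rewrite -ge0_integralD//.
  - by apply: eq_integral => s _; rewrite gN.
  - by move=> s _; rewrite lee_fin.
  - by apply/measurable_EFinP; exact: measurable_funTS.
  - by move=> s _; rewrite lee_fin.
  - by apply/measurable_EFinP; exact: measurable_funTS.
(* Each tail at [y] is the tail at [y'] plus the integral over []y, y']], so the increment of [f] is
   a difference of two such integrals. *)
rewrite (tail_itv mgp gp0 u yy') (tail_itv mgm gm0 u yy') in Ey.
apply: (ereal_diff_bound _ _ Ey Ey').
  by apply: integral_ge0 => s _; rewrite lee_fin.
by apply: integral_ge0 => s _; rewrite lee_fin.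
Qed.

End acl.

(** * Exchanging the two coordinates *)

Section swap.
Context {R : realType}.
Local Notation line := (measurableTypeR R).
Local Notation plane := (measurableTypeR R * measurableTypeR R)%type.
Local Notation mu := (@plane_measure R).
Local Notation lam := (@lebesgue_measure R).

Definition swp (x : plane) : plane := (x.2, x.1).

Lemma measurable_swp : measurable_fun [set: plane] swp.
Proof. by apply: measurable_fun_pair. Qed.

(** Tonelli in one order for [f \o swp] and in the other order for [f] gives the same iterated
    integral. *)
Lemma ge0_integral_swp (f : plane -> \bar R) : measurable_fun [set: plane] f ->
  (forall x, 0 <= f x)%E -> (\int[mu]_x f (swp x) = \int[mu]_x f x)%E.
Proof.
move=> mf f0; have mfs : measurable_fun [set: plane] (f \o swp).
  by apply: measurableT_comp mf measurable_swp.
rewrite (@fubini_tonelli1 _ _ line line R lam lam _ mfs (fun x => f0 (swp x))).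
by rewrite (@fubini_tonelli2 _ _ line line R lam lam f mf f0).
Qed.

Lemma integrable_swp (f : plane -> R) : mu.-integrable [set: plane] (EFin \o f) ->
  mu.-integrable [set: plane] (EFin \o (f \o swp)).
Proof.
move=> /integrableP[mf fi]; apply/integrableP; split.
  by apply: (measurableT_comp mf measurable_swp).
rewrite (ge0_integral_swp (f := fun x => `|(f x)%:E|%E))//.
exact: measurableT_comp.
Qed.

Lemma integral_swp (f : plane -> R) : mu.-integrable [set: plane] (EFin \o f) ->
  (\int[mu]_x (f (swp x))%:E = \int[mu]_x (f x)%:E)%E.
Proof.
move=> fi; have mf := measurable_int _ fi.
rewrite integralE [RHS]integralE; congr (_ - _)%E.
  rewrite -(ge0_integral_swp (f := (EFin \o f)^\+%E))//.
    by apply: eq_integral => x _; rewrite !funeposE.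
  exact: measurable_funepos.
rewrite -(ge0_integral_swp (f := (EFin \o f)^\-%E))//.
  by apply: eq_integral => x _; rewrite !funenegE.
exact: measurable_funeneg.
Qed.

Lemma plane_measure_swp (A : set plane) : measurable A -> mu (swp @^-1` A) = mu A.
Proof.
move=> mA; have mA' : measurable (swp @^-1` A).
  by rewrite -[X in measurable X]setTI; exact: measurable_swp.
have E : (\int[mu]_x (\1_(swp @^-1` A) x)%:E = \int[mu]_x (\1_A x)%:E)%E.
  apply: (ge0_integral_swp (f := fun x => (\1_A x)%:E)); first exact/measurable_EFinP.
  by move=> x; rewrite lee_fin.
by move: E; rewrite !integral_indic// !setIT.
Qed.

Lemma negligible_swp (N : set plane) : mu.-negligible N -> mu.-negligible (swp @^-1` N).
Proof.
move=> [A [mA A0 NA]]; exists (swp @^-1` A); split.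
- by rewrite -[X in measurable X]setTI; exact: measurable_swp.
- by rewrite plane_measure_swp.
- by move=> x; exact: NA.
Qed.

End swap.

(** * Absolute continuity along both axes; uniqueness of weak derivatives *)

Section acl_weak.
Context {R : realType}.
Local Notation line := (measurableTypeR R).
Local Notation plane := (measurableTypeR R * measurableTypeR R)%type.
Local Notation mu := (@plane_measure R).
Local Notation lam := (@lebesgue_measure R).

Lemma is_derive_fst x v : is_derive x v (fst : R * R -> R) v.1.
Proof. by apply: is_derive_affine_line. Qed.

Lemma is_derive_snd x v : is_derive x v (snd : R * R -> R) v.2.
Proof. by apply: is_derive_affine_line. Qed.

Lemma weak_derivative_acl1 (f g : plane -> R) :
  mu.-integrable [set: plane] (EFin \o f) -> mu.-integrable [set: plane] (EFin \o g) ->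
  weak_derivative e1 (EFin \o f) g ->
  exists2 N : set plane, mu.-negligible N & acl1 f g N.
Proof.
move=> fi gi wfg; apply: acl_of_identity => // a0 a1 c d.
apply: (rect_identity a0 a1 c d _ smooth_fst smooth_snd _ _ fi gi wfg); first by left.
  by move=> x; exact: is_derive_fst.
by move=> x; exact: is_derive_snd.
Qed.

Lemma weak_derivative_acl2 (f g : plane -> R) :
  mu.-integrable [set: plane] (EFin \o f) -> mu.-integrable [set: plane] (EFin \o g) ->
  weak_derivative e2 (EFin \o f) g ->
  exists2 N : set plane, mu.-negligible N & acl2 f g N.
Proof.
move=> fi gi wfg.
have [||a0 a1 c d|N N0 NP] := @acl_of_identity R (f \o swp) (g \o swp).
- exact: integrable_swp.
- exact: integrable_swp.
(* The roles of the coordinates are exchanged here; [integral_swp] then carries the identity over to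
   [f \o swp]. *)
- have := @rect_identity R e2 snd fst f g a0 a1 c d (or_intror erefl) smooth_snd smooth_fst.
  move=> /(_ (fun x => is_derive_snd _ _) (fun x => is_derive_fst _ _) fi gi wfg).
  have mh e e' : measurable_fun [set: plane] (fun x => heavi (x.2 - e) - heavi (x.2 - e')).
    by apply: measurable_funB; apply: (measurableT_comp measurable_heavi); exact: measurable_funB.
  have mh' e e' : measurable_fun [set: plane] (fun x => heavi (x.1 - e) - heavi (x.1 - e')).
    by apply: measurable_funB; apply: (measurableT_comp measurable_heavi); exact: measurable_funB.
  have hb (z e e' : R) : `|heavi (z - e) - heavi (z - e')| <= 1.
    have h01 (t : R) : 0 <= heavi t <= 1.
      by have [t0|t0] := leP t 0; [rewrite heavi_le0// lexx ler01|rewrite heavi_gt0// lexx ler01].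
    have /andP[? ?] := h01 (z - e); have /andP[? ?] := h01 (z - e').
    by rewrite ler_norml; apply/andP; split; lra.
  have mm : measurable_fun [set: plane] (fun x => Num.max (x.2 - a0) 0 - Num.max (x.2 - a1) 0).
    by apply: measurable_funB; apply: measurable_maxr => //; exact: measurable_funB.
  have mb (z : R) : `|Num.max (z - a0) 0 - Num.max (z - a1) 0| <= `|a1 - a0|.
    by rewrite (le_trans (max0_lip _ _))// (_ : _ - _ = a1 - a0)//; ring.
  have i1 := @integrable_mul_bounded _ _ _ mu _ f _ 1 measurableT fi
    (measurable_funM (mh a0 a1) (mh' c d)).
  have i2 := @integrable_mul_bounded _ _ _ mu _ g _ `|a1 - a0| measurableT gi
    (measurable_funM mm (mh' c d)).
  rewrite -(integral_swp (i1 _)); last by move=> x; rewrite normrM mulr_ile1.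
  rewrite -(integral_swp (i2 _))//.
  by move=> x; rewrite normrM -[leRHS]mulr1 ler_pM.
exists (swp @^-1` N); first exact: negligible_swp.
by move=> u y y' yy' Ny Ny'; exact: (NP u y y' yy' Ny Ny').
Qed.

(** The right-hand factors stay positive up to [b + (nn n)^-1] and [d + (nn n)^-1]; hence the limit
    is 1 at the closed ends [b] and [d], and equals the indicator of the half-open [rect]. *)
Definition bump_rect a b c d n (x : R * R) : R :=
  flat 0 (nn n * (x.1 - a)) * flat 0 (nn n * (nn n * (b - x.1) + 1)) *
  (flat 0 (nn n * (x.2 - c)) * flat 0 (nn n * (nn n * (d - x.2) + 1))).

Lemma cvg_flat_heavi_le (t : R) :
  flat 0 (nn n * (nn n * t + 1)) @[n --> \oo] --> (if 0 <= t then 1 else 0 : R).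
Proof.
have [t0|t0] := leP 0 t.
  apply: (@squeeze_cvgr _ _ _ _ (fun n => 1 - (nn n)^-1 / 1) (cst 1)).
  - apply: nearW => n; have nt : 0 < nn n * t + 1 by rewrite ltr_wpDl// mulr_ge0// ltW// nn_gt0.
    have /andP[lo ->] := flat_heavi_le n nt; rewrite andbT (le_trans _ lo)//.
    rewrite lerD2l lerN2 ler_wpM2l ?invr_ge0 ?(ltW (nn_gt0 _))// lef_pV2 ?posrE//.
    by rewrite lerDr mulr_ge0// ltW// nn_gt0.
  - by rewrite -[X in _ --> X]subr0; apply: cvgB; [exact: cvg_cst|exact: cvg_nn].
  - exact: cvg_cst.
apply: cvg_near_cst; near=> n; apply: flat_le0; rewrite pmulr_rle0 ?nn_gt0//.
suff : (nn n)^-1 <= - t.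
  by rewrite -[_^-1]mul1r ler_pdivrMr ?nn_gt0// mulNr mulrC; lra.
near: n; have Nt0 : 0 < - t by rewrite oppr_gt0.
have := @cvg_harmonic R => /cvgrPdist_le/(_ _ Nt0).
by apply: filterS => n; rewrite sub0r normrN gtr0_norm ?invr_gt0 ?nn_gt0.
Unshelve. all: by end_near. Qed.

Lemma cvg_bump_rect a b c d x :
  bump_rect a b c d n x @[n --> \oo] --> (\1_(rect a b c d) x : R).
Proof.
have itvE (z e e' : R) : heavi (z - e) * (if 0 <= e' - z then 1 else 0) = \1_`]e, e'] z.
  rewrite indicE mem_setE in_itv/= subr_ge0.
  have [ez|ez] := ltP e z; last by rewrite heavi_le0 ?mul0r// subr_le0.
  by rewrite heavi_gt0 ?subr_gt0// mul1r; case: ifP.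
rewrite rect_indic -!itvE; apply: cvgM; apply: cvgM; try exact: cvg_flat_heavi;
exact: cvg_flat_heavi_le.
Qed.

Lemma bump_rect_support a b c d n x : ~ rect a (b + 1) c (d + 1) x -> bump_rect a b c d n x = 0.
Proof.
have z1 (z e : R) : z <= e -> flat 0 (nn n * (z - e)) = 0.
  by move=> ze; rewrite flat_le0// pmulr_rle0 ?nn_gt0// subr_le0.
have z2 (z e : R) : e + 1 < z -> flat 0 (nn n * (nn n * (e - z) + 1)) = 0.
  move=> ez; rewrite flat_le0// pmulr_rle0 ?nn_gt0//.
  by have : 1 <= nn n :> R by [rewrite /nn ler1n]; nra.
rewrite /rect/= !in_itv/= => /not_andP[] /negP/nandP[]; rewrite -?leNgt -?ltNge => xr; rewrite /bump_rect.
- by rewrite z1// !mul0r.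
- by rewrite (z2 x.1)// mulr0 mul0r.
- by rewrite (z1 x.2)// mul0r mulr0.
- by rewrite (z2 x.2)// !mulr0.
Qed.

Lemma test_function_bump_rect a b c d n : test_function (bump_rect a b c d n).
Proof.
apply: (smooth_test_function (M := `|a| + `|b| + `|c| + `|d| + 1)).
  have sl (r : R * R -> R) e : smooth r -> smooth (fun x => flat 0 (nn n * (r x - e))).
    move=> sr; apply: smooth_flat; apply: smoothM; first exact: smooth_cst.
    by apply: smoothB => //; exact: smooth_cst.
  have sr (r : R * R -> R) e : smooth r ->
      smooth (fun x => flat 0 (nn n * (nn n * (e - r x) + 1))).
    move=> sr; apply: smooth_flat; apply: smoothM; first exact: smooth_cst.
    apply: smoothD; last exact: smooth_cst.
    apply: smoothM; first exact: smooth_cst.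
    by apply: smoothB => //; exact: smooth_cst.
  apply: smoothM; apply: smoothM.
  - exact/sl/smooth_fst.
  - exact/sr/smooth_fst.
  - exact/sl/smooth_snd.
  - exact/sr/smooth_snd.
move=> x bx; have [|/bump_rect_support b0] := pselect (rect a (b + 1) c (d + 1) x); last first.
  by move: bx; rewrite b0 eqxx.
rewrite /rect/= !in_itv/= => -[/andP[? ?] /andP[? ?]].
have := ler_norm a; have := ler_norm b; have := ler_norm c; have := ler_norm d.
have := ler_norm (- a); have := ler_norm (- b); have := ler_norm (- c); have := ler_norm (- d).
have := normr_ge0 a; have := normr_ge0 b; have := normr_ge0 c; have := normr_ge0 d.
rewrite !normrN => *.
by split; rewrite ler_norml; apply/andP; split; lra.
Qed.

Lemma bump_rect_le1 a b c d n x : `|bump_rect a b c d n x| <= 1.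
Proof.
have n1 y : `|flat 0 y| <= 1 :> R by rewrite ger0_norm ?flat_ge0//; exact: (flat_le 0).
by rewrite !normrM; apply: mulr_ile1; rewrite ?mulr_ge0//; apply: mulr_ile1.
Qed.

(** Membership in W^{1,1} and in W^{1,2} supplies two weak gradients, to be identified.
    Integrability is asked on rectangles because a square integrable function may fail to be
    integrable on the plane. *)
Lemma weak_derivative_unique v (f : plane -> \bar R) (g g' : plane -> R) :
  (forall a b c d, mu.-integrable (rect a b c d) (EFin \o g)) ->
  (forall a b c d, mu.-integrable (rect a b c d) (EFin \o g')) ->
  weak_derivative v f g -> weak_derivative v f g' ->
  {ae mu, forall x, g x = g' x}.
Proof.
move=> gi g'i wg wg'.
have mb a b c d n : measurable_fun [set: plane] (bump_rect a b c d n).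
  apply: continuous_measurable_plane; apply: test_function_continuous.
  exact: test_function_bump_rect.
have lim (h : plane -> R) a b c d : mu.-integrable (rect a (b + 1) c (d + 1)) (EFin \o h) ->
    (\int[mu]_x (h x * bump_rect a b c d n x)%:E @[n --> \oo] -->
     \int[mu]_(x in rect a b c d) (h x)%:E)%E.
  move=> ih; have mr := measurable_rect a (b + 1) c (d + 1).
  have := @cvg_integral_mul _ _ _ mu _ h (bump_rect a b c d) (fun x => \1_(rect a b c d) x) 1 mr ih.
  move=> /(_ (fun n => measurable_funTS (mb a b c d n)) (bump_rect_le1 a b c d)).
  move=> /(_ (fun x _ => @cvg_bump_rect a b c d x)).
  rewrite (_ : (\int[mu]_(x in rect a (b + 1) _ _) _)%E = (\int[mu]_(x in rect a b c d) (h x)%:E)%E).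
    under eq_cvg => n.
      rewrite (_ : (\int[mu]_(x in _) _)%E = (\int[mu]_x (h x * bump_rect a b c d n x)%:E)%E).
        over.
      rewrite integral_mkcond; apply: eq_integral => x _; rewrite patchE.
      by case: ifPn => // /negP xr; rewrite bump_rect_support ?mulr0// => rx; exact/xr/mem_set.
    by [].
  rewrite integral_mkcond [RHS]integral_mkcond; apply: eq_integral => x _; rewrite !patchE indicE.
  case: ifPn => [_|/negP xr]; first by case: ifP => _; rewrite ?mulr1 ?mulr0.
  case: ifPn => // /set_mem[x1 x2]; exfalso; apply: xr; apply/mem_set.
  move: x1 x2; rewrite /rect/= !in_itv/= => /andP[-> x1] /andP[-> x2].
  by split; lra.
have E a b c d : (\int[mu]_(x in rect a b c d) (g x)%:E = \int[mu]_(x in rect a b c d) (g' x)%:E)%E.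
  rewrite -(cvg_lim _ (lim g a b c d (gi _ _ _ _)))//; apply: cvg_lim => //.
  under eq_cvg => n.
    rewrite (_ : (\int[mu]_x _)%E = (\int[mu]_x (g' x * bump_rect a b c d n x)%:E)%E); first over.
    apply: oppe_inj; rewrite -(wg _ (test_function_bump_rect a b c d n)).
    exact: (wg' _ (test_function_bump_rect a b c d n)).
  exact: lim.
apply: ae_rects => n; have := @ae_eq_rect R _ _ _ _ (EFin \o g) (EFin \o g')
  (gi (- n%:R) n%:R (- n%:R) n%:R) (g'i _ _ _ _) (fun a b c d _ => E a b c d).
by apply: filterS => x gx /gx[].
Qed.

End acl_weak.

(** * Splitting the perimeter along a rectangle *)

Section step.
Context {R : realType}.
Implicit Types (z : R).

Lemma flat_nondecreasing z z' : z <= z' -> flat 0 z <= flat 0 z'.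
Proof.
move=> zz'; have [z0|z0] := leP z 0; first by rewrite flat_le0// flat_ge0.
rewrite !flat0E// ?ler_expR ?lerN2 ?lef_pV2 ?posrE//; exact: lt_le_trans zz'.
Qed.

(** A step from 0 (for z <= 0) to 1 (for z >= 1), obtained by composing [flat 0] with itself so that
    it stays visibly in the class [smooth]. For z <= 0 the inner difference is nonpositive; for z >=
    1 it equals [flat 0 1]. *)
Definition stepf z : R := (flat 0 (flat 0 1))^-1 * flat 0 (flat 0 1 - flat 0 (1 - z)).

Definition dstepf z : R :=
  (flat 0 (flat 0 1))^-1 * (flat 2 (flat 0 1 - flat 0 (1 - z)) * flat 2 (1 - z)).

Let flat01 : 0 < flat 0 (flat 0 1) :> R.
Proof. by rewrite !flat_gt0. Qed.

Lemma stepf_le0 z : z <= 0 -> stepf z = 0.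
Proof.
move=> z0; rewrite /stepf (flat_le0 0 (x := _ - _)) ?mulr0// subr_le0.
by apply: flat_nondecreasing; rewrite lerBrDr addrC -lerBrDr subrr.
Qed.

Lemma stepf_ge1 z : 1 <= z -> stepf z = 1.
Proof.
move=> z1; rewrite /stepf (flat_le0 0 (x := 1 - _)) ?subr_le0// subr0 mulVf//.
by rewrite gt_eqF.
Qed.

Lemma stepf_ge0 z : 0 <= stepf z.
Proof. by rewrite /stepf mulr_ge0 ?flat_ge0// invr_ge0 ltW. Qed.

Lemma stepf_le1 z : stepf z <= 1.
Proof.
rewrite /stepf mulrC ler_pdivrMr// mul1r; apply: flat_nondecreasing.
by rewrite gerBl flat_ge0.
Qed.

Lemma dstepf_le0 z : z <= 0 -> dstepf z = 0.
Proof.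
move=> z0; rewrite /dstepf (flat_le0 2 (x := _ - flat _ _)) ?mul0r ?mulr0// subr_le0.
by apply: flat_nondecreasing; rewrite lerBrDr addrC -lerBrDr subrr.
Qed.

Lemma dstepf_ge1 z : 1 <= z -> dstepf z = 0.
Proof.
by move=> z1; rewrite /dstepf (flat_le0 2 (x := 1 - _)) ?subr_le0// !mulr0.
Qed.

(** Each of the two factors [flat 2] in [dstepf] is at most 2! = 2. *)
Definition dstep_bound : R := 4 / flat 0 (flat 0 1).

Lemma dstepf_bound z : `|dstepf z| <= dstep_bound.
Proof.
rewrite /dstepf ger0_norm; last by rewrite !mulr_ge0 ?flat_ge0 ?invr_ge0 ?ltW.
rewrite /dstep_bound mulrC ler_pM2r ?invr_gt0//.
rewrite (_ : 4 = 2 * 2); last by ring.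
by apply: ler_pM; rewrite ?flat_ge0//; exact: (flat_le 2).
Qed.

Lemma is_derive_stepf (f : R * R -> R) (b : R) x v : is_derive x v f b ->
  is_derive x v (fun y => stepf (f y)) (dstepf (f x) * b).
Proof.
move=> df; have d1 := is_derive_flat_comp 0 (is_deriveB (is_derive_cst (1 : R) x v) df).
have d2 := is_derive_flat_comp 0 (is_deriveB (is_derive_cst (flat 0 1 : R) x v) d1).
apply: (is_derive_eq (@is_deriveZ _ _ _ _ ((flat 0 (flat 0 1))^-1) _ _ _ d2)).
rewrite /dstepf /= !mul0r !subr0 /GRing.scale/= !sub0r; ring.
Qed.

Lemma smooth_stepf (f : R * R -> R) : smooth f -> smooth (fun y => stepf (f y)).
Proof.
move=> sf; apply: smoothM; first exact: smooth_cst.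
apply: smooth_flat; apply: smoothB; first exact: smooth_cst.
by apply: smooth_flat; apply: smoothB => //; exact: smooth_cst.
Qed.

Lemma cvg_stepf z : stepf (nn n * z) @[n --> \oo] --> heavi z.
Proof.
have [z0|z0] := leP z 0.
  rewrite heavi_le0//; apply: cvg_near_cst; apply: nearW => n.
  by apply: stepf_le0; rewrite pmulr_rle0// nn_gt0.
rewrite heavi_gt0//; apply: cvg_near_cst; near=> n; apply: stepf_ge1.
rewrite -ler_pdivrMl ?nn_gt0// mulr1.
near: n; have := @cvg_harmonic R => /cvgrPdist_le/(_ _ z0).
by apply: filterS => n; rewrite sub0r normrN gtr0_norm ?invr_gt0 ?nn_gt0.
Unshelve. all: by end_near. Qed.

End step.

Section eta.
Context {R : realType}.
Local Notation plane := (measurableTypeR R * measurableTypeR R)%type.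
Variables l1 r1 l2 r2 : R.

Definition orect : set (R * R) := `]l1, r1[ `*` `]l2, r2[.

(** The transition from 0 to 1 takes place inside the rectangle, within [(nn n)^-1] of its sides,
    that is, in the four strips defined below. *)
Definition eta n (x : R * R) : R :=
  stepf (nn n * (x.1 - l1)) * stepf (nn n * (r1 - x.1)) *
  (stepf (nn n * (x.2 - l2)) * stepf (nn n * (r2 - x.2))).

Definition deta1 n (x : R * R) : R := nn n *
  (stepf (nn n * (r1 - x.1)) * dstepf (nn n * (x.1 - l1)) -
   stepf (nn n * (x.1 - l1)) * dstepf (nn n * (r1 - x.1))) *
  (stepf (nn n * (x.2 - l2)) * stepf (nn n * (r2 - x.2))).

Definition deta2 n (x : R * R) : R := nn n *
  (stepf (nn n * (r2 - x.2)) * dstepf (nn n * (x.2 - l2)) -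
   stepf (nn n * (x.2 - l2)) * dstepf (nn n * (r2 - x.2))) *
  (stepf (nn n * (x.1 - l1)) * stepf (nn n * (r1 - x.1))).

Let is_derive_lo (f : R * R -> R) n a x v b : is_derive x v f b ->
  is_derive x v (fun y => stepf (nn n * (f y - a))) (dstepf (nn n * (f x - a)) * (nn n * b)).
Proof.
move=> df; apply: is_derive_stepf.
by apply: (is_derive_eq (@is_deriveZ _ _ _ _ (nn n) _ _ _ (is_deriveB df (is_derive_cst a x v))));
  rewrite subr0.
Qed.

Let is_derive_hi (f : R * R -> R) n a x v b : is_derive x v f b ->
  is_derive x v (fun y => stepf (nn n * (a - f y))) (dstepf (nn n * (a - f x)) * (nn n * - b)).
Proof.
move=> df; apply: is_derive_stepf.
by apply: (is_derive_eq (@is_deriveZ _ _ _ _ (nn n) _ _ _ (is_deriveB (is_derive_cst a x v) df)));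
  rewrite sub0r.
Qed.

Lemma is_derive_eta1 n x : is_derive x e1 (eta n) (deta1 n x).
Proof.
have d1 := is_derive_fst x e1; have d2 := is_derive_snd x e1.
apply: (is_derive_eq (is_deriveM (is_deriveM (is_derive_lo n l1 d1) (is_derive_hi n r1 d1))
  (is_deriveM (is_derive_lo n l2 d2) (is_derive_hi n r2 d2)))).
rewrite /deta1 /e1 !mulrfctE /GRing.scale/=.
move: (nn n) (stepf _) (stepf _) (stepf _) (stepf _) (dstepf _) (dstepf _) (dstepf _) (dstepf _).
by move=> *; ring.
Qed.

Lemma is_derive_eta2 n x : is_derive x e2 (eta n) (deta2 n x).
Proof.
have d1 := is_derive_fst x e2; have d2 := is_derive_snd x e2.
apply: (is_derive_eq (is_deriveM (is_deriveM (is_derive_lo n l1 d1) (is_derive_hi n r1 d1))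
  (is_deriveM (is_derive_lo n l2 d2) (is_derive_hi n r2 d2)))).
rewrite /deta2 /e2 !mulrfctE /GRing.scale/=.
move: (nn n) (stepf _) (stepf _) (stepf _) (stepf _) (dstepf _) (dstepf _) (dstepf _) (dstepf _).
by move=> *; ring.
Qed.

Lemma smooth_eta n : smooth (eta n).
Proof.
have slo (f : R * R -> R) a : smooth f -> smooth (fun y => stepf (nn n * (f y - a))).
  move=> sf; apply: smooth_stepf; apply: smoothM; first exact: smooth_cst.
  by apply: smoothB => //; exact: smooth_cst.
have shi (f : R * R -> R) a : smooth f -> smooth (fun y => stepf (nn n * (a - f y))).
  move=> sf; apply: smooth_stepf; apply: smoothM; first exact: smooth_cst.
  by apply: smoothB => //; exact: smooth_cst.
apply: smoothM; apply: smoothM.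
- exact/slo/smooth_fst.
- exact/shi/smooth_fst.
- exact/slo/smooth_snd.
- exact/shi/smooth_snd.
Qed.

Lemma eta_ge0 n x : 0 <= eta n x.
Proof. by apply: mulr_ge0; apply: mulr_ge0; exact: stepf_ge0. Qed.

Lemma eta_le1 n x : eta n x <= 1.
Proof.
by apply: mulr_ile1; [apply: mulr_ge0| apply: mulr_ge0|apply: mulr_ile1|apply: mulr_ile1];
  rewrite ?stepf_ge0 ?stepf_le1.
Qed.

Lemma orect_indic x : \1_orect x =
  heavi (x.1 - l1) * heavi (r1 - x.1) * (heavi (x.2 - l2) * heavi (r2 - x.2)).
Proof.
have E (z a b : R) : heavi (z - a) * heavi (b - z) = (a < z < b)%R%:R.
  have [az|az] := ltP a z; last by rewrite heavi_le0 ?mul0r// subr_le0.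
  rewrite heavi_gt0 ?subr_gt0// mul1r.
  by have [zb|zb] := ltP z b; [rewrite heavi_gt0// subr_gt0|rewrite heavi_le0// subr_le0].
rewrite !E -natrM mulnb indicE; congr (_%:R); congr nat_of_bool.
by apply/idP/idP => [/set_mem|h]; [|apply/mem_set]; rewrite /orect/= ?in_itv/= => *; apply/andP.
Qed.

Lemma cvg_eta x : eta n x @[n --> \oo] --> (\1_orect x : R).
Proof. by rewrite orect_indic; apply: cvgM; apply: cvgM; exact: cvg_stepf. Qed.

Definition strip_l n : set (R * R) := `]l1, l1 + (nn n)^-1[ `*` `]l2, r2[.
Definition strip_r n : set (R * R) := `]r1 - (nn n)^-1, r1[ `*` `]l2, r2[.
Definition strip_d n : set (R * R) := `]l1, r1[ `*` `]l2, l2 + (nn n)^-1[.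
Definition strip_u n : set (R * R) := `]l1, r1[ `*` `]r2 - (nn n)^-1, r2[.

End eta.

Section eta_bounds.
Context {R : realType}.
Local Notation line := (measurableTypeR R).
Local Notation plane := (measurableTypeR R * measurableTypeR R)%type.
Local Notation mu := (@plane_measure R).
Variables l1 r1 l2 r2 : R.

Lemma setX_itv_indic (a b c d : R) (x : R * R) :
  \1_(`]a, b[ `*` `]c, d[ : set (R * R)) x = (a < x.1 < b)%R%:R * (c < x.2 < d)%R%:R :> R.
Proof.
rewrite -natrM mulnb indicE; congr (_%:R); congr nat_of_bool.
by apply/idP/idP => [/set_mem|h]; [|apply/mem_set]; rewrite /= ?in_itv/= => *; apply/andP.
Qed.

Lemma dstepf_scaled_bound n (t : R) :
  `|dstepf (nn n * t)| <= dstep_bound * (0 < t < (nn n)^-1)%R%:R.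
Proof.
have [t0|t0] := leP t 0.
  by rewrite dstepf_le0 ?normr0 ?mulr0//= pmulr_rle0// nn_gt0.
have [t1|t1] := leP (nn n)^-1 t.
  by rewrite dstepf_ge1 ?normr0 ?mulr0//= -ler_pdivrMl ?nn_gt0// mulr1.
by rewrite mulr1 dstepf_bound.
Qed.

Lemma step_pair_bound n (z a b : R) :
  0 <= stepf (nn n * (z - a)) * stepf (nn n * (b - z)) <= (a < z < b)%R%:R.
Proof.
rewrite mulr_ge0 ?stepf_ge0//=.
have [az|az] := leP z a.
  by rewrite stepf_le0 ?mul0r//= pmulr_rle0 ?nn_gt0// subr_le0.
have [bz|bz] := leP b z.
  by rewrite [X in _ * X]stepf_le0 ?mulr0//= pmulr_rle0 ?nn_gt0// subr_le0.
by apply: mulr_ile1; rewrite ?stepf_ge0 ?stepf_le1.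
Qed.

Let S : R := @dstep_bound R.

Let S0 : 0 <= S.
Proof. exact: le_trans (normr_ge0 _) (dstepf_bound 0). Qed.

Lemma dstep_pair_bound n (z a b : R) :
  `|stepf (nn n * (b - z)) * dstepf (nn n * (z - a)) -
    stepf (nn n * (z - a)) * dstepf (nn n * (b - z))| <=
  S * ((a < z < a + (nn n)^-1)%R%:R + (b - (nn n)^-1 < z < b)%R%:R).
Proof.
rewrite (le_trans (ler_normB _ _))// [leRHS]mulrDr lerD//.
  rewrite normrM -[leRHS]mul1r ler_pM//; first by rewrite ger0_norm ?stepf_ge0 ?stepf_le1.
  by rewrite (le_trans (dstepf_scaled_bound _ _))// subr_gt0 ltrBlDl.
rewrite normrM -[leRHS]mul1r ler_pM//; first by rewrite ger0_norm ?stepf_ge0 ?stepf_le1.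
by rewrite (le_trans (dstepf_scaled_bound _ _))// subr_gt0 ltrBlDl -ltrBlDr andbC.
Qed.

Let scaled_product_bound (N D P A C : R) : 0 <= N -> `|D| <= S * A -> 0 <= P <= C ->
  `|N * D * P| <= N * S * (A * C).
Proof.
move=> N0 DA /andP[P0 PC].
have -> : N * S * (A * C) = N * (S * A) * C by ring.
by rewrite !normrM (ger0_norm N0) (ger0_norm P0) ler_pM ?mulr_ge0// ler_wpM2l.
Qed.

Lemma deta1_bound n x : `|deta1 l1 r1 l2 r2 n x| <=
  nn n * S * (\1_(strip_l l1 l2 r2 n) x + \1_(strip_r r1 l2 r2 n) x).
Proof.
rewrite /strip_l /strip_r !setX_itv_indic -mulrDl.
apply: scaled_product_bound; [exact/ltW/nn_gt0|exact: dstep_pair_bound|].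
exact: step_pair_bound.
Qed.

Lemma deta2_bound n x : `|deta2 l1 r1 l2 r2 n x| <=
  nn n * S * (\1_(strip_d l1 r1 l2 n) x + \1_(strip_u l1 r1 r2 n) x).
Proof.
rewrite /strip_d /strip_u !setX_itv_indic -mulrDr [X in _ <= _ * X]mulrC.
apply: scaled_product_bound; [exact/ltW/nn_gt0|exact: dstep_pair_bound|].
exact: step_pair_bound.
Qed.

End eta_bounds.

Lemma muleD4 (R : realType) (k a b c d : \bar R) :
  (0 <= a)%E -> (0 <= b)%E -> (0 <= c)%E -> (0 <= d)%E ->
  (k * ((a + b) + (c + d)) = (k * a + k * b) + (k * c + k * d))%E.
Proof. by move=> *; rewrite ge0_muleDr ?adde_ge0// !ge0_muleDr. Qed.

Section perimeter_split.
Context {R : realType}.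
Local Notation line := (measurableTypeR R).
Local Notation plane := (measurableTypeR R * measurableTypeR R)%type.
Local Notation mu := (@plane_measure R).

Lemma is_derive_convex (v : R * R) (e p q : R * R -> R) x (e' p' q' : R) :
  is_derive x v e e' -> is_derive x v p p' -> is_derive x v q q' ->
  is_derive x v (fun y => e y * p y + (1 - e y) * q y)
    (e x * p' + (1 - e x) * q' + (p x - q x) * e').
Proof.
move=> de dp dq.
have d1 := is_deriveM de dp.
have d2 := is_deriveM (is_deriveB (is_derive_cst (1 : R) x v) de) dq.
apply: (is_derive_eq (is_deriveD d1 d2)).
by rewrite ?mulrfctE ?addrfctE ?opprfctE /cst /GRing.scale/= sub0r; ring.
Qed.

Lemma test_function_convex (e p q : R * R -> R) : smooth e ->
  test_function p -> test_function q ->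
  test_function (fun y => e y * p y + (1 - e y) * q y).
Proof.
move=> se tp tq.
have [Mp hMp] := compact_sub_rect tp.2; have [Mq hMq] := compact_sub_rect tq.2.
have sp : smooth p by apply: smooth_Ck => k; exact: tp.1.
have sq : smooth q by apply: smooth_Ck => k; exact: tq.1.
apply: (smooth_test_function (M := Num.max Mp Mq)).
  apply: smoothD; first exact: smoothM.
  by apply: smoothM => //; apply: smoothB => //; exact: smooth_cst.
move=> x h0; have : p x != 0 \/ q x != 0.
  have [px|] := eqVneq (p x) 0; last by left.
  have [qx|] := eqVneq (q x) 0; last by right.
  by move: h0; rewrite px qx !mulr0 addr0 eqxx.
have box (M : R) : M <= Num.max Mp Mq -> rect (- M) M (- M) M x ->
    `|x.1| <= Num.max Mp Mq /\ `|x.2| <= Num.max Mp Mq.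
  rewrite /rect/= !in_itv/= !ler_norml => MM [/andP[? ?] /andP[? ?]].
  by split; apply/andP; split; lra.
move=> [px|qx].
  by apply: (box Mp); [rewrite le_max lexx|apply: hMp; exact: subset_closure].
by apply: (box Mq); [rewrite le_max lexx orbT|apply: hMq; exact: subset_closure].
Qed.

Lemma cvg_test_cutoff (E K : set plane) (e : nat -> R * R -> R) (h : R * R -> R) :
  measurable E -> measurable K -> mu.-integrable [set: plane] (EFin \o h) ->
  (forall n, measurable_fun [set: plane] (e n)) -> (forall n x, `|e n x| <= 1) ->
  (forall x, e n x @[n --> \oo] --> (\1_K x : R)) ->
  (\int[mu]_(x in E) (h x * e n x)%:E @[n --> \oo] --> \int[mu]_(x in E `&` K) (h x)%:E)%E.
Proof.
move=> mE mK hi me e1 ek.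
have hE : mu.-integrable E (EFin \o h) by exact: integrableS hi.
have := @cvg_integral_mul _ _ _ mu E h e (fun x => \1_K x) 1 mE hE
  (fun n => measurable_funTS (me n)) e1 (fun x _ => ek x).
rewrite (_ : (\int[mu]_(x in E) (h x * \1_K x)%:E)%E = (\int[mu]_(x in E `&` K) (h x)%:E)%E)//.
rewrite integral_mkcond [RHS]integral_mkcond; apply: eq_integral => x _; rewrite !patchE indicE in_setI.
by case: ifP => //= _; case: ifP; rewrite ?mulr1 ?mulr0.
Qed.

Lemma test_function0 : test_function (fun _ : R * R => 0 : R).
Proof.
by apply: (smooth_test_function (M := 0)) => [|x]; [exact: smooth_cst|rewrite eqxx].
Qed.

Lemma perimeter_ge0 (E : set (R * R)) : (0 <= perimeter E)%E.
Proof.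
apply: ereal_sup_ubound; exists (fun=> 0), (fun=> 0).
have t0 := test_function0.
split => //; first by move=> x; rewrite expr0n/= addr0 ler01.
rewrite integral0_eq// => x _.
by rewrite !(derive_cst (0 : R)) addr0.
Qed.

Lemma sqr_le1_norm (a b : R) : a ^+ 2 + b ^+ 2 <= 1 -> `|a| <= 1 /\ `|b| <= 1.
Proof.
move=> ab; have a2 := sqr_ge0 a; have b2 := sqr_ge0 b.
by split; rewrite -(@ler_pXn2r _ 2) ?nnegrE// expr1n real_normK ?num_real//; lra.
Qed.

Variables (l1 r1 l2 r2 : R) (E : set plane).
Hypothesis mE : measurable E.
Let K : set plane := orect l1 r1 l2 r2.
(** [E] fills only o(1/n) of each boundary strip of width 1/n, which offsets the gradient of [eta],
    of order n. *)
Hypothesis strips : forall X : nat -> set plane,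
  X = strip_l l1 l2 r2 \/ X = strip_r r1 l2 r2 \/ X = strip_d l1 r1 l2 \/ X = strip_u l1 r1 r2 ->
  ((nn n)%:E * mu (E `&` X n) @[n --> \oo] --> 0)%E.

Let mK : measurable K.
Proof. exact: measurableX. Qed.

Let mstrip X n : X = strip_l l1 l2 r2 \/ X = strip_r r1 l2 r2 \/ X = strip_d l1 r1 l2 \/
  X = strip_u l1 r1 r2 -> measurable (X n : set plane).
Proof. by move=> [->|[->|[->|->]]]; exact: measurableX. Qed.

Let div (p q : R * R -> R) x := 'D_e1 p x + 'D_e2 q x.

Let div_int p q : test_function p -> test_function q ->
  mu.-integrable [set: plane] (EFin \o div p q).
Proof.
move=> tp tq; rewrite (_ : _ \o _ = (EFin \o 'D_e1 p) \+ (EFin \o 'D_e2 q))%E//.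
apply: integrableD => //; apply: test_function_derive_integrable => //; [by left|by right].
Qed.

(** A test field for [E] competes in both suprema on the right. *)
Lemma perimeter_subadd : (perimeter E <= perimeter (E `&` K) + perimeter (E `\` K))%E.
Proof.
apply: ub_ereal_sup => _ [p [q [tp tq pq1 ->]]].
have EK : E = (E `&` K) `|` (E `\` K) by rewrite setUIDK.
rewrite [in leLHS]EK integral_setU//; first last.
- by apply/disj_setPS => x [[_ ?] [_]].
- by rewrite -EK; exact: measurable_funTS (measurable_int _ (div_int tp tq)).
- exact: measurableD.
- exact: measurableI.
by apply: leeD; apply: ereal_sup_ubound; exists p, q.
Qed.

(** Given fields for the two pieces, the glued field e (p, q) + (1 - e) (p', q') still has norm at
    most 1 by convexity. Its divergence is the corresponding combination of divergences plus grad e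
    . (p - p', q - q'), and [strips] sends the integral of the last term to 0. *)
Lemma perimeter_superadd : (perimeter (E `&` K) + perimeter (E `\` K) <= perimeter E)%E.
Proof.
have [Eoo|Eoo] := eqVneq (perimeter E) +oo%E; first by rewrite Eoo leey.
have Efin : perimeter E \is a fin_num by rewrite ge0_fin_numE ?perimeter_ge0// ltey.
suff key p q p' q' : test_function p -> test_function q -> test_function p' -> test_function q' ->
    (forall x, p x ^+ 2 + q x ^+ 2 <= 1) -> (forall x, p' x ^+ 2 + q' x ^+ 2 <= 1) ->
    (\int[mu]_(x in E `&` K) (div p q x)%:E + \int[mu]_(x in E `\` K) (div p' q' x)%:E
     <= perimeter E)%E.
  have fin (D : set plane) p q : measurable D -> test_function p -> test_function q ->
      (\int[mu]_(x in D) (div p q x)%:E)%E \is a fin_num.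
    move=> mD tp tq; apply: (@integrable_fin_num _ _ _ mu D mD (EFin \o div p q)).
    by apply: integrableS (div_int tp tq).
  have mI : measurable (E `&` K) by exact: measurableI.
  have mDf : measurable (E `\` K) by exact: measurableD.
  have B1 p q : test_function p -> test_function q -> (forall x, p x ^+ 2 + q x ^+ 2 <= 1) ->
      (perimeter (E `\` K) <= perimeter E - \int[mu]_(x in E `&` K) (div p q x)%:E)%E.
    move=> tp tq pq; apply: ub_ereal_sup => _ [p' [q' [tp' tq' pq' ->]]].
    by rewrite leeBrDr ?fin// addeC; exact: key.
  (* The zero field on [E :&: K] shows that the other perimeter is finite, so that it can be moved
     across the inequality; the two suprema are then taken one after the other. *)
  have Bfin : perimeter (E `\` K) \is a fin_num.
    rewrite ge0_fin_numE ?perimeter_ge0//.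
    have := B1 _ _ test_function0 test_function0.
    have /[swap] /[apply] : forall x : R * R, (0 : R) ^+ 2 + 0 ^+ 2 <= 1.
      by move=> _; rewrite expr0n addr0.
    move=> /le_lt_trans; apply; rewrite ltey_eq fin_numB Efin fin//; exact: test_function0.
  rewrite -leeBrDr//; apply: ub_ereal_sup => _ [p [q [tp tq pq ->]]].
  by rewrite leeBrDr// addeC -leeBrDr ?fin//; exact: B1.
move=> tp tq tp' tq' pq pq'.
pose e := eta l1 r1 l2 r2.
pose P n y := e n y * p y + (1 - e n y) * p' y.
pose Q n y := e n y * q y + (1 - e n y) * q' y.
have tP n : test_function (P n) by apply: test_function_convex => //; exact: smooth_eta.
have tQ n : test_function (Q n) by apply: test_function_convex => //; exact: smooth_eta.
have e01 n x : 0 <= e n x <= 1 by rewrite eta_ge0 eta_le1.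
have PQ n x : P n x ^+ 2 + Q n x ^+ 2 <= 1.
  have /andP[e0 e1] := e01 n x; have := pq x; have := pq' x; rewrite /P /Q.
  move: (e n x) (p x) (q x) (p' x) (q' x) e0 e1 => t a b c d t0 t1 h1 h2.
  (* The exact defect of convexity of the squared norm. *)
  have -> : (t * a + (1 - t) * c) ^+ 2 + (t * b + (1 - t) * d) ^+ 2 =
    t * (a ^+ 2 + b ^+ 2) + (1 - t) * (c ^+ 2 + d ^+ 2)
    - t * (1 - t) * ((a - c) ^+ 2 + (b - d) ^+ 2) by ring.
  have h3 : 0 <= t * (1 - t) * ((a - c) ^+ 2 + (b - d) ^+ 2).
    by apply: mulr_ge0; [apply: mulr_ge0|apply: addr_ge0]; rewrite ?sqr_ge0 ?subr_ge0.
  have h4 : t * (a ^+ 2 + b ^+ 2) <= t by rewrite ler_piMr.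
  have h5 : (1 - t) * (c ^+ 2 + d ^+ 2) <= 1 - t by rewrite ler_piMr ?subr_ge0.
  lra.
pose r n x := (p x - p' x) * deta1 l1 r1 l2 r2 n x + (q x - q' x) * deta2 l1 r1 l2 r2 n x.
have divE n x : div (P n) (Q n) x = div p q x * e n x + div p' q' x * (1 - e n x) + r n x.
  have d (f : R * R -> R) v : test_function f -> v = e1 \/ v = e2 -> is_derive x v f ('D_v f x).
    by move=> tf ve; apply: derivableP; have [/(_ 1)[/(_ x)[? ?] _] _] := tf; case: ve => ->.
  have [_ E1] := is_derive_convex (is_derive_eta1 l1 r1 l2 r2 n x) (d p e1 tp (or_introl erefl))
    (d p' e1 tp' (or_introl erefl)).
  have [_ E2] := is_derive_convex (is_derive_eta2 l1 r1 l2 r2 n x) (d q e2 tq (or_intror erefl))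
    (d q' e2 tq' (or_intror erefl)).
  by rewrite /div /P /Q /r E1 E2 /e; ring.
have me n : measurable_fun [set: plane] (e n).
  by apply: continuous_measurable_plane; have [] := smooth_derive (smooth_eta l1 r1 l2 r2 n).
have me' n : measurable_fun [set: plane] (fun x => 1 - e n x) by exact: measurable_funB.
have i1 n : mu.-integrable E (fun x => (div p q x * e n x)%:E).
  apply: (integrable_mul_bounded (C := 1)) => //; last first.
  - by move=> x; have /andP[? ?] := e01 n x; rewrite ger0_norm.
  - exact: measurable_funTS.
  - by apply: integrableS (div_int tp tq).
have i2 n : mu.-integrable E (fun x => (div p' q' x * (1 - e n x))%:E).
  apply: (integrable_mul_bounded (C := 1)) => //; last first.
  - by move=> x; have /andP[? ?] := e01 n x; rewrite ger0_norm; lra.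
  - exact: measurable_funTS.
  - by apply: integrableS (div_int tp' tq').
have i3 n : mu.-integrable E (EFin \o r n).
  rewrite (_ : _ \o _ = (EFin \o div (P n) (Q n)) \-
    ((fun x => (div p q x * e n x)%:E) \+ (fun x => (div p' q' x * (1 - e n x))%:E)))%E.
    apply: integrableB => //; first by apply: integrableS (div_int (tP n) (tQ n)).
    exact: integrableD.
  by apply/funext => x /=; rewrite divE; congr EFin; ring.
have le n : (\int[mu]_(x in E) (div p q x * e n x)%:E +
    \int[mu]_(x in E) (div p' q' x * (1 - e n x))%:E +
    \int[mu]_(x in E) (r n x)%:E <= perimeter E)%E.
  have i12 : mu.-integrable E (fun x => (div p q x * e n x)%:E + (div p' q' x * (1 - e n x))%:E)%E.
    exact: integrableD.
  rewrite -(integralD mE (i1 n) (i2 n)) -(integralD mE i12 (i3 n)).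
  apply: ereal_sup_ubound; exists (P n), (Q n); split => //.
  by apply: eq_integral => x _; rewrite -!EFinD -divE.
have en n x : `|e n x| <= 1 by have /andP[? ?] := e01 n x; rewrite ger0_norm.
have en' n x : `|1 - e n x| <= 1 by have /andP[? ?] := e01 n x; rewrite ger0_norm; lra.
have lim1 := cvg_test_cutoff mE mK (div_int tp tq) me en (@cvg_eta R l1 r1 l2 r2).
have cK x : 1 - e n x @[n --> \oo] --> (\1_(~` K) x : R).
  have -> : \1_(~` K) x = 1 - \1_K x :> R.
    by rewrite !indicE in_setC; case: (x \in K); rewrite ?subrr ?subr0.
  by apply: cvgB; [exact: cvg_cst|exact: cvg_eta].
have lim2 := cvg_test_cutoff mE (measurableC mK) (div_int tp' tq') me' en' cK.
rewrite -setDE in lim2.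
have lim3 : (\int[mu]_(x in E) (r n x)%:E @[n --> \oo] --> 0)%E.
  apply/cvg_abse0P.
  (* The factor 2 bounds the difference of corresponding components of two fields of norm at most
     1. *)
  pose S2 : R := 2 * dstep_bound.
  have S0 : 0 <= dstep_bound :> R by exact: le_trans (normr_ge0 _) (dstepf_bound 0).
  have S20 : 0 <= S2 by rewrite mulr_ge0.
  pose Z (X : nat -> set plane) n := ((nn n)%:E * mu (E `&` X n))%E.
  have lim0 : ((S2%:E * ((Z (strip_l l1 l2 r2) n + Z (strip_r r1 l2 r2) n) +
      (Z (strip_d l1 r1 l2) n + Z (strip_u l1 r1 r2) n))) @[n --> \oo] --> 0)%E.
    rewrite -[X in _ --> X](mule0 S2%:E); apply: cvgeZl => //.
    have zz : (0 + 0 + (0 + 0) = 0 :> \bar R)%E by rewrite !adde0.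
    rewrite -[X in _ --> X]zz; apply: cvgeD => //; apply: cvgeD => //; apply: strips.
    - by left.
    - by right; left.
    - by right; right; left.
    - by right; right; right.
  apply: (squeeze_cvge _ (cvg_cst 0%E) lim0); apply: nearW => n; rewrite abse_ge0/=.
  have ms X := mstrip (X := X) n.
  have m1 : measurable (strip_l l1 l2 r2 n : set plane) by apply: ms; left.
  have m2 : measurable (strip_r r1 l2 r2 n : set plane) by apply: ms; right; left.
  have m3 : measurable (strip_d l1 r1 l2 n : set plane) by apply: ms; right; right; left.
  have m4 : measurable (strip_u l1 r1 r2 n : set plane) by apply: ms; right; right; right.
  have mi (X : set plane) : measurable X -> measurable_fun E (fun x => (\1_X x : R)%:E).
    by move=> mX; apply/measurable_EFinP; exact: measurable_funTS.
  apply: (le_trans (le_abse_integral _ _ _)) => //; first exact: measurable_int (i3 n).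
  have rb x : (`|(r n x)%:E| <= (S2 * nn n)%:E *
      (((\1_(strip_l l1 l2 r2 n) x)%:E + (\1_(strip_r r1 l2 r2 n) x)%:E) +
       ((\1_(strip_d l1 r1 l2 n) x)%:E + (\1_(strip_u l1 r1 r2 n) x)%:E)))%E.
    rewrite -!EFinD -EFinM abse_EFin lee_fin.
    have [p1 q1] := sqr_le1_norm (pq x); have [p1' q1'] := sqr_le1_norm (pq' x).
    have pb : `|p x - p' x| <= 2 by rewrite (le_trans (ler_normB _ _))//; lra.
    have qb : `|q x - q' x| <= 2 by rewrite (le_trans (ler_normB _ _))//; lra.
    have -> : forall c d u w : R, S2 * nn n * (c + d + (u + w)) =
        2 * (nn n * dstep_bound * (c + d)) + 2 * (nn n * dstep_bound * (u + w)).
      by move=> c d u w; rewrite /S2; ring.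
    rewrite /r (le_trans (ler_normD _ _))// [X in X + _ <= _]normrM [X in _ + X <= _]normrM.
    by apply: lerD; apply: ler_pM => //; [exact: deta1_bound|exact: deta2_bound].
  have mi2 (X Y : set plane) : measurable X -> measurable Y ->
      measurable_fun E (fun x => (\1_X x : R)%:E + (\1_Y x : R)%:E)%E.
    by move=> mX mY; apply: emeasurable_funD; exact: mi.
  have ii (X Y : set plane) : measurable X -> measurable Y ->
      (\int[mu]_(x in E) ((\1_X x : R)%:E + (\1_Y x : R)%:E) = mu (E `&` X) + mu (E `&` Y))%E.
    move=> mX mY; rewrite ge0_integralD//; [|exact: mi..].
    by rewrite !integral_indic// ![_ `&` E]setIC.
  apply: (@le_trans _ _ (\int[mu]_(x in E) ((S2 * nn n)%:E *
      (((\1_(strip_l l1 l2 r2 n) x)%:E + (\1_(strip_r r1 l2 r2 n) x)%:E) +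
       ((\1_(strip_d l1 r1 l2 n) x)%:E + (\1_(strip_u l1 r1 r2 n) x)%:E))))%E).
    apply: ge0_le_integral => //.
    - by apply: measurableT_comp => //; exact: measurable_int (i3 n).
    - by apply: measurable_funeM; apply: emeasurable_funD; exact: mi2.
  have nn0 : 0 <= S2 * nn n by rewrite mulr_ge0// ltW// nn_gt0.
  rewrite ge0_integralZl//; first last.
  - by move=> x _; rewrite -!EFinD lee_fin !addr_ge0.
  - by apply: emeasurable_funD; exact: mi2.
  rewrite ge0_integralD//; first last.
  - exact: mi2.
  - by move=> x _; rewrite -EFinD lee_fin addr_ge0.
  - exact: mi2.
  - by move=> x _; rewrite -EFinD lee_fin addr_ge0.
  rewrite !ii// EFinM -muleA lee_wpmul2l ?lee_fin//.
  have m0 (X : set plane) : (0 <= mu (E `&` X))%E by exact: measure_ge0.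
  by rewrite /Z muleD4// ?m0.
have lim12 : (\int[mu]_(x in E) (div p q x * e n x)%:E +
    \int[mu]_(x in E) (div p' q' x * (1 - e n x))%:E + \int[mu]_(x in E) (r n x)%:E @[n --> \oo]
    --> \int[mu]_(x in E `&` K) (div p q x)%:E + \int[mu]_(x in E `\` K) (div p' q' x)%:E + 0)%E.
  apply: cvgeD lim3; first exact: fin_num_adde_defl.
  apply: cvgeD lim1 lim2; apply: fin_num_adde_defr.
  apply: (@integrable_fin_num _ _ _ mu _ _ (EFin \o div p q)); first exact: measurableI.
  by apply: integrableS (div_int tp tq) => //; exact: measurableI.
rewrite -[leLHS]adde0; apply: cvge_le lim12; apply: nearW => n; exact: le.
Qed.

End perimeter_split.

(** * Slices of plane sets and thin strips *)

Section sections.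
Context {R : realType}.
Local Notation line := (measurableTypeR R).
Local Notation plane := (measurableTypeR R * measurableTypeR R)%type.
Local Notation mu := (@plane_measure R).
Local Notation lam := (@lebesgue_measure R).

Lemma plane_measure_ysection (A : set plane) : measurable A ->
  (mu A = \int[lam]_u lam (ysection A u))%E.
Proof.
move=> mA; have m1 : measurable_fun [set: plane] (fun x => (\1_A x : R)%:E) by exact/measurable_EFinP.
have f0 x : (0 <= (\1_A x : R)%:E)%E by rewrite lee_fin.
have := @fubini_tonelli2 _ _ line line R lam lam _ m1 f0.
rewrite integral_indic// setIT => ->.
apply: eq_integral => u _; rewrite /fubini_G /=.
rewrite (_ : (fun _ => _) = (fun y => (\1_(ysection A u) y : R)%:E)); last first.
  by apply/funext => y; rewrite !indicE mem_ysection.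
by rewrite integral_indic ?setIT//; exact: measurable_ysection.
Qed.

Lemma negligible_ysection (N : set plane) : mu.-negligible N ->
  {ae lam, forall u, lam.-negligible [set y | N (y, u)]}.
Proof.
move=> [A [mA A0 NA]].
have mys : measurable_fun [set: line] (fun u => lam (ysection A u)).
  exact: (measurable_fun_ysection lam mA).
have : ae_eq lam [set: line] (fun u => lam (ysection A u)) (cst 0%E).
  apply/ae_eq_integral_abs => //.
  rewrite -[RHS]A0 (plane_measure_ysection mA); apply: eq_integral => u _.
  by rewrite gee0_abs.
apply: filterS => u /(_ I) A0u; exists (ysection A u); split => //.
  exact: measurable_ysection.
by move=> y /NA Ay; rewrite /ysection/=; exact/mem_set.
Qed.

Lemma negligible_xsection (N : set plane) : mu.-negligible N ->
  {ae lam, forall u, lam.-negligible [set y | N (u, y)]}.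
Proof. by move=> /negligible_swp/negligible_ysection. Qed.

(** Dominated convergence over slices: a slice has measure at most [(nn n)^-1], so [F n] is
    dominated by the indicator of [D], and for almost every [u] it vanishes eventually. The rank
    from which it vanishes may depend on [u]. *)
Lemma strip_null (E : set plane) (I : nat -> set line) (D : set line) :
  measurable E -> (forall n, measurable (I n)) -> (forall n, lam (I n) <= (nn n)^-1%:E)%E ->
  measurable D -> (lam D < +oo)%E ->
  {ae lam, forall u, D u -> \forall n \near \oo, lam.-negligible [set y | I n y /\ E (y, u)]} ->
  ((nn n)%:E * mu (E `&` (I n `*` D)) @[n --> \oo] --> 0)%E.
Proof.
move=> mE mI lI mD Doo H.
pose A n : set plane := E `&` (I n `*` D).
have mA n : measurable (A n) by apply: measurableI => //; exact: measurableX.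
pose F n u := ((nn n)%:E * lam (ysection (A n) u))%E.
have mF n : measurable_fun [set: line] (F n).
  by apply: measurable_funeM; exact: (measurable_fun_ysection lam (mA n)).
have E1 n : ((nn n)%:E * mu (A n) = \int[lam]_u F n u)%E.
  rewrite plane_measure_ysection// ge0_integralZl//; first exact: (measurable_fun_ysection lam (mA n)).
  by rewrite lee_fin ltW// nn_gt0.
have secE n u : ysection (A n) u = [set y | (I n y /\ E (y, u)) /\ D u].
  apply/seteqP; split => y; rewrite /ysection/=; first by move=> /set_mem[? []].
  by move=> [[? ?] ?]; exact/mem_set.
have iD : lam.-integrable [set: line] (fun u => (\1_D u : R)%:E).
  exact: integrable_indic_lty.
under eq_cvg do rewrite E1.
have -> : (0 = \int[lam]_(u in [set: line]) (cst 0%E u))%E by rewrite integral0.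
have [//||||_ _] := @dominated_convergence _ _ _ lam [set: line] measurableT F (cst 0%E) _ _ _ _ iD => //.
- apply: filterS H => u Hu _; have [Du|Du] := pselect (D u).
    apply: cvg_near_cst; near=> n; rewrite /F secE.
    have [B [mB B0 IB]] : lam.-negligible [set y | I n y /\ E (y, u)].
      by near: n; exact: Hu.
    rewrite (_ : lam _ = 0%E) ?mule0//; apply/eqP; rewrite eq_le measure_ge0 andbT -B0.
    apply: le_measure; rewrite ?inE//; last by move=> y [/IB].
    by rewrite -secE; exact: measurable_ysection.
  apply: cvg_near_cst; apply: nearW => n; rewrite /F secE.
  by rewrite (_ : [set _ | _] = set0) ?measure0 ?mule0//; rewrite -subset0 => y [].
- apply: aeW => u n _; rewrite gee0_abs; last by rewrite mule_ge0// lee_fin ltW// nn_gt0.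
  rewrite /F secE indicE; case: (boolP (u \in D)) => [uD|/negP uD].
    apply: (@le_trans _ _ ((nn n)%:E * (nn n)^-1%:E)%E).
      rewrite lee_wpmul2l ?lee_fin ?(ltW (nn_gt0 _))//; apply: le_trans (lI n).
      apply: le_measure; rewrite ?inE//; last by move=> y [[]].
      by rewrite -secE; exact: measurable_ysection.
    by rewrite -EFinM divff// gt_eqF// nn_gt0.
  rewrite (_ : [set _ | _] = set0) ?measure0 ?mule0//.
  by rewrite -subset0 => y [_ ?]; exact/uD/mem_set.
Unshelve. all: by end_near. Qed.

Lemma strip_null_swp (E : set plane) (I : nat -> set line) (D : set line) :
  measurable E -> (forall n, measurable (I n)) -> (forall n, lam (I n) <= (nn n)^-1%:E)%E ->
  measurable D -> (lam D < +oo)%E ->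
  {ae lam, forall u, D u -> \forall n \near \oo, lam.-negligible [set y | I n y /\ E (u, y)]} ->
  ((nn n)%:E * mu (E `&` (D `*` I n)) @[n --> \oo] --> 0)%E.
Proof.
move=> mE mI lI mD Doo H.
have mEs : measurable (swp @^-1` E : set plane).
  by rewrite -[X in measurable X]setTI; exact: measurable_swp.
have := strip_null mEs mI lI mD Doo H.
rewrite (_ : (fun n => _) = (fun n => (nn n)%:E * mu (E `&` (D `*` I n)))%E)//.
apply/funext => n; rewrite -(@plane_measure_swp _ (E `&` (D `*` I n))); last first.
  by apply: measurableI => //; exact: measurableX.
congr (_ * mu _)%E; apply/seteqP; split => -[y u] /=; first by move=> [? [? ?]].
by move=> [? [? ?]].
Qed.

(** Absolute continuity of the integral; the rank depends only on the length of the interval,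
    whatever its position. *)
Lemma small_integral (h : line -> R) (e : R) : lam.-integrable [set: line] (EFin \o h) -> 0 < e ->
  \forall n \near \oo, forall a b : R, b - a <= (nn n)^-1 ->
    (\int[lam]_(s in `]a, b]) `|h s|%:E < e%:E)%E.
Proof.
move=> ih e0; have [d [d0 dh]] := integral_normr_continuous ih e0.
near=> n => a b ab.
have lab : (lam `]a, b]%classic < d%:E)%E.
  rewrite lebesgue_measure_itv/= lte_fin; case: ifP => _; rewrite ?lte_fin//.
  rewrite (le_lt_trans ab)//.
  near: n; have := @cvg_harmonic R => /cvgrPdist_lt/(_ _ d0).
  by apply: filterS => n; rewrite sub0r normrN gtr0_norm ?invr_gt0 ?nn_gt0.
have := dh _ (measurable_itv _) lab; rewrite /Rintegral -lte_fin fineK//.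
have ia : lam.-integrable `]a, b] (abse \o (EFin \o h)).
  by apply: integrable_abse; exact: integrableS ih.
exact: (integrable_fin_num _ ia).
Unshelve. all: by end_near. Qed.

End sections.

(** * Level sets near a boundary on which f is almost constant *)

Section perimeter_split_acl.
Context {R : realType}.
Local Notation line := (measurableTypeR R).
Local Notation plane := (measurableTypeR R * measurableTypeR R)%type.
Local Notation mu := (@plane_measure R).
Local Notation lam := (@lebesgue_measure R).
Variables (f g1 g2 : plane -> R) (N : set plane).
Hypotheses (g1i : mu.-integrable [set: plane] (EFin \o g1)).
Hypotheses (g2i : mu.-integrable [set: plane] (EFin \o g2)).
Hypotheses (N0 : mu.-negligible N) (acl1N : acl1 f g1 N) (acl2N : acl2 f g2 N).
Variables (l1 r1 l2 r2 c w w' : R).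
Hypothesis ww' : w < w'.
Hypothesis side_l : {ae lam, forall u, `]l2, r2[%classic u -> ~ N (l1, u) /\ `|f (l1, u) - c| <= w}.
Hypothesis side_r : {ae lam, forall u, `]l2, r2[%classic u -> ~ N (r1, u) /\ `|f (r1, u) - c| <= w}.
Hypothesis side_d : {ae lam, forall y, `]l1, r1[%classic y -> ~ N (y, l2) /\ `|f (y, l2) - c| <= w}.
Hypothesis side_u : {ae lam, forall y, `]l1, r1[%classic y -> ~ N (y, r2) /\ `|f (y, r2) - c| <= w}.
Variable E : set plane.
Hypothesis mE : measurable E.
Hypothesis Ef : forall x, E x -> ~ N x -> w' < `|f x - c|.

Let row_int : {ae lam, forall u, lam.-integrable [set: line] (EFin \o (fun y => g1 (y, u)))}.
Proof. exact: (@ae_integrable2 _ _ line line R lam lam (EFin \o g1) g1i). Qed.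

Let col_int : {ae lam, forall y, lam.-integrable [set: line] (EFin \o (fun u => g2 (y, u)))}.
Proof. exact: (@ae_integrable1 _ _ line line R lam lam (EFin \o g2) g2i). Qed.

Let len (a b : R) : (lam `]a, b[%classic < +oo)%E.
Proof. by rewrite lebesgue_measure_itv/=; case: ifP => _; rewrite ?ltry// -EFinB ltry. Qed.

Let len_nn (a b : R) n : b - a = (nn n)^-1 -> (lam `]a, b[%classic <= (nn n)^-1%:E)%E.
Proof.
move=> ab; rewrite lebesgue_measure_itv/=; case: ifP => _; first by rewrite -EFinB ab.
by rewrite lee_fin invr_ge0 ltW// nn_gt0.
Qed.

Let far (a b : R) : `|a - c| <= w -> w' < `|b - c| -> `|b - a| < w' - w -> False.
Proof.
move=> ac bc ba; have := ler_distD a b c; lra.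
Qed.

(** On almost every slice, [f] is within [w] of [c] on the side, and across a thin enough strip its
    increment is less than [w' - w]. Points of [E] off [N] have distance more than [w'] from [c], so
    the slice of [E] in the strip is null. *)
Lemma strips_of_acl (X : nat -> set plane) :
  X = strip_l l1 l2 r2 \/ X = strip_r r1 l2 r2 \/ X = strip_d l1 r1 l2 \/ X = strip_u l1 r1 r2 ->
  ((nn n)%:E * mu (E `&` X n) @[n --> \oo] --> 0)%E.
Proof.
have ww0 : 0 < w' - w by rewrite subr_gt0.
move=> [->|[->|[->|->]]].
- apply: strip_null; [by []|by []|by move=> n; apply: len_nn; ring|by []|exact: len|].
  near=> u => Du; near=> n.
  have Nu : lam.-negligible [set y | N (y, u)] by near: u; exact: negligible_ysection.
  apply: negligibleS Nu => y [/=]; rewrite in_itv/= => /andP[ay yb] Eyu; apply: contrapT => Nyu.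
  have [Nl fl] : ~ N (l1, u) /\ `|f (l1, u) - c| <= w by move: Du; near: u; exact: side_l.
  apply: (far fl (Ef Eyu Nyu)); rewrite -lte_fin.
  apply: le_lt_trans (acl1N (ltW ay) Nl Nyu) _.
  have small : forall a b : R, b - a <= (nn n)^-1 ->
      (\int[lam]_(s in `]a, b]) `|g1 (s, u)|%:E < (w' - w)%:E)%E.
    near: n; apply: (small_integral (h := fun s => g1 (s, u))) => //.
    by near: u; exact: row_int.
  by apply: small; rewrite lerBlDl ltW.
- apply: strip_null; [by []|by []|by move=> n; apply: len_nn; ring|by []|exact: len|].
  near=> u => Du; near=> n.
  have Nu : lam.-negligible [set y | N (y, u)] by near: u; exact: negligible_ysection.
  apply: negligibleS Nu => y [/=]; rewrite in_itv/= => /andP[ay yb] Eyu; apply: contrapT => Nyu.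
  have [Nl fl] : ~ N (r1, u) /\ `|f (r1, u) - c| <= w by move: Du; near: u; exact: side_r.
  apply: (far fl (Ef Eyu Nyu)); rewrite distrC -lte_fin.
  apply: le_lt_trans (acl1N (ltW yb) Nyu Nl) _.
  have small : forall a b : R, b - a <= (nn n)^-1 ->
      (\int[lam]_(s in `]a, b]) `|g1 (s, u)|%:E < (w' - w)%:E)%E.
    near: n; apply: (small_integral (h := fun s => g1 (s, u))) => //.
    by near: u; exact: row_int.
  by apply: small; rewrite lerBlDr -lerBlDl ltW.
- apply: strip_null_swp; [by []|by []|by move=> n; apply: len_nn; ring|by []|exact: len|].
  near=> u => Du; near=> n.
  have Nu : lam.-negligible [set y | N (u, y)] by near: u; exact: negligible_xsection.
  apply: negligibleS Nu => y [/=]; rewrite in_itv/= => /andP[ay yb] Eyu; apply: contrapT => Nyu.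
  have [Nl fl] : ~ N (u, l2) /\ `|f (u, l2) - c| <= w by move: Du; near: u; exact: side_d.
  apply: (far fl (Ef Eyu Nyu)); rewrite -lte_fin.
  apply: le_lt_trans (acl2N (ltW ay) Nl Nyu) _.
  have small : forall a b : R, b - a <= (nn n)^-1 ->
      (\int[lam]_(s in `]a, b]) `|g2 (u, s)|%:E < (w' - w)%:E)%E.
    near: n; apply: (small_integral (h := fun s => g2 (u, s))) => //.
    by near: u; exact: col_int.
  by apply: small; rewrite lerBlDl ltW.
- apply: strip_null_swp; [by []|by []|by move=> n; apply: len_nn; ring|by []|exact: len|].
  near=> u => Du; near=> n.
  have Nu : lam.-negligible [set y | N (u, y)] by near: u; exact: negligible_xsection.
  apply: negligibleS Nu => y [/=]; rewrite in_itv/= => /andP[ay yb] Eyu; apply: contrapT => Nyu.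
  have [Nl fl] : ~ N (u, r2) /\ `|f (u, r2) - c| <= w by move: Du; near: u; exact: side_u.
  apply: (far fl (Ef Eyu Nyu)); rewrite distrC -lte_fin.
  apply: le_lt_trans (acl2N (ltW yb) Nyu Nl) _.
  have small : forall a b : R, b - a <= (nn n)^-1 ->
      (\int[lam]_(s in `]a, b]) `|g2 (u, s)|%:E < (w' - w)%:E)%E.
    near: n; apply: (small_integral (h := fun s => g2 (u, s))) => //.
    by near: u; exact: col_int.
  by apply: small; rewrite lerBlDr -lerBlDl ltW.
Unshelve. all: by end_near. Qed.

Lemma perimeter_split : perimeter E =
  (perimeter (E `&` orect l1 r1 l2 r2) + perimeter (E `\` orect l1 r1 l2 r2))%E.
Proof.
apply/eqP; rewrite eq_le perimeter_subadd//=.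
exact: (perimeter_superadd mE strips_of_acl).
Qed.


End perimeter_split_acl.

(** * Choice of good rectangles *)

Section selection.
Context {R : realType}.
Local Notation line := (measurableTypeR R).
Local Notation plane := (measurableTypeR R * measurableTypeR R)%type.
Local Notation mu := (@plane_measure R).
Local Notation lam := (@lebesgue_measure R).

(** A mean value argument: otherwise [G] would be at least [e] almost everywhere on []a, b[],
    contradicting the bound on its integral. *)
Lemma pick_small (G : line -> \bar R) (P : line -> Prop) (a b e : R) : a < b -> 0 < e ->
  measurable_fun [set: line] G -> (forall u, 0 <= G u)%E ->
  (\int[lam]_u G u < ((b - a) * e)%:E)%E -> {ae lam, forall u, P u} ->
  exists u, [/\ a < u < b, P u & (G u < e%:E)%E].
Proof.
move=> ab e0 mG G0 Gint Pae; apply: contrapT => noex.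
suff : (((b - a) * e)%:E <= \int[lam]_u G u)%E by rewrite leNgt Gint.
pose I : set R := `]a, b[%classic.
have mI : measurable I by exact: measurable_itv.
have lI : (lam I = (b - a)%:E)%E by rewrite lebesgue_measure_itv/= lte_fin ab.
apply: (@le_trans _ _ (\int[lam]_(u in I) G u)%E); last first.
  by apply: ge0_subset_integral.
apply: (@le_trans _ _ (\int[lam]_(u in I) (cst e%:E u))%E).
  have -> : (\int[lam]_(u in I) (cst e%:E u) = e%:E * (b - a)%:E)%E.
    by rewrite -lI; exact: integral_cst.
  by rewrite -EFinM mulrC.
apply: ae_ge0_le_integral => //.
- by move=> u _; rewrite lee_fin ltW.
- exact: measurable_funTS.
- apply: filterS Pae => u Pu; rewrite /I/= in_itv/= => ub.
  rewrite leNgt; apply/negP => Gu; apply: noex; exists u; split => //.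
Qed.

Lemma integral_abs_le_sqr (Q : set plane) (g : plane -> R) (k : R) : measurable Q -> 0 < k ->
  measurable_fun [set: plane] g ->
  (\int[mu]_(x in Q) `|g x|%:E <= k%:E * mu Q + k^-1%:E * \int[mu]_(x in Q) (g x ^+ 2)%:E)%E.
Proof.
move=> mQ k0 mg; have mg2 : measurable_fun Q (fun x => (g x ^+ 2)%:E).
  by apply/measurable_EFinP; apply: measurable_funTS; exact: measurable_funX.
rewrite -(integral_cst _ mQ) -ge0_integralZl//; first last.
- by rewrite lee_fin invr_ge0 ltW.
- by move=> x _; rewrite lee_fin sqr_ge0.
rewrite -ge0_integralD//; first last.
- exact: measurable_funeM.
- by move=> x _; rewrite -EFinM lee_fin mulr_ge0 ?sqr_ge0 ?invr_ge0 ?ltW.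
- by move=> x _; rewrite lee_fin ltW.
apply: ge0_le_integral => //.
- by apply/measurable_EFinP; apply: measurable_funTS; exact: measurableT_comp.
- by apply: emeasurable_funD => //; exact: measurable_funeM.
move=> x _; rewrite /= lee_fin -real_normK ?num_real//.
(* AM-GM: [t <= k + t^2 / k] *)
have := normr_ge0 (g x); move: `|g x| => t t0.
have -> : t = k * (t / k) by rewrite mulrC divfK// gt_eqF.
have -> : k + k^-1 * (k * (t / k)) ^+ 2 = k * (1 + (t / k) ^+ 2).
  by field; rewrite gt_eqF.
rewrite ler_pM2l//; have : 0 <= t / k by rewrite divr_ge0// ltW.
by move: (t / k) => s s0; nra.
Qed.

(** The scaling that exponent 2 provides in the plane: the integral of |g| over a square of side 4
    rho is o(rho). It is uniform in the centre because the integral of g^2 is small on every set of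
    small measure. *)
Lemma small_square (g : plane -> R) (eta : R) : 0 < eta ->
  mu.-integrable [set: plane] (EFin \o g) ->
  mu.-integrable [set: plane] (fun x => (g x ^+ 2)%:E) ->
  exists2 d : R, 0 < d & forall (x : plane) (rho : R), 0 < rho -> rho < d ->
   (\int[mu]_(y in rect (x.1 - 2 * rho) (x.1 + 2 * rho) (x.2 - 2 * rho) (x.2 + 2 * rho)) `|g y|%:E
    < (rho * eta)%:E)%E.
Proof.
move=> eta0 gi gs; have mg : measurable_fun [set: plane] g.
  by apply/measurable_EFinP; exact: measurable_int gi.
have e0 : 0 < eta ^+ 2 / 64 by rewrite divr_gt0// exprn_gt0.
have [d [d0 dh]] := integral_normr_continuous gs e0.
(* The area is 16 rho^2, which is below [d] as soon as rho < 1 and rho < d / 16. *)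
exists (Num.min 1 (d / 16)); first by rewrite lt_min ltr01 divr_gt0.
move=> x rho rho0; rewrite lt_min => /andP[rho1 rhod].
set Q := rect _ _ _ _; have mQ : measurable (Q : set plane) by exact: measurable_rect.
have muQ : (mu Q = (16 * rho ^+ 2)%:E)%E.
  rewrite /Q /rect plane_measureX// !lebesgue_measure_itv/= !lte_fin !ifT; [|lra..].
  by rewrite -!EFinB -EFinM; congr EFin; ring.
have Qd : (mu Q < d%:E)%E by rewrite muQ lte_fin; nra.
have gsQ : (\int[mu]_(y in Q) (g y ^+ 2)%:E < (eta ^+ 2 / 64)%:E)%E.
  have := dh _ mQ Qd; rewrite /Rintegral -lte_fin fineK//.
    rewrite (eq_integral (fun y => (g y ^+ 2)%:E))// => y _.
    by rewrite ger0_norm// sqr_ge0.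
  have ia : mu.-integrable Q (abse \o (fun x => (g x ^+ 2)%:E)).
    by apply: integrable_abse; exact: integrableS gs.
  exact: (integrable_fin_num _ ia).
(* This choice makes the two terms 16 k rho^2 and eta^2 / (64 k) both equal to rho eta / 2. *)
pose k := eta / (32 * rho).
have k0 : 0 < k by rewrite divr_gt0// mulr_gt0.
apply: (le_lt_trans (integral_abs_le_sqr mQ k0 mg)).
have : ((k^-1)%:E * \int[mu]_(y in Q) (g y ^+ 2)%:E < (k^-1)%:E * (eta ^+ 2 / 64)%:E)%E.
  by rewrite lte_pmul2l// lte_fin invr_gt0.
rewrite muQ -!EFinM => h.
apply: (@lt_le_trans _ _ ((k * (16 * rho ^+ 2))%:E + (k^-1 * (eta ^+ 2 / 64))%:E)%E).
  by rewrite lteD2lE.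
rewrite -EFinD lee_fin /k le_eqVlt; apply/orP; left; apply/eqP; field.
by rewrite !gt_eqF.
Qed.


(** Every side is picked in a window of length [rho], on a line that meets [N] in a null set and on
    which the relevant partial derivative integrates to less than [eta] within the square. The
    columns are chosen first, so that the rows can be required to cross them off [N]. *)
Lemma good_rect (f g1 g2 : plane -> R) (N : set plane) (x : plane) (e : R) :
  mu.-integrable [set: plane] (EFin \o g1) -> mu.-integrable [set: plane] (EFin \o g2) ->
  mu.-integrable [set: plane] (fun x => (g1 x ^+ 2)%:E) ->
  mu.-integrable [set: plane] (fun x => (g2 x ^+ 2)%:E) ->
  mu.-negligible N -> acl1 f g1 N -> acl2 f g2 N ->
  0 < e -> exists l1 r1 l2 r2 c : R,
  [/\ x.1 - e < l1 /\ l1 < x.1, x.1 < r1 /\ r1 < x.1 + e,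
      x.2 - e < l2 /\ l2 < x.2, x.2 < r2 /\ r2 < x.2 + e &
      forall E : set plane, measurable E -> (forall y, E y -> ~ N y -> e < `|f y - c|) ->
        perimeter E =
        (perimeter (E `&` orect l1 r1 l2 r2) + perimeter (E `\` orect l1 r1 l2 r2))%E].
Proof.
move=> g1i g2i g1s g2s N0 acl1N acl2N e0.
pose colint (h : plane -> R) (y : line) : \bar R := (\int[lam]_u (h (y, u))%:E)%E.
pose rowint (h : plane -> R) (u : line) : \bar R := (\int[lam]_y (h (y, u))%:E)%E.
(* Almost every boundary point is joined to the corner [(l1, l2)] by at most two segments along the
   sides, each costing less than [eta]; the total 2 eta = e / 2 leaves a gap below [e]. *)
have [eta etaE] : exists eta, eta = e / 4 by exists (e / 4).
have eta0 : 0 < eta by rewrite etaE divr_gt0.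
have [d1 d10 small1] := small_square eta0 g1i g1s.
have [d2 d20 small2] := small_square eta0 g2i g2s.
have [rho [rho0 rd1 rd2 re]] : exists rho : R, [/\ 0 < rho, rho < d1, rho < d2 & 4 * rho <= e].
  pose m := Num.min (Num.min d1 d2) e; have m0 : 0 < m by rewrite !lt_min d10 d20.
  exists (m / 4); have : m / 4 < m by move: m0; move: m; clear => m; lra.
  rewrite !lt_min => /andP[/andP[-> ->] _]; split => //; first by rewrite divr_gt0.
  by rewrite mulrC divfK// /m ge_min lexx orbT.
pose a1 := x.1 - 2 * rho; pose b1 := x.1 + 2 * rho.
pose a2 := x.2 - 2 * rho; pose b2 := x.2 + 2 * rho.
pose Q := rect a1 b1 a2 b2.
pose h1 y := `|g1 y| * \1_Q y; pose h2 y := `|g2 y| * \1_Q y.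
have mQ : measurable (Q : set plane) by exact: measurable_rect.
have mg1 : measurable_fun [set: plane] g1 by apply/measurable_EFinP; exact: measurable_int g1i.
have mg2 : measurable_fun [set: plane] g2 by apply/measurable_EFinP; exact: measurable_int g2i.
have mh1 : measurable_fun [set: plane] (EFin \o h1).
  by apply/measurable_EFinP; apply: measurable_funM => //; exact: measurableT_comp.
have mh2 : measurable_fun [set: plane] (EFin \o h2).
  by apply/measurable_EFinP; apply: measurable_funM => //; exact: measurableT_comp.
have h10 y : (0 <= (h1 y)%:E)%E by rewrite lee_fin mulr_ge0.
have h20 y : (0 <= (h2 y)%:E)%E by rewrite lee_fin mulr_ge0.
have hQ (g : plane -> R) : (\int[mu]_y (`|g y| * \1_Q y)%:E = \int[mu]_(y in Q) `|g y|%:E)%E.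
  rewrite [RHS]integral_mkcond; apply: eq_integral => y _; rewrite patchE indicE.
  by case: ifP; rewrite ?mulr1 ?mulr0.
have rowE : (\int[lam]_u rowint h1 u < (rho * eta)%:E)%E.
  rewrite -(@fubini_tonelli2 _ _ line line R lam lam _ mh1 h10).
  by have := small1 x rho rho0 rd1; rewrite -hQ.
have colE : (\int[lam]_y colint h2 y < (rho * eta)%:E)%E.
  rewrite -(@fubini_tonelli1 _ _ line line R lam lam _ mh2 h20).
  by have := small2 x rho rho0 rd2; rewrite -hQ.
have mrow : measurable_fun [set: line] (rowint h1).
  exact: (@measurable_fun_fubini_tonelli_G _ _ line line R lam _ mh1 h10).
have mcol : measurable_fun [set: line] (colint h2).
  exact: (@measurable_fun_fubini_tonelli_F _ _ line line R lam _ mh2 h20).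
have row0 u : (0 <= rowint h1 u)%E by apply: integral_ge0 => y _; exact: h10.
have col0 y : (0 <= colint h2 y)%E by apply: integral_ge0 => u _; exact: h20.
have pickcol a : exists y, [/\ a < y < a + rho, lam.-negligible [set u | N (y, u)] &
    (colint h2 y < eta%:E)%E].
  apply: pick_small => //; first by rewrite ltrDl.
    by rewrite addrC addKr.
  exact: negligible_xsection.
have pickrow a (P : line -> Prop) : {ae lam, forall u, P u} ->
    exists u, [/\ a < u < a + rho, lam.-negligible [set y | N (y, u)] /\ P u &
    (rowint h1 u < eta%:E)%E].
  move=> Pae; apply: pick_small => //; first by rewrite ltrDl.
    by rewrite addrC addKr.
  by apply: filterS2 (negligible_ysection N0) Pae => u.
have [l1 [/andP[l1a l1b] Nl1 Gl1]] := pickcol a1.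
have [r1 [/andP[r1a r1b] Nr1 Gr1]] := pickcol (x.1 + rho).
have aeN (y : line) : lam.-negligible [set u | N (y, u)] -> {ae lam, forall u, ~ N (y, u)}.
  by apply: negligibleS => u /= /contrapT.
have aeN' (u : line) : lam.-negligible [set y | N (y, u)] -> {ae lam, forall y, ~ N (y, u)}.
  by apply: negligibleS => y /= /contrapT.
(* The lower row must cross both columns off [N]: its corners are the starting points for the left
   and the right side. *)
have aeNN : {ae lam, forall u, ~ N (l1, u) /\ ~ N (r1, u)}.
  by apply: filterS2 (aeN _ Nl1) (aeN _ Nr1).
have [l2 [/andP[l2a l2b] [Nl2 [Nll Nrl]] Gl2]] := pickrow a2 _ aeNN.
(* The upper side is linked to the base corner through [(l1, r2)]. *)
have [r2 [/andP[r2a r2b] [Nr2 Nlr] Gr2]] := pickrow (x.2 + rho) _ (aeN _ Nl1).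
have geo : [/\ x.1 - e < l1 /\ l1 < x.1, x.1 < r1 /\ r1 < x.1 + e,
      x.2 - e < l2 /\ l2 < x.2 & x.2 < r2 /\ r2 < x.2 + e].
  rewrite /a1 /a2 in l1a l1b l2a l2b.
  move: rho0 re l1a l1b r1a r1b l2a l2b r2a r2b; move: (x.1) (x.2); clear => s t *.
  by split; split; lra.
have [al1 l1b1 ar1 r1b1 l1r1] : [/\ a1 < l1, l1 <= b1, a1 < r1, r1 <= b1 & l1 <= r1].
  rewrite /a1 /b1 in l1a l1b *.
  by move: rho0 l1a l1b r1a r1b; move: (x.1); clear => s *; split; lra.
have [al2 l2b2 ar2 r2b2 l2r2] : [/\ a2 < l2, l2 <= b2, a2 < r2, r2 <= b2 & l2 <= r2].
  rewrite /a2 /b2 in l2a l2b *.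
  by move: rho0 l2a l2b r2a r2b; move: (x.2); clear => s *; split; lra.
exists l1, r1, l2, r2, (f (l1, l2)); have [? ? ? ?] := geo; split => //.
have cole y u u' : a1 < y -> y <= b1 -> a2 <= u -> u' <= b2 ->
    (\int[lam]_(s in `]u, u']) `|g2 (y, s)|%:E <= colint h2 y)%E.
  move=> ay yb au ub; rewrite integral_mkcond /colint; apply: ge0_le_integral => //.
  - by move=> s _; rewrite patchE; case: ifP.
  - apply/(measurable_restrictT _ _).1 => //; apply/measurable_EFinP.
    apply: measurable_funTS; apply: measurableT_comp => //; exact: (measurableT_comp mg2).
  - exact: (measurableT_comp mh2).
  move=> s _; rewrite patchE; case: ifPn => [/set_mem/=|_]; last exact: h20.
  rewrite in_itv/= => /andP[us su']; rewrite lee_fin /h2 indicE mem_set ?mulr1//.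
  by rewrite /Q /rect/= !in_itv/= ay yb (le_lt_trans au us) (le_trans su' ub).
have rowe u y y' : a2 < u -> u <= b2 -> a1 <= y -> y' <= b1 ->
    (\int[lam]_(s in `]y, y']) `|g1 (s, u)|%:E <= rowint h1 u)%E.
  move=> au ub ay yb; rewrite integral_mkcond /rowint; apply: ge0_le_integral => //.
  - by move=> s _; rewrite patchE; case: ifP.
  - apply/(measurable_restrictT _ _).1 => //; apply/measurable_EFinP.
    apply: measurable_funTS; apply: measurableT_comp => //; exact: (measurableT_comp mg1).
  - exact: (measurableT_comp mh1).
  move=> s _; rewrite patchE; case: ifPn => [/set_mem/=|_]; last exact: h10.
  rewrite in_itv/= => /andP[ys sy']; rewrite lee_fin /h1 indicE mem_set ?mulr1//.
  by rewrite /Q /rect/= !in_itv/= au ub (le_lt_trans ay ys) (le_trans sy' yb).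
have Cbnd y u u' : a1 < y -> y <= b1 -> a2 <= u -> u' <= b2 -> (colint h2 y < eta%:E)%E ->
    u <= u' -> ~ N (y, u) -> ~ N (y, u') -> `|f (y, u') - f (y, u)| < eta.
  move=> ay yb au ub Gy uu' Nu Nu'; rewrite -lte_fin.
  by apply: le_lt_trans (acl2N _ _ _ uu' Nu Nu') _; apply: le_lt_trans (cole _ _ _ ay yb au ub) Gy.
have Rbnd u y y' : a2 < u -> u <= b2 -> a1 <= y -> y' <= b1 -> (rowint h1 u < eta%:E)%E ->
    y <= y' -> ~ N (y, u) -> ~ N (y', u) -> `|f (y', u) - f (y, u)| < eta.
  move=> au ub ay yb Gu yy' Ny Ny'; rewrite -lte_fin.
  by apply: le_lt_trans (acl1N _ _ _ yy' Ny Ny') _; apply: le_lt_trans (rowe _ _ _ au ub ay yb) Gu.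
have rl : `|f (r1, l2) - f (l1, l2)| < eta by apply: Rbnd => //; exact: ltW.
have lr : `|f (l1, r2) - f (l1, l2)| < eta by apply: Cbnd => //; exact: ltW.
have add2 (p q t : R) : `|p - q| < eta -> `|q - t| < eta -> `|p - t| <= 2 * eta.
  move=> pq qt; have := ler_distD q p t; move: pq qt.
  by move: `|p - q| `|q - t| `|p - t|; clear => *; lra.
have eta2 t : t < eta -> t <= 2 * eta by move: eta0; clear => *; lra.
move=> E mE Ef.
apply: (@perimeter_split R f g1 g2 N g1i g2i N0 acl1N acl2N l1 r1 l2 r2 (f (l1, l2)) (2 * eta) e) => //.
- by rewrite etaE; move: e0; clear => *; lra.
- apply: filterS (aeN _ Nl1) => u Nu; rewrite /= in_itv/= => /andP[lu ur]; split => //.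
  by apply: eta2; apply: Cbnd; rewrite ?(ltW al2) ?(ltW lu) ?(le_trans (ltW ur)).
- apply: filterS (aeN _ Nr1) => u Nu; rewrite /= in_itv/= => /andP[lu ur]; split => //.
  apply: add2 rl.
  by apply: Cbnd; rewrite ?(ltW al2) ?(ltW lu) ?(le_trans (ltW ur)).
- apply: filterS (aeN' _ Nl2) => y Ny; rewrite /= in_itv/= => /andP[ly yr]; split => //.
  by apply: eta2; apply: Rbnd; rewrite ?(ltW al1) ?(ltW ly) ?(le_trans (ltW yr)).
- apply: filterS (aeN' _ Nr2) => y Ny; rewrite /= in_itv/= => /andP[ly yr]; split => //.
  apply: add2 lr.
  by apply: Rbnd; rewrite ?(ltW al1) ?(ltW ly) ?(le_trans (ltW yr)).
Qed.

End selection.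

(** * Analytic data extracted from the Sobolev hypotheses *)

Section sobolev.
Context {R : realType}.
Local Notation plane := (measurableTypeR R * measurableTypeR R)%type.
Local Notation mu := (@plane_measure R).

Lemma inL1_integrable (f : plane -> \bar R) : inLp 1 f -> mu.-integrable [set: plane] f.
Proof. by move=> [mf]; rewrite Lnorm1 => fi; apply/integrableP. Qed.

Lemma inL2_sqr_integrable (g : plane -> R) : inLp 2 (EFin \o g) ->
  mu.-integrable [set: plane] (fun x => (g x ^+ 2)%:E).
Proof.
move=> [mg gi]; have mg' : measurable_fun [set: plane] g by exact/measurable_EFinP.
apply/integrableP; split; first by apply/measurable_EFinP; exact: measurable_funX.
have E : (\int[mu]_x `|(g x ^+ 2)%:E| = 'N[mu]_2%:E[EFin \o g] `^ 2)%E.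
  rewrite powR_Lnorm//; apply: eq_integral => x _.
  have -> : (`|(EFin \o g) x| = `|g x|%:E)%E by [].
  by rewrite poweR_EFin abse_EFin powR_mulrn// ger0_norm ?sqr_ge0// real_normK ?num_real.
by rewrite E; apply: poweR_lty.
Qed.

Lemma sqr_integrable_rect (g : plane -> R) a b c d : measurable_fun [set: plane] g ->
  mu.-integrable [set: plane] (fun x => (g x ^+ 2)%:E) ->
  mu.-integrable (rect a b c d) (EFin \o g).
Proof.
move=> mg gs; have mr := measurable_rect a b c d.
apply/integrableP; split; first by apply/measurable_EFinP; exact: measurable_funTS.
apply: (le_lt_trans (integral_abs_le_sqr mr ltr01 mg)).
rewrite invr1 !mul1e lte_add_pinfty//; first exact: plane_measure_rect_lty.
have gr : mu.-integrable (rect a b c d) (fun x => (g x ^+ 2)%:E) by exact: integrableS gs.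
by rewrite ltey_eq (integrable_fin_num mr gr).
Qed.

(** The integrable weak gradient inherits square integrability from the W^{1,2} one by uniqueness.
    Points where [f] is infinite are put into [N], so that [fine] loses nothing off [N]. *)
Lemma acl_data (f : plane -> \bar R) : sobolev_W1 1 f -> sobolev_W1 2 f ->
  exists (g1 g2 : plane -> R) (N : set plane),
  [/\ mu.-integrable [set: plane] (EFin \o g1) /\ mu.-integrable [set: plane] (EFin \o g2),
      mu.-integrable [set: plane] (fun x => (g1 x ^+ 2)%:E) /\
      mu.-integrable [set: plane] (fun x => (g2 x ^+ 2)%:E),
      mu.-negligible N,
      acl1 (fine \o f) g1 N /\ acl2 (fine \o f) g2 N &
      forall x, ~ N x -> f x \is a fin_num].
Proof.
move=> [f1 [g1 [g2 [g1i g2i wg1 wg2]]]] [_ [h1 [h2 [h1i h2i wh1 wh2]]]].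
have fi := inL1_integrable f1; have mf := measurable_int _ fi.
have {}g1i := inL1_integrable g1i; have {}g2i := inL1_integrable g2i.
have mh1 : measurable_fun [set: plane] h1 by apply/measurable_EFinP; case: h1i.
have mh2 : measurable_fun [set: plane] h2 by apply/measurable_EFinP; case: h2i.
have {}h1i := inL2_sqr_integrable h1i; have {}h2i := inL2_sqr_integrable h2i.
have mg1 : measurable_fun [set: plane] g1 by apply/measurable_EFinP; exact: measurable_int g1i.
have mg2 : measurable_fun [set: plane] g2 by apply/measurable_EFinP; exact: measurable_int g2i.
have ffin : {ae mu, forall x, f x \is a fin_num}.
  by apply: filterS (integrable_ae measurableT fi) => x; apply.
have mr a b c d := @measurable_rect R a b c d.
have E1 : {ae mu, forall x, g1 x = h1 x}.
  apply: (weak_derivative_unique _ _ wg1 wh1) => a b c d.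
    by apply: integrableS g1i.
  exact: sqr_integrable_rect.
have E2 : {ae mu, forall x, g2 x = h2 x}.
  apply: (weak_derivative_unique _ _ wg2 wh2) => a b c d.
    by apply: integrableS g2i.
  exact: sqr_integrable_rect.
have sqr (g h : plane -> R) : measurable_fun [set: plane] g -> measurable_fun [set: plane] h -> {ae mu, forall x, g x = h x} ->
    mu.-integrable [set: plane] (fun x => (h x ^+ 2)%:E) ->
    mu.-integrable [set: plane] (fun x => (g x ^+ 2)%:E).
  move=> mg mh gh /integrableP[_ hi]; apply/integrableP; split.
    by apply/measurable_EFinP; exact: measurable_funX.
  apply: le_lt_trans hi; rewrite le_eqVlt; apply/orP; left; apply/eqP; apply: ae_eq_integral => //.
  - by apply/measurable_EFinP; apply: measurableT_comp => //; exact: measurable_funX.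
  - by apply/measurable_EFinP; apply: measurableT_comp => //; exact: measurable_funX.
  - by apply: filterS gh => x ->.
have mfr : measurable_fun [set: plane] (fine \o f) by exact: measurableT_comp.
have fri : mu.-integrable [set: plane] (EFin \o (fine \o f)).
  apply: le_integrable fi => //; first exact/measurable_EFinP.
  by move=> x _ /=; case: (f x) => [r||] //=; rewrite leey.
have wk v (g : plane -> R) : v = e1 \/ v = e2 -> weak_derivative v f g -> weak_derivative v (EFin \o (fine \o f)) g.
  move=> ve wg phi tphi; rewrite -(wg _ tphi).
  have mD : measurable_fun [set: plane] (fun x => ('D_v phi x)%:E).
    apply/measurable_EFinP; apply: continuous_measurable_plane.
    exact: test_function_derive_continuous.
  apply: ae_eq_integral => //.
  - by apply: emeasurable_funM => //; exact/measurable_EFinP.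
  - by apply: emeasurable_funM.
  - by apply: filterS ffin => x fx _ /=; rewrite fineK.
have [N1 N10 A1] := weak_derivative_acl1 fri g1i (wk _ _ (or_introl erefl) wg1).
have [N2 N20 A2] := weak_derivative_acl2 fri g2i (wk _ _ (or_intror erefl) wg2).
have ffin' : mu.-negligible (~` [set x | f x \is a fin_num]) by exact: ffin.
exists g1, g2, (N1 `|` N2 `|` ~` [set x | f x \is a fin_num]); split.
- by [].
- by split; [exact: sqr mg1 mh1 E1 h1i|exact: sqr mg2 mh2 E2 h2i].
- by apply: negligibleU => //; exact: negligibleU.
- by split=> u y y' yy' Ny Ny'; [apply: A1|apply: A2] => //; [contra: Ny|contra: Ny'|contra: Ny|contra: Ny'];
    move=> ?; left; [left|left|right|right].
- by move=> x Nx; apply: contrapT => fx; apply: Nx; right.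
Qed.

End sobolev.

(** * The dichotomy given by indecomposability *)

Section dichotomy.
Context {R : realType}.
Local Notation line := (measurableTypeR R).
Local Notation plane := (measurableTypeR R * measurableTypeR R)%type.
Local Notation mu := (@plane_measure R).
Local Notation lam := (@lebesgue_measure R).

Lemma indecomposable_split (E K : set plane) : measurable K -> indecomposable E ->
  perimeter E = (perimeter (E `&` K) + perimeter (E `\` K))%E ->
  mu (E `&` K) = 0%E \/ mu (E `\` K) = 0%E.
Proof.
move=> mK [mE _ noAB] pE.
have [EK0|EK0] := eqVneq (mu (E `&` K)) 0%E; first by left.
have [EK0'|EK0'] := eqVneq (mu (E `\` K)) 0%E; first by right.
exfalso; apply: noAB; exists (E `&` K), (E `\` K); split => //.
- by split; [exact: measurableI|exact: measurableD].
- by rewrite setUIDK.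
- by rewrite -subset0 => x [[_ ?] [_]].
- by split; rewrite lt0e ?EK0 ?EK0' measure_ge0.
Qed.

(** One set that charges [K] decides for all: smaller ones are null off [K] with it, and larger ones
    charge [K] too. This makes the alternative uniform over a sequence of levels. *)
Lemma nested_dichotomy (F : nat -> set plane) (K : set plane) : measurable K ->
  (forall n, measurable (F n)) -> (forall n m, F n `<=` F m \/ F m `<=` F n) ->
  (forall n, mu (F n `&` K) = 0%E \/ mu (F n `\` K) = 0%E) ->
  (forall n, mu (F n `&` K) = 0%E) \/ (forall n, mu (F n `\` K) = 0%E).
Proof.
move=> mK mF nF FK.
have [h|/existsNP[n0 n0K]] := pselect (forall n, mu (F n `&` K) = 0%E); first by left.
have n0D : mu (F n0 `\` K) = 0%E by case: (FK n0).
have mI n : measurable (F n `&` K) by exact: measurableI.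
have mD n : measurable (F n `\` K) by exact: measurableD.
right=> n; have [Fn|//] := FK n; have [nn0|n0n] := nF n n0.
  apply/eqP; rewrite eq_le measure_ge0 andbT -n0D; apply: le_measure; rewrite ?inE//.
  exact: setSD.
exfalso; apply: n0K; apply/eqP; rewrite eq_le measure_ge0 andbT -Fn.
by apply: le_measure; rewrite ?inE//; exact: setSI.
Qed.

Lemma ae_dense (P : line -> Prop) (a b : R) : a < b -> {ae lam, forall t, P t} ->
  exists2 t, a < t < b & P t.
Proof.
move=> ab Pae; have [//|//||t [abt Pt _]] := @pick_small R (cst 0%E) P a b 1 ab ltr01 _ _ _ Pae.
  by rewrite integral0 lte_fin mulr_gt0// subr_gt0.
by exists t.
Qed.

Lemma ae_null_bigcup (F : nat -> set plane) (S : set plane) (P : plane -> Prop) :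
  (forall n, measurable (F n `&` S)) -> (forall n, mu (F n `&` S) = 0%E) ->
  (forall y, ~ P y -> exists n, F n y) ->
  {ae mu, forall y, S y -> P y}.
Proof.
move=> mF F0 PF.
have : mu.-negligible (\bigcup_n (F n `&` S)).
  apply: negligible_bigcup => n; exists (F n `&` S); split => //.
apply: negligibleS => y /= /not_implyP[Sy /PF[n Fny]]; by exists n.
Qed.

Lemma invn_lt (d : R) : 0 < d -> exists n : nat, n.+1%:R^-1 < d.
Proof.
move=> d0; exists (Num.truncn d^-1); rewrite -[ltRHS]invrK ltf_pV2 ?posrE ?invr_gt0//.
exact: truncnS_gt.
Qed.

Variables (f : plane -> \bar R) (g1 g2 : plane -> R) (N : set plane).
Hypotheses (f_monotone : monotone_function f).
Hypotheses (gi : mu.-integrable [set: plane] (EFin \o g1) /\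
                 mu.-integrable [set: plane] (EFin \o g2)).
Hypotheses (gs : mu.-integrable [set: plane] (fun x => (g1 x ^+ 2)%:E) /\
                 mu.-integrable [set: plane] (fun x => (g2 x ^+ 2)%:E)).
Hypotheses (N0 : mu.-negligible N).
Hypotheses (aclN : acl1 (fine \o f) g1 N /\ acl2 (fine \o f) g2 N).
Hypotheses (fN : forall x, ~ N x -> f x \is a fin_num).

Lemma dichotomy (x : plane) (e : R) : 0 < e -> exists l1 r1 l2 r2 c : R,
  let K : set plane := orect l1 r1 l2 r2 in
  [/\ x.1 - e < l1 /\ l1 < x.1, x.1 < r1 /\ r1 < x.1 + e,
      x.2 - e < l2 /\ l2 < x.2, x.2 < r2 /\ r2 < x.2 + e &
      ({ae mu, forall y, K y -> (f y <= (c + e)%:E)%E} \/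
       {ae mu, forall y, (~` K) y -> (f y <= (c + e)%:E)%E}) /\
      ({ae mu, forall y, K y -> ((c - e)%:E <= f y)%E} \/
       {ae mu, forall y, (~` K) y -> ((c - e)%:E <= f y)%E})].
Proof.
move=> e0; have [l1 [r1 [l2 [r2 [c [H1 H2 H3 H4 split_per]]]]]] :=
  good_rect x gi.1 gi.2 gs.1 gs.2 N0 aclN.1 aclN.2 e0.
exists l1, r1, l2, r2, c; move=> K; split => //.
have mK : measurable K by exact: measurableX.
have inv0 n : 0 < n.+1%:R^-1 :> R by [].
split.
(* Only almost every level is known to be good, so [c + e] is approached from above by good levels,
   and {f > c + e} is the union of their superlevel sets. *)
- have /choice[t tP] : forall n : nat, exists t : R, c + e < t < c + e + n.+1%:R^-1 /\
      indecomposable [set y | (t%:E < f y)%E].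
    move=> n; have [|t tb [? _]] := ae_dense _ f_monotone (a := c + e) (b := c + e + n.+1%:R^-1).
      by rewrite ltrDl.
    by exists t.
  pose F n : set plane := [set y | ((t n)%:E < f y)%E].
  have mF n : measurable (F n) by have [_ []] := tP n.
  have FP y : ~ (f y <= (c + e)%:E)%E -> exists n, F n y.
    move=> /negP; rewrite -ltNge; case fy : (f y) => [r||] //; last first.
      by move=> _; exists 0%N; rewrite /F/= fy ltry.
    rewrite lte_fin => cer; have [n nr] := @invn_lt (r - (c + e)) ltac:(by rewrite subr_gt0).
    exists n; rewrite /F/= fy lte_fin; have [/andP[_ tn] _] := tP n.
    by apply: (lt_trans tn); rewrite -ltrBrDl.
  have [||h|h] := @nested_dichotomy F K mK mF.
  - move=> n m; have [nm|/ltW nm] := leP (t n) (t m); [right|left] => y /=;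
      by apply: le_lt_trans; rewrite lee_fin.
  - move=> n; have [tb indF] := tP n; apply: indecomposable_split => //.
    apply: split_per => // y Fy Ny; have fy := fN Ny.
    move: Fy; rewrite /F/= -{1}(fineK fy) lte_fin => Fy; apply: lt_le_trans (ler_norm _).
    by rewrite ltrBrDl (lt_trans _ Fy)//; case/andP: tb.
  - left; apply: (ae_null_bigcup _ h FP) => n; exact: measurableI.
  - right; apply: (ae_null_bigcup _ h FP) => n; exact: measurableD.
- have /choice[t tP] : forall n : nat, exists t : R, c - e - n.+1%:R^-1 < t < c - e /\
      indecomposable [set y | (f y < t%:E)%E].
    move=> n; have [|t tb [_ ?]] := ae_dense _ f_monotone (a := c - e - n.+1%:R^-1) (b := c - e).
      by rewrite ltrBlDr ltrDl.
    by exists t.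
  pose F n : set plane := [set y | (f y < (t n)%:E)%E].
  have mF n : measurable (F n) by have [_ []] := tP n.
  have FP y : ~ ((c - e)%:E <= f y)%E -> exists n, F n y.
    move=> /negP; rewrite -ltNge; case fy : (f y) => [r||] //; last first.
      by move=> _; exists 0%N; rewrite /F/= fy ltNyr.
    rewrite lte_fin => cer; have [n nr] := @invn_lt (c - e - r) ltac:(by rewrite subr_gt0).
    exists n; rewrite /F/= fy lte_fin; have [/andP[tn _] _] := tP n.
    by apply: lt_trans tn; rewrite ltrBrDr -ltrBrDl.
  have [||h|h] := @nested_dichotomy F K mK mF.
  - move=> n m; have [nm|/ltW nm] := leP (t n) (t m); [left|right] => y /= h;
      by apply: (lt_le_trans h); rewrite lee_fin.
  - move=> n; have [tb indF] := tP n; apply: indecomposable_split => //.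
    apply: split_per => // y Fy Ny; have fy := fN Ny.
    move: Fy; rewrite /F/= -{1}(fineK fy) lte_fin => Fy; rewrite distrC.
    apply: lt_le_trans (ler_norm _).
    by rewrite ltrBrDr -ltrBrDl (lt_trans Fy)//; case/andP: tb.
  - left; apply: (ae_null_bigcup _ h FP) => n; exact: measurableI.
  - right; apply: (ae_null_bigcup _ h FP) => n; exact: measurableD.
Qed.

End dichotomy.

(** * Essential limits and the precise representative *)

Section ess_limit.
Context {R : realType}.
Local Notation line := (measurableTypeR R).
Local Notation plane := (measurableTypeR R * measurableTypeR R)%type.
Local Notation mu := (@plane_measure R).
Local Notation lam := (@lebesgue_measure R).

Definition sq (x : R * R) (r : R) : set plane :=
  orect (x.1 - r) (x.1 + r) (x.2 - r) (x.2 + r).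

Lemma measurable_sq x r : measurable (sq x r).
Proof. exact: measurableX. Qed.

Lemma plane_measure_sq x r : 0 < r -> mu (sq x r) = (4 * r ^+ 2)%:E.
Proof.
move=> r0; rewrite /sq /orect plane_measureX// !lebesgue_measure_itv/= !lte_fin !ifT; [|lra..].
by rewrite -!EFinB -EFinM; congr EFin; ring.
Qed.

Lemma sqP x r y : sq x r y <-> `|y.1 - x.1| < r /\ `|y.2 - x.2| < r.
Proof.
rewrite /sq /orect/= !in_itv/= !ltr_norml; split => -[/andP[? ?] /andP[? ?]];
  by split; apply/andP; split; lra.
Qed.

Lemma sq_nbhs x r : 0 < r -> nbhs x (sq x r).
Proof.
move=> r0; apply/nbhs_ballP; exists r => // y [y1 y2]; apply/sqP.
by split; rewrite distrC.
Qed.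

Lemma sub_sq x r s : r <= s -> sq x r `<=` sq x s.
Proof. by move=> rs y /sqP[? ?]; apply/sqP; split; exact: lt_le_trans rs. Qed.

Lemma sq_sq x r y : sq x r y -> exists2 s, 0 < s & sq y s `<=` sq x r.
Proof.
move=> /sqP[y1 y2]; exists (Num.min (r - `|y.1 - x.1|) (r - `|y.2 - x.2|)).
  by rewrite lt_min !subr_gt0 y1.
move=> z /sqP; rewrite !lt_min => -[/andP[z1 _] /andP[_ z2]]; apply/sqP.
have := ler_distD y.1 z.1 x.1; have := ler_distD y.2 z.2 x.2.
by split; lra.
Qed.

Lemma ae_point (A : set plane) (P : plane -> Prop) : measurable A -> (0 < mu A)%E ->
  {ae mu, forall y, A y -> P y} -> exists2 y, A y & P y.
Proof.
move=> mA A0 [B [mB B0 PB]]; apply: contrapT => noy.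
suff : (mu A <= mu B)%E by rewrite B0 leNgt A0.
apply: le_measure; rewrite ?inE// => y Ay; apply: PB => /= h.
by apply: noy; exists y => //; exact: h.
Qed.

Variable f : plane -> \bar R.

Definition essle x (M : R) :=
  exists2 r, 0 < r & {ae mu, forall y, sq x r y -> (f y <= M%:E)%E}.

Definition essge x (M : R) :=
  exists2 r, 0 < r & {ae mu, forall y, sq x r y -> (M%:E <= f y)%E}.

(** Squares have positive measure, so both bounds hold at some common point. *)
Lemma essge_essle x M M' : essge x M -> essle x M' -> M <= M'.
Proof.
move=> [r r0 hr] [s s0 hs]; pose t := Num.min r s.
have t0 : 0 < t by rewrite lt_min r0.
have [y Ay [h1 h2]] : exists2 y, sq x t y & (M%:E <= f y)%E /\ (f y <= M'%:E)%E.
  apply: ae_point; first exact: measurable_sq.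
    by rewrite plane_measure_sq// lte_fin mulr_gt0// exprn_gt0.
  apply: filterS2 hr hs => y hr hs ty; split.
    by apply: hr; apply: sub_sq ty; rewrite ge_min lexx.
  by apply: hs; apply: sub_sq ty; rewrite ge_min lexx orbT.
by rewrite -lee_fin; exact: le_trans h1 h2.
Qed.

Lemma ae_neq_point (x : plane) : {ae mu, forall y, y != x}.
Proof.
exists [set x]; split; last by move=> y /= /negP; rewrite negbK => /eqP.
  have -> : [set x] = [set x.1] `*` [set x.2].
    by apply/seteqP; split => [y ->//|[y1 y2] [/= -> ->]]; case: x.
  exact: measurableX.
have -> : [set x] = [set x.1] `*` [set x.2].
  by apply/seteqP; split => [y ->//|[y1 y2] [/= -> ->]]; case: x.
by rewrite plane_measureX// lebesgue_measure_set1 mul0e.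
Qed.

Hypothesis dich : forall (x : plane) (e : R), 0 < e -> exists l1 r1 l2 r2 c : R,
  let K : set plane := orect l1 r1 l2 r2 in
  [/\ x.1 - e < l1 /\ l1 < x.1, x.1 < r1 /\ r1 < x.1 + e,
      x.2 - e < l2 /\ l2 < x.2, x.2 < r2 /\ r2 < x.2 + e &
      ({ae mu, forall y, K y -> (f y <= (c + e)%:E)%E} \/
       {ae mu, forall y, (~` K) y -> (f y <= (c + e)%:E)%E}) /\
      ({ae mu, forall y, K y -> ((c - e)%:E <= f y)%E} \/
       {ae mu, forall y, (~` K) y -> ((c - e)%:E <= f y)%E})].

Lemma dich_sq (x : plane) (e : R) : 0 < e -> exists (K : set plane) (c : R),
  [/\ exists2 r, 0 < r & sq x r `<=` K, K `<=` sq x e,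
      {ae mu, forall y, K y -> (f y <= (c + e)%:E)%E} \/
       {ae mu, forall y, (~` K) y -> (f y <= (c + e)%:E)%E} &
      {ae mu, forall y, K y -> ((c - e)%:E <= f y)%E} \/
       {ae mu, forall y, (~` K) y -> ((c - e)%:E <= f y)%E}].
Proof.
move=> /(dich x)[l1 [r1 [l2 [r2 [c [[? ?] [? ?] [? ?] [? ?] [? ?]]]]]]].
exists (orect l1 r1 l2 r2), c; split => //.
  exists (Num.min (Num.min (x.1 - l1) (r1 - x.1)) (Num.min (x.2 - l2) (r2 - x.2))).
    by rewrite !lt_min !subr_gt0; apply/andP; split; apply/andP; split.
  move=> y /sqP; rewrite !lt_min !ltr_norml.
  move=> [/andP[/andP[/andP[? ?] /andP[? ?]] _] /andP[_ /andP[/andP[? ?] /andP[? ?]]]].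
  by rewrite /orect/= !in_itv/=; split; apply/andP; split; lra.
move=> y; rewrite /orect/= !in_itv/= => -[/andP[? ?] /andP[? ?]]; apply/sqP.
by rewrite !ltr_norml; split; apply/andP; split; lra.
Qed.

(** Every point other than [x] lies outside some [K n], and [x] itself is null. This covers the
    branch of the dichotomy in which the bound holds off the rectangle. *)
Lemma ess_bound_frequently (P : plane -> Prop) (x : plane) (K : nat -> set plane) (e : nat -> R) :
  (forall n, K n `<=` sq x (e n)) -> (forall d, 0 < d -> exists n, e n < d) ->
  (forall n, {ae mu, forall y, (~` K n) y -> P y}) -> {ae mu, forall y, P y}.
Proof.
move=> Ke e0 KP; have := KP => /ae_foralln h.
apply: filterS2 h (ae_neq_point x) => y hy yx.
have d0 : 0 < `|y - x| by rewrite normr_gt0 subr_eq0.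
have [n en] := e0 _ d0; have Kny : ~ K n y; last by have := hy n; apply.
move=> /Ke /sqP[y1 y2].
move: en; rewrite prod_normE/= ltNge => /negP; apply.
by rewrite ge_max !ltW.
Qed.

(** The limit is the upper limit of the constants [c n], written as the supremum of the levels
    exceeded infinitely often. Below it, M <= c n - e n for infinitely many n; above it, c n + e n
    <= M for all large n. *)
Lemma ess_limit_exists (x : plane) : exists L : \bar R,
  (forall M : R, (M%:E < L)%E -> essge x M) /\ (forall M : R, (L < M%:E)%E -> essle x M).
Proof.
pose e n : R := n.+1%:R^-1; have e0 n : 0 < e n by rewrite /e invr_gt0.
have elt d : 0 < d -> exists n, forall m, (n <= m)%N -> e m < d.
  move=> /invn_lt[n nd]; exists n => m nm; apply: le_lt_trans nd.
  by rewrite lef_pV2 ?posrE// ler_nat.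
have /choice[K /choice[c Kc]] := fun n => dich_sq x (e0 n).
pose S := [set t : R | forall n, exists2 m, (n <= m)%N & t < c m].
exists (ereal_sup (EFin @` S)); split => M.
- move=> /ereal_sup_gt[_ [t tS <-]]; rewrite lte_fin => Mt.
  have [n0 n0P] := elt (t - M) ltac:(by rewrite subr_gt0).
  have /choice[m mP] : forall n, exists m, [/\ (n <= m)%N, (n0 <= m)%N & t < c m].
    move=> n; have [m nm tm] := tS (maxn n n0).
    by exists m; rewrite (leq_trans (leq_maxl n n0)) ?(leq_trans (leq_maxr n n0)).
  have bnd n : (M%:E <= (c (m n) - e (m n))%:E)%E.
    have [_ n0m tc] := mP n; rewrite lee_fin; have := n0P _ n0m.
    by move: (c _) (e _) tc => u v; move: Mt; clear => *; lra.
  (* Either some rectangle carries the bound inside, hence near [x], or every one of them carries it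
     outside, hence almost everywhere. *)
  have [[n]|/forallNP noleft] := pselect (exists n,
      {ae mu, forall y, K (m n) y -> ((c (m n) - e (m n))%:E <= f y)%E}).
    have [[r r0 rK] _ _ _] := Kc (m n) => h; exists r => //.
    by apply: filterS h => y h /rK /h; exact: le_trans (bnd n).
  exists 1 => //; suff : {ae mu, forall y, (M%:E <= f y)%E} by apply: filterS => y.
  apply: (@ess_bound_frequently _ x (fun n => K (m n)) (fun n => e (m n))).
  + by move=> n; case: (Kc (m n)).
  + by move=> d /elt[n nP]; exists n; apply: nP; case: (mP n).
  + move=> n; have [_ _ _ [/noleft//|]] := Kc (m n).
    by apply: filterS => y h /h; exact: le_trans (bnd n).
- move=> LM; have [t Lt tM] : exists2 t : R, (ereal_sup (EFin @` S) < t%:E)%E & t < M.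
    case: (ereal_sup _) LM => [r||] //; rewrite ?lte_fin => rM.
      by exists ((r + M) / 2); rewrite ?lte_fin; lra.
    by exists (M - 1); rewrite ?ltNyr//; lra.
  have tS : ~ S t.
    by move=> tS; move: Lt; rewrite ltNge => /negP; apply; apply: ereal_sup_ubound; exists t.
  have [n1 n1P] : exists n, forall m, (n <= m)%N -> c m <= t.
    move/existsNP: tS => [n nP]; exists n => m nm; rewrite leNgt; apply/negP => tm.
    by apply: nP; exists m.
  have [n0 n0P] := elt (M - t) ltac:(by rewrite subr_gt0).
  pose m n := (n + (n0 + n1))%N.
  have bnd n : ((c (m n) + e (m n))%:E <= M%:E)%E.
    have l1 : (n1 <= m n)%N by rewrite /m addnA leq_addl.
    have l0 : (n0 <= m n)%N by rewrite /m addnCA leq_addr.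
    rewrite lee_fin; move: (n1P _ l1) (n0P _ l0).
    by move: (c _) (e _) => u v; clear => *; lra.
  have [[n]|/forallNP noleft] := pselect (exists n,
      {ae mu, forall y, K (m n) y -> (f y <= (c (m n) + e (m n))%:E)%E}).
    have [[r r0 rK] _ _ _] := Kc (m n) => h; exists r => //.
    by apply: filterS h => y h /rK /h fy; exact: le_trans fy (bnd n).
  exists 1 => //; suff : {ae mu, forall y, (f y <= M%:E)%E} by apply: filterS => y.
  apply: (@ess_bound_frequently _ x (fun n => K (m n)) (fun n => e (m n))).
  + by move=> n; case: (Kc (m n)).
  + by move=> d /elt[n nP]; exists n; apply: nP; rewrite /m leq_addr.
  + move=> n; have [_ _ up _] := Kc (m n); case: up => [/noleft//|].
    by apply: filterS => y h /h fy; exact: le_trans fy (bnd n).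
Qed.

End ess_limit.

(** A single criterion for finite and infinite limits: only real levels strictly on either side of
    [L] are tested, the form in which essential bounds are available. *)
Lemma cvge_squeeze_real (R : realType) (T : Type) (F : set_system T) (FF : ProperFilter F)
    (h : T -> \bar R) (L : \bar R) :
  (forall M : R, (M%:E < L)%E -> \forall t \near F, (M%:E <= h t)%E) ->
  (forall M : R, (L < M%:E)%E -> \forall t \near F, (h t <= M%:E)%E) ->
  h @ F --> L.
Proof.
case: L => [l||] lo hi.
- apply/fine_cvgP; split.
    have h1 := lo (l - 1) ltac:(by rewrite lte_fin gtrBl).
    have h2 := hi (l + 1) ltac:(by rewrite lte_fin ltrDl).
    near=> t; rewrite fin_real//; apply/andP; split.
      by apply: (@lt_le_trans _ _ (l - 1)%:E); [exact: ltNyr|near: t].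
    by apply: (@le_lt_trans _ _ (l + 1)%:E); [near: t|exact: ltry].
  apply/cvgrPdist_le => e e0.
  have h1 := lo (l - e) ltac:(by rewrite lte_fin gtrBl).
  have h2 := hi (l + e) ltac:(by rewrite lte_fin ltrDl).
  near=> t.
  have : ((l - e)%:E <= h t)%E by near: t.
  have : (h t <= (l + e)%:E)%E by near: t.
  by rewrite [(fine \o h) t]/=; case: (h t) => [r||] //=; rewrite !lee_fin ler_distlC => -> ->.
- by apply/cvgeyPge => A; apply: lo; exact: ltry.
- by apply/cvgeNyPle => A; apply: hi; exact: ltNyr.
Unshelve. all: by end_near. Qed.

(** * Averages over discs *)

Section averages.
Context {R : realType}.
Local Notation plane := (measurableTypeR R * measurableTypeR R)%type.
Local Notation mu := (@plane_measure R).

Lemma measurable_disc (x : R * R) (r : R) : measurable (disc x r : set plane).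
Proof.
pose g (y : plane) : R := (y.1 - x.1) ^+ 2 + (y.2 - x.2) ^+ 2.
have mg : measurable_fun [set: plane] g.
  by apply: measurable_funD; apply: measurable_funX; exact: measurable_funB.
rewrite (_ : disc x r = g @^-1` `]-oo, r ^+ 2[); last first.
  by apply/seteqP; split => y; rewrite /disc/= in_itv.
rewrite -[X in measurable X]setTI; apply: mg => //; exact: measurable_itv.
Qed.

Lemma disc_sub_sq (x : R * R) (r : R) : 0 < r -> disc x r `<=` sq x r.
Proof.
move=> r0 y; rewrite /disc/= => yr; apply/sqP.
have y1 := sqr_ge0 (y.1 - x.1); have y2 := sqr_ge0 (y.2 - x.2).
by split; rewrite -(@ltr_pXn2r _ 2) ?nnegrE ?normr_ge0 ?(ltW r0)// real_normK ?num_real//; lra.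
Qed.

Lemma sq_sub_disc (x : R * R) (r : R) : 0 < r -> sq x (r / 2) `<=` disc x r.
Proof.
move=> r0 y /sqP[y1 y2]; rewrite /disc/= -[X in X + _ < _]real_normK ?num_real//.
rewrite -[X in _ + X < _]real_normK ?num_real//.
move: y1 y2 (normr_ge0 (y.1 - x.1)) (normr_ge0 (y.2 - x.2)).
by move: `|y.1 - x.1| `|y.2 - x.2| => s t *; nra.
Qed.

(** Comparison with an inner and an outer square. *)
Lemma plane_measure_disc (x : R * R) (r : R) : 0 < r ->
  exists2 m : R, 0 < m & mu (disc x r) = m%:E.
Proof.
move=> r0; have r20 : 0 < r / 2 by rewrite divr_gt0.
have lo : (mu (sq x (r / 2)) <= mu (disc x r))%E.
  by apply: le_measure; rewrite ?inE; [exact: measurable_sq|exact: measurable_disc|exact: sq_sub_disc].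
have hi : (mu (disc x r) <= mu (sq x r))%E.
  by apply: le_measure; rewrite ?inE; [exact: measurable_disc|exact: measurable_sq|exact: disc_sub_sq].
move: lo hi; rewrite !plane_measure_sq//; case: (mu _) => [m||] //; rewrite !lee_fin => lo _.
by exists m => //; apply: lt_le_trans lo; rewrite mulr_gt0// exprn_gt0.
Qed.

Lemma ae_le_integral d (T : measurableType d) (m : {measure set T -> \bar R}) (D : set T)
    (h1 h2 : T -> \bar R) : measurable D -> m.-integrable D h1 -> m.-integrable D h2 ->
  {ae m, forall y, D y -> (h1 y <= h2 y)%E} ->
  (\int[m]_(y in D) h1 y <= \int[m]_(y in D) h2 y)%E.
Proof.
move=> mD i1 i2 [B [mB B0 hB]].
rewrite (negligible_integral mB mD i1 B0) (negligible_integral mB mD i2 B0).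
have mDB : measurable (D `\` B) by exact: measurableD.
apply: le_integral => //.
- by apply: integrableS i1 => // y [].
- by apply: integrableS i2 => // y [].
- move=> y /set_mem[Dy By]; apply: contrapT => h; apply: By; apply: hB => /=.
  by move=> h'; exact/h/h'.
Qed.

Lemma avg_cst (x : R * R) (r M : R) : 0 < r -> avg (cst M%:E) (disc x r) = M%:E.
Proof.
move=> r0; have mD := measurable_disc x r; have [m m0 mE] := plane_measure_disc x r0.
rewrite /avg (integral_cst mu mD) mE inver gt_eqF// -!EFinM; congr EFin.
by rewrite mulrCA mulVf ?mulr1// gt_eqF.
Qed.

Lemma le_avg (h1 h2 : R * R -> \bar R) (x : R * R) (r : R) : 0 < r ->
  mu.-integrable (disc x r) h1 -> mu.-integrable (disc x r) h2 ->
  {ae mu, forall y, disc x r y -> (h1 y <= h2 y)%E} ->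
  (avg h1 (disc x r) <= avg h2 (disc x r))%E.
Proof.
move=> r0 i1 i2 h12; have mD := measurable_disc x r; have [m m0 mE] := plane_measure_disc x r0.
rewrite /avg mE inver gt_eqF// lee_wpmul2l ?lee_fin ?invr_ge0 ?(ltW m0)//.
exact: ae_le_integral.
Qed.

Lemma integrable_disc_cst (x : R * R) (r M : R) : 0 < r ->
  mu.-integrable (disc x r) (cst M%:E).
Proof.
move=> r0; have mD := measurable_disc x r; have [m m0 mE] := plane_measure_disc x r0.
apply/integrableP; split => //.
by rewrite /= (integral_cst mu mD) mE -EFinM ltry.
Qed.

Lemma near0_disc (x : R * R) (s : R) : 0 < s ->
  \forall r \near 0^'+, 0 < r /\ disc x r `<=` sq x s.
Proof.
move=> s0; near=> r; have r0 : 0 < r by near: r; exact: nbhs_right_gt.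
split=> //; apply: (subset_trans (disc_sub_sq r0)); apply: sub_sq.
by near: r; exact: nbhs_right_le.
Unshelve. all: by end_near. Qed.

Lemma avg_cvg (f : R * R -> \bar R) (x : R * R) (L : \bar R) :
  mu.-integrable [set: plane] f ->
  (forall M : R, (M%:E < L)%E -> essge f x M) -> (forall M : R, (L < M%:E)%E -> essle f x M) ->
  avg f (disc x r) @[r --> 0^'+] --> L.
Proof.
move=> fi lo hi; have fD r : mu.-integrable (disc x r) f.
  by apply: integrableS fi => //; exact: measurable_disc.
apply: cvge_squeeze_real => M; [move=> /lo|move=> /hi] => -[s s0 sM].
  apply: filterS (near0_disc x s0) => r [r0 rs]; rewrite -(avg_cst x M r0).
  apply: le_avg => //; first exact: integrable_disc_cst.
  by apply: filterS sM => y sM /rs.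
apply: filterS (near0_disc x s0) => r [r0 rs]; rewrite -(avg_cst x M r0).
apply: le_avg => //; first exact: integrable_disc_cst.
by apply: filterS sM => y sM /rs.
Qed.

End averages.

Lemma lte_between_real (R : realType) (a b : \bar R) : (a < b)%E ->
  exists2 t : R, (a < t%:E)%E & (t%:E < b)%E.
Proof.
case: a b => [a||] [b||] //; rewrite ?lte_fin => ab.
- by exists ((a + b) / 2); rewrite lte_fin; [exact: (midf_lt ab).1|exact: (midf_lt ab).2].
- by exists (a + 1); [rewrite lte_fin ltrDl|exact: ltry].
- by exists (b - 1); [exact: ltNyr|rewrite lte_fin gtrBl].
- by exists 0; [exact: ltNyr|exact: ltry].
Qed.

(** * Continuity and Lebesgue points *)

Section main.
Context {R : realType}.
Local Notation plane := (measurableTypeR R * measurableTypeR R)%type.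
Local Notation mu := (@plane_measure R).
Variable f : R * R -> \bar R.
Hypothesis fi : mu.-integrable [set: plane] f.
Hypothesis f_ge : forall (x : R * R) (M : R), (M%:E < f x)%E -> essge f x M.
Hypothesis f_le : forall (x : R * R) (M : R), (f x < M%:E)%E -> essle f x M.

(** An essential bound near [x] is also one near each [y] close to [x]. If [f y] were below [M], a
    real level strictly between them would bound [f] essentially from above near [y], against
    [essge_essle]. Essential bounds thus become pointwise. *)
Lemma essge_near x M : essge f x M -> \forall y \near x, (M%:E <= f y)%E.
Proof.
move=> [r r0 rM]; apply: filterS (sq_nbhs x r0) => y xy.
have [s s0 sr] := sq_sq xy.
have yM : essge f y M by exists s => //; apply: filterS rM => z rM /sr.
rewrite leNgt; apply/negP => /lte_between_real[t ft]; rewrite lte_fin ltNge => /negP; apply.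
exact: essge_essle yM (f_le ft).
Qed.

Lemma essle_near x M : essle f x M -> \forall y \near x, (f y <= M%:E)%E.
Proof.
move=> [r r0 rM]; apply: filterS (sq_nbhs x r0) => y xy.
have [s s0 sr] := sq_sq xy.
have yM : essle f y M by exists s => //; apply: filterS rM => z rM /sr.
rewrite leNgt; apply/negP => /lte_between_real[t Mt tf].
move: Mt; rewrite lte_fin ltNge => /negP; apply.
exact: essge_essle (f_ge tf) yM.
Qed.

Lemma ereal_continuous x : {for x, continuous f}.
Proof.
apply: cvge_squeeze_real => M; first by move=> /f_ge/essge_near.
by move=> /f_le/essle_near.
Qed.

(** By the pointwise bounds, |f - f x| is at most any given e > 0 on small discs, and so are its
    averages. *)
Lemma fin_lebesgue_point x : f x \is a fin_num -> lebesgue_point f x.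
Proof.
move=> fx; split => //.
have mf := measurable_int _ fi.
have mh : measurable_fun [set: plane] (fun y => `|f y - f x|%E).
  by apply: measurableT_comp => //; apply: emeasurable_funB.
have small (e : R) : 0 < e -> exists2 s, 0 < s & forall y, sq x s y -> (`|f y - f x| <= e%:E)%E.
  move=> e0; have h : \forall y \near x, ((fine (f x) - e)%:E <= f y)%E /\
      (f y <= (fine (f x) + e)%:E)%E.
    apply: filterI; [apply: essge_near; apply: f_ge|apply: essle_near; apply: f_le].
      by rewrite -{2}(fineK fx) lte_fin gtrBl.
    by rewrite -{1}(fineK fx) lte_fin ltrDl.
  have /nbhs_ballP[s /= s0 sP] := h; exists s => // y /sqP[y1 y2].
  have [] : ((fine (f x) - e)%:E <= f y)%E /\ (f y <= (fine (f x) + e)%:E)%E.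
    by apply: sP; split; rewrite /ball/= distrC.
  have fE : f x = (fine (f x))%:E by rewrite fineK.
  rewrite [in X in _ -> _ -> X]fE; move: (fine (f x)) => a; case: (f y) => [r||] //=.
  by rewrite !lee_fin => h1 h2; rewrite ler_distl h1 h2.
have avg_ge0 r : (0 <= avg (fun y => `|f y - f x|%E) (disc x r))%E.
  by rewrite /avg mule_ge0 ?inve_ge0//; apply: integral_ge0 => y _; exact: abse_ge0.
apply: cvge_squeeze_real => M.
  rewrite lte_fin => M0; apply: nearW => r; apply: le_trans (avg_ge0 r).
  by rewrite lee_fin ltW.
rewrite lte_fin => M0; have [s s0 sM] := small _ M0.
apply: filterS (near0_disc x s0) => r [r0 rs]; rewrite -(avg_cst x M r0).
have mD := measurable_disc x r.
apply: le_avg => //; [|exact: integrable_disc_cst|by apply: aeW => y /rs /sM].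
apply: le_integrable (integrable_disc_cst x M r0) => //; first exact: measurable_funTS.
by move=> y /rs /sM yM; rewrite /= abse_id (le_trans yM)// lee_fin ler_norm.
Qed.

End main.

Theorem theorem5p15 (R : realType) (f : R * R -> \bar R)
  (f_precise : f = precise_rep f)
  (f_W11 : sobolev_W1 1 f) (f_W12 : sobolev_W1 2 f)
  (f_monotone : monotone_function f) :
  let X := [set x | f x = +oo%E] `|` [set x | f x = -oo%E] in
  [/\ (forall x y, f x = +oo%E -> f y = +oo%E -> x = y),
      (forall x y, f x = -oo%E -> f y = -oo%E -> x = y),
      continuous_at_points (~` X) f,
      approx_discontinuity_set f `<=` X &
      bounded_ereal f -> continuous_at_points [set: R * R] f].
Proof.
move=> X; have [g1 [g2 [N [gi gs N0 aclN fN]]]] := acl_data f_W11 f_W12.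
have dich := dichotomy f_monotone gi gs N0 aclN fN.
have fi : (@plane_measure R).-integrable setT f by apply: inL1_integrable; case: f_W11.
have ess x : (forall M : R, (M%:E < f x)%E -> essge f x M) /\
    (forall M : R, (f x < M%:E)%E -> essle f x M).
  have [L [Llo Lhi]] := ess_limit_exists dich x.
  suff -> : f x = L by [].
  (* The averages converge to the essential limit, so [f_precise] identifies it with the value
     [f x]. *)
  have cL := avg_cvg fi Llo Lhi.
  rewrite f_precise /precise_rep asboolT; first exact: cvg_lim cL.
  by apply/cvg_ex; exists L.
have f_ge x M := (ess x).1 M; have f_le x M := (ess x).2 M.
have cont x := ereal_continuous f_ge f_le x.
have finX x : ~ X x -> f x \is a fin_num.
  move=> Xx; rewrite fin_numE; apply/andP; split; apply/eqP => fx; apply: Xx; [by right|by left].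
(* In the maximum norm, open squares of radius half the distance are disjoint. *)
have far (x y : R * R) : x != y -> exists2 e : R, 0 < e & sq y e `<=` ~` sq x e.
  move=> xy; exists (`|x - y| / 2); first by rewrite divr_gt0// normr_gt0 subr_eq0.
  move=> z /sqP[zy1 zy2] /sqP[zx1 zx2].
  have : `|x - y| < `|x - y|.
    rewrite {1}prod_normE gt_max /=; apply/andP; split.
      by apply: (le_lt_trans (ler_distD z.1 _ _)); rewrite (distrC x.1) [ltRHS]splitr ltrD.
    by apply: (le_lt_trans (ler_distD z.2 _ _)); rewrite (distrC x.2) [ltRHS]splitr ltrD.
  by rewrite ltxx.
split.
- move=> x y fx fy; apply/eqP; apply: contrapT => /negP xy.
  have [e e0 eyx] := far x y xy.
  (* The bound [c + e] inside [K] contradicts the value at [x]; outside [K] it contradicts the value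
     at [y], whose square avoids [K]. The extra 1 separates the two essential bounds. *)
  have [K [c [[r r0 rK] Ke [up|up] _]]] := dich_sq dich x e0.
    have : c + e + 1 <= c + e.
      by apply: (@essge_essle R f x); [apply: f_ge; rewrite fx ltry|exists r => //; apply: filterS up => z up /rK].
    by rewrite gerDl ler10.
  have : c + e + 1 <= c + e.
    apply: (@essge_essle R f y); first by apply: f_ge; rewrite fy ltry.
    by exists e => //; apply: filterS up => z up /eyx xz; apply: up => /Ke.
  by rewrite gerDl ler10.
- move=> x y fx fy; apply/eqP; apply: contrapT => /negP xy.
  have [e e0 eyx] := far x y xy.
  have [K [c [[r r0 rK] Ke _ [lo|lo]]]] := dich_sq dich x e0.
    have : c - e <= c - e - 1.
      by apply: (@essge_essle R f x); [exists r => //; apply: filterS lo => z lo /rK|apply: f_le; rewrite fx ltNyr].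
    by rewrite lerBrDr gerDl ler10.
  have : c - e <= c - e - 1.
    apply: (@essge_essle R f y); last by apply: f_le; rewrite fy ltNyr.
    by exists e => //; apply: filterS lo => z lo /eyx xz; apply: lo => /Ke.
  by rewrite lerBrDr gerDl ler10.
- by move=> x Xx; split; [exact: finX|exact: cont].
- move=> x; apply: contraPP => Xx; apply; apply: (fin_lebesgue_point fi f_ge f_le).
  exact: finX.
- move=> [M fM] x _; split; last exact: cont.
  by rewrite fin_num_abs (le_lt_trans (fM x))// ltry.
Qed.
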